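(* Let $\mathbf{F}$ be a finite field of odd cardinality $q$ in which $-1$ is not a square. Let $\mathfrak{C}$ be the ultraproduct interpolation category of the finite symplectic groups over $\mathbf{F}$ and $A$ the twisted group algebra in $\mathfrak{C}$, as described in the context (with all ground fields $k_i=\mathbf{C}$, so that $t$ is transcendental over $\mathbf{Q}$). Then the class $[A]$ in the Brauer group $\mathrm{Br}(\mathfrak{C})$ generates a cyclic subgroup of order $4$.
   Context: Set-up. Let $I$ be an infinite set with a non-principal ultrafilter. For $i\in I$ let $E_i$ be a symplectic $\mathbf{F}$-vector space of finite dimension $d_i$, such that the ultralimit of $(d_i)$ in the ultrapower of $\mathbf{N}$ is not an integer. Let $G_i=\mathbf{Sp}(E_i)$, $k_i=\mathbf{C}$, $\mathfrak{C}_i$ the tensor category of finite-dimensional representations of $G_i$ over $k_i$, and $V_i=k_i[E_i]$ the permutation representation. Let $k$ be the ultraproduct of the $k_i$, $t\in k$ the ultralimit of the $q^{d_i}$, $\tilde{\mathfrak{C}}$ the ultraproduct of the $\mathfrak{C}_i$, $V\in\tilde{\mathfrak{C}}$ the object defined by $(V_i)$, and $\mathfrak{C}$ the full subcategory of $\tilde{\mathfrak{C}}$ consisting of subquotients of finite direct sums of tensor powers of $V$. Fix a non-trivial additive character $\psi\colon\mathbf{F}\to\mathbf{C}^\times$. Let $A_i=V_i$ with product $[x]\cdot[y]=\psi(\langle x,y\rangle)[x+y]$, an algebra in $\mathfrak{C}_i$, and let $A\in\mathfrak{C}$ be the ultralimit of the $A_i$; it is an Azumaya algebra. An Azumaya algebra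 in a tensor category is an algebra $A$ (associative, unital) with rigid underlying object for which $A\otimes A^{\mathrm{op}}\to\underline{\mathrm{End}}(A)$, $a\otimes b\mapsto(x\mapsto axb)$, is an isomorphism. Here $\underline{\mathrm{End}}(P)=P\otimes P^*$ for a rigid object $P$. The Brauer group $\mathrm{Br}(\mathfrak{C})$ (in the sense of Pareigis) is the group, under $\otimes$, of Azumaya algebras modulo the relation $A\sim B$ iff $A\otimes\underline{\mathrm{End}}(P)\cong B\otimes\underline{\mathrm{End}}(Q)$ as algebras for some non-zero rigid objects $P,Q$ of $\mathfrak{C}$. *)

(* Defs.v *)
From HB Require Import structures.
From Stdlib Require Setoid.
From mathcomp Require Import all_boot all_order all_algebra all_fingroup.
From mathcomp Require Import sesquilinear mxrepresentation.
From mathcomp Require Import complex mxtens.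
From mathcomp Require Import boolp classical_sets functions cardinality filter.
From mathcomp Require Import reals.

Set Implicit Arguments.
Unset Strict Implicit.
Unset Printing Implicit Defensive.

Import GRing.Theory.

Declare Scope tcat_scope.
Delimit Scope tcat_scope with tcat.
Reserved Notation "f =~ g" (at level 70, no associativity).
Reserved Notation "f ;; g" (at level 45, left associativity).
Reserved Notation "X ⊗ Y" (at level 40, left associativity).
Reserved Notation "f ⊠ g" (at level 40, left associativity).
Reserved Notation "𝟙".

(* Hom-sets are setoids, [heq] being the equality of morphisms, so that an
   ultraproduct of hom-sets is the full product with equality almost everywhere.
   Composition is diagrammatic: [hcomp f g] is f followed by g.
   Linearity over the ground field is not recorded separately: it is the action of
   End(𝟙). *)
Record tensorCat := TensorCat {
  ob :> Type;
  hom : ob -> ob -> Type;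
  heq : forall X Y, hom X Y -> hom X Y -> Prop;
  idm : forall X, hom X X;
  hcomp : forall X Y Z, hom X Y -> hom Y Z -> hom X Z;
  hzero : forall X Y, hom X Y;
  hadd : forall X Y, hom X Y -> hom X Y -> hom X Y;
  hopp : forall X Y, hom X Y -> hom X Y;
  tens : ob -> ob -> ob;
  tensm : forall X X' Y Y', hom X X' -> hom Y Y' -> hom (tens X Y) (tens X' Y');
  tunit : ob;
  assoc : forall X Y Z, hom (tens (tens X Y) Z) (tens X (tens Y Z));
  assocV : forall X Y Z, hom (tens X (tens Y Z)) (tens (tens X Y) Z);
  lunit : forall X, hom (tens tunit X) X;
  lunitV : forall X, hom X (tens tunit X);
  runit : forall X, hom (tens X tunit) X;
  runitV : forall X, hom X (tens X tunit);
  braid : forall X Y, hom (tens X Y) (tens Y X);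

  heq_refl : forall X Y (f : hom X Y), heq f f;
  heq_sym : forall X Y (f g : hom X Y), heq f g -> heq g f;
  heq_trans : forall X Y (f g h : hom X Y), heq f g -> heq g h -> heq f h;
  comp_heq : forall X Y Z (f f' : hom X Y), heq f f' ->
    forall (g g' : hom Y Z), heq g g' -> heq (hcomp f g) (hcomp f' g');
  hadd_heq : forall X Y (f f' : hom X Y), heq f f' ->
    forall (g g' : hom X Y), heq g g' -> heq (hadd f g) (hadd f' g');
  hopp_heq : forall X Y (f f' : hom X Y), heq f f' -> heq (hopp f) (hopp f');
  tensm_heq : forall X X' Y Y' (f f' : hom X X'), heq f f' ->
    forall (g g' : hom Y Y'), heq g g' -> heq (tensm f g) (tensm f' g');

  comp_id_l : forall X Y (f : hom X Y), heq (hcomp (idm X) f) f;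
  comp_id_r : forall X Y (f : hom X Y), heq (hcomp f (idm Y)) f;
  comp_assoc : forall X Y Z W (f : hom X Y) (g : hom Y Z) (h : hom Z W),
    heq (hcomp (hcomp f g) h) (hcomp f (hcomp g h));

  hadd_assoc : forall X Y (f g h : hom X Y),
    heq (hadd f (hadd g h)) (hadd (hadd f g) h);
  hadd_comm : forall X Y (f g : hom X Y), heq (hadd f g) (hadd g f);
  hadd_zero : forall X Y (f : hom X Y), heq (hadd (hzero X Y) f) f;
  hadd_opp : forall X Y (f : hom X Y), heq (hadd (hopp f) f) (hzero X Y);
  comp_add_l : forall X Y Z (f g : hom X Y) (h : hom Y Z),
    heq (hcomp (hadd f g) h) (hadd (hcomp f h) (hcomp g h));
  comp_add_r : forall X Y Z (f : hom X Y) (g h : hom Y Z),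
    heq (hcomp f (hadd g h)) (hadd (hcomp f g) (hcomp f h));

  tensm_id : forall X Y, heq (tensm (idm X) (idm Y)) (idm (tens X Y));
  tensm_comp : forall X X' X'' Y Y' Y''
    (f : hom X X') (f' : hom X' X'') (g : hom Y Y') (g' : hom Y' Y''),
    heq (tensm (hcomp f f') (hcomp g g')) (hcomp (tensm f g) (tensm f' g'));
  tensm_add_l : forall X X' Y Y' (f g : hom X X') (h : hom Y Y'),
    heq (tensm (hadd f g) h) (hadd (tensm f h) (tensm g h));
  tensm_add_r : forall X X' Y Y' (f : hom X X') (g h : hom Y Y'),
    heq (tensm f (hadd g h)) (hadd (tensm f g) (tensm f h));
  assocK : forall X Y Z, heq (hcomp (assoc X Y Z) (assocV X Y Z)) (idm _);
  assocVK : forall X Y Z, heq (hcomp (assocV X Y Z) (assoc X Y Z)) (idm _);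
  lunitK : forall X, heq (hcomp (lunit X) (lunitV X)) (idm _);
  lunitVK : forall X, heq (hcomp (lunitV X) (lunit X)) (idm _);
  runitK : forall X, heq (hcomp (runit X) (runitV X)) (idm _);
  runitVK : forall X, heq (hcomp (runitV X) (runit X)) (idm _);
  assoc_nat : forall X X' Y Y' Z Z' (f : hom X X') (g : hom Y Y') (h : hom Z Z'),
    heq (hcomp (tensm (tensm f g) h) (assoc X' Y' Z'))
        (hcomp (assoc X Y Z) (tensm f (tensm g h)));
  lunit_nat : forall X X' (f : hom X X'),
    heq (hcomp (tensm (idm tunit) f) (lunit X')) (hcomp (lunit X) f);
  runit_nat : forall X X' (f : hom X X'),
    heq (hcomp (tensm f (idm tunit)) (runit X')) (hcomp (runit X) f);
  triangle : forall X Y,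
    heq (hcomp (assoc X tunit Y) (tensm (idm X) (lunit Y)))
        (tensm (runit X) (idm Y));
  pentagon : forall X Y Z W,
    heq (hcomp (hcomp (tensm (assoc X Y Z) (idm W)) (assoc X (tens Y Z) W))
              (tensm (idm X) (assoc Y Z W)))
        (hcomp (assoc (tens X Y) Z W) (assoc X Y (tens Z W)));

  braid_nat : forall X X' Y Y' (f : hom X X') (g : hom Y Y'),
    heq (hcomp (tensm f g) (braid X' Y')) (hcomp (braid X Y) (tensm g f));
  braid_invol : forall X Y, heq (hcomp (braid X Y) (braid Y X)) (idm _);
  hexagon : forall X Y Z,
    heq (hcomp (hcomp (assoc X Y Z) (braid X (tens Y Z))) (assoc Y Z X))
        (hcomp (hcomp (tensm (braid X Y) (idm Z)) (assoc Y X Z))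
              (tensm (idm Y) (braid X Z)))
}.

Arguments hom {t}.
Arguments heq {t X Y}.
Arguments idm {t}.
Arguments hcomp {t X Y Z}.
Arguments hzero {t}.
Arguments hadd {t X Y}.
Arguments hopp {t X Y}.
Arguments tens {t}.
Arguments tensm {t X X' Y Y'}.
Arguments tunit {t}.
Arguments assoc {t}.
Arguments assocV {t}.
Arguments lunit {t}.
Arguments lunitV {t}.
Arguments runit {t}.
Arguments runitV {t}.
Arguments braid {t}.

Notation "f =~ g" := (heq f g) : tcat_scope.
Notation "f ;; g" := (hcomp f g) : tcat_scope.
Notation "X ⊗ Y" := (tens X Y) : tcat_scope.
Notation "f ⊠ g" := (tensm f g) : tcat_scope.
Notation "𝟙" := tunit : tcat_scope.

#[global] Instance heq_equiv (C : tensorCat) (X Y : C) :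
  RelationClasses.Equivalence (@heq C X Y).
Proof. by split; [exact: heq_refl|exact: heq_sym|exact: heq_trans]. Qed.
#[global] Instance comp_proper (C : tensorCat) (X Y Z : C) :
  Morphisms.Proper (Morphisms.respectful heq (Morphisms.respectful heq heq))
    (@hcomp C X Y Z).
Proof. exact: comp_heq. Qed.
#[global] Instance hadd_proper (C : tensorCat) (X Y : C) :
  Morphisms.Proper (Morphisms.respectful heq (Morphisms.respectful heq heq))
    (@hadd C X Y).
Proof. exact: hadd_heq. Qed.
#[global] Instance tensm_proper (C : tensorCat) (X X' Y Y' : C) :
  Morphisms.Proper (Morphisms.respectful heq (Morphisms.respectful heq heq))
    (@tensm C X X' Y Y').
Proof. exact: tensm_heq. Qed.
#[global] Hint Resolve heq_refl : core.

Local Open Scope classical_set_scope.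
Local Open Scope tcat_scope.

Section CategoricalNotions.
Variable C : tensorCat.
Implicit Types X Y Z M N T V : C.

Definition is_inverse X Y (f : hom X Y) (g : hom Y X) :=
  f ;; g =~ idm X /\ g ;; f =~ idm Y.
Definition is_iso X Y (f : hom X Y) := exists g, is_inverse f g.
Definition is_zero X := idm X =~ hzero X X.
Definition is_mono X Y (f : hom X Y) :=
  forall T (g h : hom T X), g ;; f =~ h ;; f -> g =~ h.
Definition is_epi X Y (f : hom X Y) :=
  forall T (g h : hom Y T), f ;; g =~ f ;; h -> g =~ h.
Definition subquotient X Y :=
  exists Z (m : hom Z Y) (e : hom Z X), is_mono m /\ is_epi e.

Definition is_biproduct X Y M :=
  exists (i : hom X M) (j : hom Y M) (p : hom M X) (q : hom M Y),
    [/\ i ;; p =~ idm X, j ;; q =~ idm Y, i ;; q =~ hzero X Y,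
        j ;; p =~ hzero Y X & hadd (p ;; i) (q ;; j) =~ idm M].

Fixpoint tpow V (n : nat) : C := if n is n'.+1 then V ⊗ tpow V n' else 𝟙.

Inductive sum_of_powers V : C -> Prop :=
| Sop_zero M : is_zero M -> sum_of_powers V M
| Sop_pow n : sum_of_powers V (tpow V n)
| Sop_add X Y M : sum_of_powers V X -> sum_of_powers V Y ->
    is_biproduct X Y M -> sum_of_powers V M.

Definition in_gen V X := exists2 M, sum_of_powers V M & subquotient X M.

Definition is_dual X Y (e : hom (Y ⊗ X) 𝟙) (c : hom 𝟙 (X ⊗ Y)) :=
  lunitV X ;; c ⊠ idm X ;; assoc X Y X ;; idm X ⊠ e ;; runit X =~ idm X /\
  runitV Y ;; idm Y ⊠ c ;; assocV Y X Y ;; e ⊠ idm Y ;; lunit Y =~ idm Y.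

Record dual_of X := DualOf {
  dob : C;
  ev : hom (dob ⊗ X) 𝟙;
  coev : hom 𝟙 (X ⊗ dob);
  dual_ofP : is_dual ev coev
}.

Definition dualizable X :=
  (exists Y (e : hom (Y ⊗ X) 𝟙) (c : hom 𝟙 (X ⊗ Y)), is_dual e c) /\
  (exists Y (e : hom (X ⊗ Y) 𝟙) (c : hom 𝟙 (Y ⊗ X)), is_dual e c).

End CategoricalNotions.

Arguments sum_of_powers {C} V M.
Arguments in_gen {C} V X.
Arguments dual_of {C} X.

Section GeneratedClosed.
Variable C : tensorCat.
Implicit Types X Y Z M N T V : C.

Lemma hadd_idem X Y (f : hom X Y) : hadd f f =~ f -> f =~ hzero X Y.
Proof.
move=> ff; rewrite -(hadd_zero f) -{1}(hadd_opp f) -hadd_assoc ff.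
exact: hadd_opp.
Qed.

Lemma comp0m X Y Z (f : hom Y Z) : hzero X Y ;; f =~ hzero X Z.
Proof. by apply: hadd_idem; rewrite -comp_add_l hadd_zero. Qed.
Lemma compm0 X Y Z (f : hom X Y) : f ;; hzero Y Z =~ hzero X Z.
Proof. by apply: hadd_idem; rewrite -comp_add_r hadd_zero. Qed.
Lemma tens0m X X' Y Y' (f : hom Y Y') : hzero X X' ⊠ f =~ hzero _ _.
Proof. by apply: hadd_idem; rewrite -tensm_add_l hadd_zero. Qed.
Lemma tensm0 X X' Y Y' (f : hom X X') : f ⊠ hzero Y Y' =~ hzero _ _.
Proof. by apply: hadd_idem; rewrite -tensm_add_r hadd_zero. Qed.

Lemma tensl_comp X Y Y' Y'' (f : hom Y Y') (g : hom Y' Y'') :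
  idm X ⊠ (f ;; g) =~ idm X ⊠ f ;; idm X ⊠ g.
Proof. by rewrite -tensm_comp comp_id_l. Qed.
Lemma tensr_comp X Y Y' Y'' (f : hom Y Y') (g : hom Y' Y'') :
  (f ;; g) ⊠ idm X =~ f ⊠ idm X ;; g ⊠ idm X.
Proof. by rewrite -tensm_comp comp_id_l. Qed.
Lemma tens_exch X X' Y Y' (f : hom X X') (g : hom Y Y') :
  f ⊠ idm Y ;; idm X' ⊠ g =~ idm X ⊠ g ;; f ⊠ idm Y'.
Proof. by rewrite -!tensm_comp !comp_id_l !comp_id_r. Qed.

Lemma assocV_nat X X' Y Y' Z Z' (f : hom X X') (g : hom Y Y') (h : hom Z Z') :
  f ⊠ (g ⊠ h) ;; assocV X' Y' Z' =~ assocV X Y Z ;; (f ⊠ g) ⊠ h.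
Proof.
rewrite -(comp_id_l (f ⊠ (g ⊠ h))) -assocVK !comp_assoc -(comp_assoc (assoc _ _ _)).
by rewrite -assoc_nat comp_assoc assocK comp_id_r.
Qed.
Lemma lunitV_nat X X' (f : hom X X') : f ;; lunitV X' =~ lunitV X ;; idm 𝟙 ⊠ f.
Proof.
rewrite -{1}(comp_id_l f) -{1}(lunitVK X) !comp_assoc -(comp_assoc (lunit _)) -lunit_nat.
by rewrite !comp_assoc lunitK comp_id_r.
Qed.
Lemma runitV_nat X X' (f : hom X X') : f ;; runitV X' =~ runitV X ;; f ⊠ idm 𝟙.
Proof.
rewrite -{1}(comp_id_l f) -{1}(runitVK X) !comp_assoc -(comp_assoc (runit _)) -runit_nat.
by rewrite !comp_assoc runitK comp_id_r.
Qed.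

Lemma comp_cancell X Y Z (f : hom X Y) (f' : hom Y X) (g h : hom Y Z) :
  f' ;; f =~ idm Y -> f ;; g =~ f ;; h -> g =~ h.
Proof.
by move=> ff e; rewrite -(comp_id_l g) -(comp_id_l h) -ff !comp_assoc e.
Qed.

Lemma unit_faithful X Y (f g : hom X Y) : idm 𝟙 ⊠ f =~ idm 𝟙 ⊠ g -> f =~ g.
Proof.
by move=> e; apply: (comp_cancell (lunitVK X)); rewrite -!lunit_nat e.
Qed.

Lemma lunit_tens X A : assoc 𝟙 X A ;; lunit (X ⊗ A) =~ lunit X ⊠ idm A.
Proof.
apply: unit_faithful; rewrite tensl_comp.
apply: (comp_cancell (assocVK 𝟙 (𝟙 ⊗ X) A)).
have e : assocV 𝟙 𝟙 X ⊠ idm A ;; assoc 𝟙 𝟙 X ⊠ idm A =~ idm _.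
  by rewrite -tensr_comp assocVK tensm_id.
apply: (comp_cancell e).
rewrite -!comp_assoc pentagon comp_assoc triangle -tensm_id -assoc_nat.
rewrite -triangle tensr_comp !comp_assoc.
by rewrite -assoc_nat.
Qed.

Lemma lunitV_tens X A : lunitV (X ⊗ A) ;; assocV 𝟙 X A =~ lunitV X ⊠ idm A.
Proof.
apply: (comp_cancell (f := lunit X ⊠ idm A) (f' := lunitV X ⊠ idm A)).
  by rewrite -tensr_comp lunitVK tensm_id.
rewrite -tensr_comp lunitK tensm_id -lunit_tens !comp_assoc.
by rewrite -(comp_assoc (lunit _)) lunitK comp_id_l assocK.
Qed.

Lemma tens_mono X A B (f : hom A B) :
  dualizable X -> is_mono f -> is_mono (idm X ⊠ f).
Proof.
move=> [[Y [e [c [zig _]]]] _] fm T g h gh.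
pose tr T' A' (k : hom T' (X ⊗ A')) :=
  idm Y ⊠ k ;; assocV Y X A' ;; e ⊠ idm A' ;; lunit A'.
have trK T' A' (k : hom T' (X ⊗ A')) :
  lunitV T' ;; c ⊠ idm T' ;; assoc X Y T' ;; idm X ⊠ tr T' A' k =~ k.
  rewrite /tr !tensl_comp -!comp_assoc.
  rewrite (comp_assoc _ (assoc _ _ _)) -assoc_nat tensm_id -!comp_assoc.
  rewrite (comp_assoc _ (c ⊠ _)) tens_exch -!comp_assoc -lunitV_nat !comp_assoc.
  rewrite -{2}(comp_id_r k); apply: comp_heq => //.
  rewrite -(comp_assoc (assoc X Y (X ⊗ A'))).
  have -> : assoc X Y (X ⊗ A') ;; idm X ⊠ assocV Y X A' =~
      assocV (X ⊗ Y) X A' ;; assoc X Y X ⊠ idm A' ;; assoc X (Y ⊗ X) A'.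
    apply: (comp_cancell (assocVK (X ⊗ Y) X A')).
    rewrite -!comp_assoc assocK comp_id_l -pentagon !comp_assoc -tensl_comp.
    by rewrite assocK tensm_id comp_id_r.
  rewrite !comp_assoc -(comp_assoc (assoc X (Y ⊗ X) A')) -assoc_nat.
  rewrite !comp_assoc triangle -(comp_assoc (c ⊠ _)).
  rewrite -{1}(tensm_id X A') assocV_nat !comp_assoc -(comp_assoc (lunitV _)).
  by rewrite lunitV_tens -!tensr_comp -!comp_assoc zig tensm_id.
have trf k : tr T B (k ;; idm X ⊠ f) =~ tr T A k ;; f.
  rewrite /tr tensl_comp !comp_assoc -lunit_nat -(comp_assoc (e ⊠ _)) tens_exch.
  by rewrite -(comp_assoc (idm Y ⊠ (idm X ⊠ f))) assocV_nat tensm_id !comp_assoc.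
rewrite -(trK _ _ g) -(trK _ _ h); apply: comp_heq => //; apply: tensm_heq => //.
by apply: fm; rewrite -!trf /tr gh.
Qed.

Lemma tens_epi X A B (f : hom A B) :
  dualizable X -> is_epi f -> is_epi (idm X ⊠ f).
Proof.
move=> [_ [Y [e [c [_ zag]]]]] fe T g h gh.
pose tr A' T' (k : hom (X ⊗ A') T') :=
  lunitV A' ;; c ⊠ idm A' ;; assoc Y X A' ;; idm Y ⊠ k.
have trK A' T' (k : hom (X ⊗ A') T') :
  idm X ⊠ tr A' T' k ;; assocV X Y T' ;; e ⊠ idm T' ;; lunit T' =~ k.
  rewrite /tr !tensl_comp !comp_assoc.
  rewrite -(comp_assoc (idm X ⊠ (idm Y ⊠ k))) assocV_nat tensm_id !comp_assoc.
  rewrite -(comp_assoc ((idm (X ⊗ Y)) ⊠ k)) -tens_exch !comp_assoc lunit_nat.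
  rewrite -!comp_assoc -{2}(comp_id_l k); apply: comp_heq => //.
  rewrite (comp_assoc _ _ (assocV X Y (X ⊗ A'))).
  have -> : idm X ⊠ assoc Y X A' ;; assocV X Y (X ⊗ A') =~
      assocV X (Y ⊗ X) A' ;; assocV X Y X ⊠ idm A' ;; assoc (X ⊗ Y) X A'.
    apply: (comp_cancell (assocVK X (Y ⊗ X) A')).
    have e' : assocV X Y X ⊠ idm A' ;; assoc X Y X ⊠ idm A' =~ idm _.
      by rewrite -tensr_comp assocVK tensm_id.
    apply: (comp_cancell e').
    rewrite -!comp_assoc pentagon !comp_assoc assocK comp_id_r.
    rewrite -(comp_assoc (assoc X _ _)) assocK comp_id_l -comp_assoc.
    by rewrite -tensr_comp assocK tensm_id comp_id_l.
  rewrite -!comp_assoc (comp_assoc _ _ (assocV X (Y ⊗ X) A')) assocV_nat.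
  rewrite -!comp_assoc.
  have -> : idm X ⊠ lunitV A' ;; assocV X 𝟙 A' =~ runitV X ⊠ idm A'.
    have e' : idm X ⊠ lunitV A' ;; idm X ⊠ lunit A' =~ idm _.
      by rewrite -tensl_comp lunitVK tensm_id.
    apply: (comp_cancell (f := runit X ⊠ idm A') (f' := runitV X ⊠ idm A')).
      by rewrite -tensr_comp runitVK tensm_id.
    rewrite -tensr_comp runitK tensm_id -triangle !comp_assoc.
    rewrite -(comp_assoc (idm X ⊠ lunit A')) -tensl_comp lunitK tensm_id.
    by rewrite comp_id_l assocK.
  have -> : e ⊠ idm (X ⊗ A') =~ e ⊠ (idm X ⊠ idm A') by rewrite tensm_id.
  rewrite (comp_assoc _ _ (e ⊠ _)) -assoc_nat.
  rewrite -!comp_assoc (comp_assoc _ _ (lunit _)) lunit_tens.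
  by rewrite -!tensr_comp zag tensm_id.
have trf k : tr A T (idm X ⊠ f ;; k) =~ f ;; tr B T k.
  rewrite /tr tensl_comp -!comp_assoc lunitV_nat (comp_assoc (lunitV A) (_ ⊠ f)).
  rewrite -tens_exch -!comp_assoc (comp_assoc _ (_ ⊠ f) (assoc Y X B)) -tensm_id.
  by rewrite assoc_nat -!comp_assoc.
rewrite -(trK _ _ g) -(trK _ _ h); apply: comp_heq => //.
apply: comp_heq => //; apply: comp_heq => //; apply: tensm_heq => //.
by apply: fe; rewrite -!trf /tr gh.
Qed.

Definition isomorphic X Y := exists f : hom X Y, is_iso f.

Lemma iso_refl X : isomorphic X X.
Proof. by exists (idm X), (idm X); split; rewrite comp_id_l. Qed.
Lemma iso_sym X Y : isomorphic X Y -> isomorphic Y X.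
Proof. by move=> [f [g [fg gf]]]; exists g, f. Qed.
Lemma iso_trans X Y Z : isomorphic X Y -> isomorphic Y Z -> isomorphic X Z.
Proof.
move=> [f [g [fg gf]]] [h [k [hk kh]]]; exists (f ;; h), (k ;; g); split.
  by rewrite comp_assoc -(comp_assoc h) hk comp_id_l.
by rewrite comp_assoc -(comp_assoc g) gf comp_id_l.
Qed.
Lemma iso_tens X X' Y Y' :
  isomorphic X X' -> isomorphic Y Y' -> isomorphic (X ⊗ Y) (X' ⊗ Y').
Proof.
move=> [f [g [fg gf]]] [h [k [hk kh]]]; exists (f ⊠ h), (g ⊠ k).
by split; rewrite -tensm_comp ?fg ?hk ?gf ?kh tensm_id.
Qed.
Lemma iso_assoc X Y Z : isomorphic ((X ⊗ Y) ⊗ Z) (X ⊗ (Y ⊗ Z)).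
Proof. by exists (assoc X Y Z), (assocV X Y Z); split; rewrite ?assocK ?assocVK. Qed.
Lemma iso_lunit X : isomorphic (𝟙 ⊗ X) X.
Proof. by exists (lunit X), (lunitV X); split; rewrite ?lunitK ?lunitVK. Qed.
Lemma iso_runit X : isomorphic (X ⊗ 𝟙) X.
Proof. by exists (runit X), (runitV X); split; rewrite ?runitK ?runitVK. Qed.
Lemma iso_braid X Y : isomorphic (X ⊗ Y) (Y ⊗ X).
Proof. by exists (braid X Y), (braid Y X); split; rewrite braid_invol. Qed.

Lemma iso_tpow V m n : isomorphic (tpow V (m + n)) (tpow V m ⊗ tpow V n).
Proof.
elim: m => [|m IH] /=; first exact/iso_sym/iso_lunit.
apply: iso_trans (iso_sym (iso_assoc _ _ _)).
exact: iso_tens (iso_refl _) IH.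
Qed.

Lemma iso_biproduct X Y M Z1 Z2 W : isomorphic Z1 X -> isomorphic Z2 Y ->
  isomorphic W M -> is_biproduct X Y M -> is_biproduct Z1 Z2 W.
Proof.
move=> [f [f' [ff' f'f]]] [g [g' [gg' g'g]]] [h [h' [hh' h'h]]].
move=> [i [j [p [q [ip jq iq jp e]]]]].
have K (A B D E : C) (a : hom A B) (b : hom B M) (d : hom M D) (e' : hom D E) :
  (a ;; b ;; h') ;; (h ;; d ;; e') =~ a ;; (b ;; d) ;; e'.
  by rewrite !comp_assoc -(comp_assoc h') h'h comp_id_l.
exists (f ;; i ;; h'), (g ;; j ;; h'), (h ;; p ;; f'), (h ;; q ;; g').
split; rewrite ?K ?ip ?jq ?iq ?jp ?compm0 ?comp0m ?comp_id_r //.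
rewrite !(comp_assoc h) -!(comp_assoc _ _ h') !(comp_assoc p f') !(comp_assoc q g').
rewrite -!(comp_assoc f') -!(comp_assoc g') f'f g'g !comp_id_l.
rewrite -!(comp_assoc h) !(comp_assoc h) -!comp_add_r -comp_add_l e.
by rewrite comp_id_l.
Qed.

Lemma biproduct_tensr X Y M N :
  is_biproduct X Y M -> is_biproduct (X ⊗ N) (Y ⊗ N) (M ⊗ N).
Proof.
move=> [i [j [p [q [ip jq iq jp e]]]]].
exists (i ⊠ idm N), (j ⊠ idm N), (p ⊠ idm N), (q ⊠ idm N).
by split; rewrite -!tensr_comp ?ip ?jq ?iq ?jp -?tensm_add_l ?e
  ?tens0m ?tensm_id.
Qed.

Lemma zero_tensr M N : is_zero M -> is_zero (M ⊗ N).
Proof. by rewrite /is_zero -tensm_id => ->; exact: tens0m. Qed.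

Lemma iso_zero M N : isomorphic M N -> is_zero N -> is_zero M.
Proof.
move=> [f [g [fg _]]]; rewrite /is_zero => z.
by rewrite -fg -(comp_id_r f) z compm0 comp0m.
Qed.

Lemma sum_of_powers_tens V M N : sum_of_powers V M -> sum_of_powers V N ->
  exists2 W, sum_of_powers V W & isomorphic W (M ⊗ N).
Proof.
move=> sM sN.
elim: sM => {M} [M zM|m|X Y M _ [W1 s1 i1] _ [W2 s2 i2] bM].
- by exists (M ⊗ N); [exact/Sop_zero/zero_tensr|exact: iso_refl].
- elim: sN => {N} [N zN|n|X Y N _ [W1 s1 i1] _ [W2 s2 i2] bN].
  + exists (tpow V m ⊗ N); last exact: iso_refl.
    apply: Sop_zero; apply: iso_zero (iso_braid _ _) _; exact: zero_tensr.
  + by exists (tpow V (m + n)); [exact: Sop_pow|exact: iso_tpow].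
  + exists (tpow V m ⊗ N); last exact: iso_refl.
    apply: (Sop_add s1 s2).
    apply: iso_biproduct (biproduct_tensr (tpow V m) bN); last exact: iso_braid.
      exact: iso_trans i1 (iso_braid _ _).
    exact: iso_trans i2 (iso_braid _ _).
- exists (M ⊗ N); last exact: iso_refl.
  apply: (Sop_add s1 s2).
  exact: iso_biproduct i1 i2 (iso_refl _) (biproduct_tensr N bM).
Qed.

Lemma tens_mono_r X A B (f : hom A B) :
  dualizable X -> is_mono f -> is_mono (f ⊠ idm X).
Proof.
move=> dX fm T g h gh.
have K (k : hom T (A ⊗ X)) : k ;; braid A X ;; braid X A =~ k.
  by rewrite comp_assoc braid_invol comp_id_r.
rewrite -(K g) -(K h); apply: comp_heq => //; apply: (tens_mono dX fm).
by rewrite !comp_assoc -braid_nat -!comp_assoc gh.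
Qed.

Lemma tens_epi_r X A B (f : hom A B) :
  dualizable X -> is_epi f -> is_epi (f ⊠ idm X).
Proof.
move=> dX fe T g h gh.
have K (k : hom (B ⊗ X) T) : braid B X ;; (braid X B ;; k) =~ k.
  by rewrite -comp_assoc braid_invol comp_id_l.
rewrite -(K g) -(K h); apply: comp_heq => //; apply: (tens_epi dX fe).
by rewrite -!comp_assoc braid_nat !comp_assoc gh.
Qed.

Lemma mono_comp X Y Z (f : hom X Y) (g : hom Y Z) :
  is_mono f -> is_mono g -> is_mono (f ;; g).
Proof. by move=> mf mg T a b; rewrite -!comp_assoc => /mg /mf. Qed.
Lemma epi_comp X Y Z (f : hom X Y) (g : hom Y Z) :
  is_epi f -> is_epi g -> is_epi (f ;; g).
Proof. by move=> ef eg T a b; rewrite !comp_assoc => /ef /eg. Qed.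
Lemma mono_iso X Y (f : hom X Y) : is_iso f -> is_mono f.
Proof.
move=> [f' [ff' _]] T g h gh.
by rewrite -(comp_id_r g) -(comp_id_r h) -ff' -!comp_assoc gh.
Qed.
Lemma epi_iso X Y (f : hom X Y) : is_iso f -> is_epi f.
Proof. by move=> [f' [_ ff']] T g h gh; apply: (comp_cancell ff' gh). Qed.
Lemma tens_as_comp X X' Y Y' (f : hom X X') (g : hom Y Y') :
  f ⊠ g =~ f ⊠ idm Y ;; idm X' ⊠ g.
Proof. by rewrite -tensm_comp comp_id_l comp_id_r. Qed.

Lemma subquotient_iso X Y M :
  isomorphic X Y -> sum_of_powers M Y -> in_gen M X.
Proof.
move=> [f fi] sY; exists Y => //; exists X, f, (idm X).
by split; [exact: mono_iso|move=> T g h; rewrite !comp_id_l].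
Qed.

Lemma in_gen_tunit V : in_gen V 𝟙.
Proof. exact: subquotient_iso (iso_refl _) (Sop_pow V 0). Qed.

Lemma in_gen_self V : in_gen V V.
Proof. exact: subquotient_iso (iso_sym (iso_runit _)) (Sop_pow V 1). Qed.

Lemma in_gen_tens V X Y : (forall Z, dualizable Z) ->
  in_gen V X -> in_gen V Y -> in_gen V (X ⊗ Y).
Proof.
move=> dual [M sM [Z [m [e [mm ee]]]]] [M' sM' [Z' [m' [e' [mm' ee']]]]].
have [W sW [f fiso]] := sum_of_powers_tens sM sM'.
have [f' [ff' f'f]] := fiso.
exists W => //; exists (Z ⊗ Z'), (m ⊠ m' ;; f'), (e ⊠ e'); split.
  apply: mono_comp; last by apply: mono_iso; exists f.
  have h := mono_comp (tens_mono_r (dual Z') mm) (tens_mono (dual M) mm').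
  by move=> T a b; rewrite tens_as_comp => /h.
have h := epi_comp (tens_epi_r (dual Z') ee) (tens_epi (dual X) ee').
by move=> T a b; rewrite tens_as_comp => /h.
Qed.

End GeneratedClosed.

Section FullSubcategory.
Variables (C : tensorCat) (P : C -> Prop).
Hypothesis P1 : P 𝟙.
Hypothesis PT : forall X Y, P X -> P Y -> P (X ⊗ Y).

Definition full_subcat : tensorCat.
Proof.
refine (@TensorCat {X : C | P X}
  (fun X Y => hom (sval X) (sval Y)) (fun X Y => @heq C _ _)
  (fun X => idm (sval X)) (fun X Y Z => @hcomp C _ _ _)
  (fun X Y => hzero _ _) (fun X Y => @hadd C _ _) (fun X Y => @hopp C _ _)
  (fun X Y => exist _ (sval X ⊗ sval Y) (PT (svalP X) (svalP Y)))
  (fun X X' Y Y' => @tensm C _ _ _ _) (exist _ 𝟙 P1)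
  (fun X Y Z => assoc _ _ _) (fun X Y Z => assocV _ _ _)
  (fun X => lunit _) (fun X => lunitV _) (fun X => runit _) (fun X => runitV _)
  (fun X Y => braid _ _)
  _ _ _ _ _ _ _ _ _ _ _ _ _ _ _ _ _ _ _ _ _ _ _ _ _ _ _ _ _ _ _ _ _ _) => /=.
- by move=> *; exact: heq_refl.
- by move=> *; exact: heq_sym.
- by move=> X Y f g h; exact: heq_trans.
- by move=> *; exact: comp_heq.
- by move=> *; exact: hadd_heq.
- by move=> *; exact: hopp_heq.
- by move=> *; exact: tensm_heq.
- by move=> *; exact: comp_id_l.
- by move=> *; exact: comp_id_r.
- by move=> *; exact: comp_assoc.
- by move=> *; exact: hadd_assoc.
- by move=> *; exact: hadd_comm.
- by move=> *; exact: hadd_zero.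
- by move=> *; exact: hadd_opp.
- by move=> *; exact: comp_add_l.
- by move=> *; exact: comp_add_r.
- by move=> *; exact: tensm_id.
- by move=> *; exact: tensm_comp.
- by move=> *; exact: tensm_add_l.
- by move=> *; exact: tensm_add_r.
- by move=> *; exact: assocK.
- by move=> *; exact: assocVK.
- by move=> *; exact: lunitK.
- by move=> *; exact: lunitVK.
- by move=> *; exact: runitK.
- by move=> *; exact: runitVK.
- by move=> *; exact: assoc_nat.
- by move=> *; exact: lunit_nat.
- by move=> *; exact: runit_nat.
- by move=> *; exact: triangle.
- by move=> *; exact: pentagon.
- by move=> *; exact: braid_nat.
- by move=> *; exact: braid_invol.
- by move=> *; exact: hexagon.
Defined.

End FullSubcategory.

Section Ultraproduct.
Variables (I : Type) (U : set_system I).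
Context {FU : Filter U}.
Variable C : I -> tensorCat.

Definition ultraproduct : tensorCat.
Proof.
refine (@TensorCat (forall i, C i)
  (fun X Y => forall i, hom (X i) (Y i))
  (fun X Y f g => U [set i | f i =~ g i])
  (fun X i => idm (X i)) (fun X Y Z f g i => f i ;; g i)
  (fun X Y i => hzero (X i) (Y i)) (fun X Y f g i => hadd (f i) (g i))
  (fun X Y f i => hopp (f i))
  (fun X Y i => X i ⊗ Y i) (fun X X' Y Y' f g i => f i ⊠ g i)
  (fun i => 𝟙)
  (fun X Y Z i => assoc (X i) (Y i) (Z i))
  (fun X Y Z i => assocV (X i) (Y i) (Z i))
  (fun X i => lunit (X i)) (fun X i => lunitV (X i))
  (fun X i => runit (X i)) (fun X i => runitV (X i))
  (fun X Y i => braid (X i) (Y i))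
  _ _ _ _ _ _ _ _ _ _ _ _ _ _ _ _ _ _ _ _ _ _ _ _ _ _ _ _ _ _ _ _ _ _) => /=.
- by move=> *; apply: filterE => i /=; exact: heq_refl.
- by move=> X Y f g; apply: filterS => i /=; exact: heq_sym.
- by move=> X Y f g h; apply: filterS2 => i /=; exact: heq_trans.
- by move=> X Y Z f f' + g g'; apply: filterS2 => i /= ? ?; exact: comp_heq.
- by move=> X Y f f' + g g'; apply: filterS2 => i /= ? ?; exact: hadd_heq.
- by move=> X Y f f'; apply: filterS => i /=; exact: hopp_heq.
- by move=> X X' Y Y' f f' + g g'; apply: filterS2 => i /= ? ?; exact: tensm_heq.
- by move=> *; apply: filterE => i /=; exact: comp_id_l.
- by move=> *; apply: filterE => i /=; exact: comp_id_r.
- by move=> *; apply: filterE => i /=; exact: comp_assoc.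
- by move=> *; apply: filterE => i /=; exact: hadd_assoc.
- by move=> *; apply: filterE => i /=; exact: hadd_comm.
- by move=> *; apply: filterE => i /=; exact: hadd_zero.
- by move=> *; apply: filterE => i /=; exact: hadd_opp.
- by move=> *; apply: filterE => i /=; exact: comp_add_l.
- by move=> *; apply: filterE => i /=; exact: comp_add_r.
- by move=> *; apply: filterE => i /=; exact: tensm_id.
- by move=> *; apply: filterE => i /=; exact: tensm_comp.
- by move=> *; apply: filterE => i /=; exact: tensm_add_l.
- by move=> *; apply: filterE => i /=; exact: tensm_add_r.
- by move=> *; apply: filterE => i /=; exact: assocK.
- by move=> *; apply: filterE => i /=; exact: assocVK.
- by move=> *; apply: filterE => i /=; exact: lunitK.
- by move=> *; apply: filterE => i /=; exact: lunitVK.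
- by move=> *; apply: filterE => i /=; exact: runitK.
- by move=> *; apply: filterE => i /=; exact: runitVK.
- by move=> *; apply: filterE => i /=; exact: assoc_nat.
- by move=> *; apply: filterE => i /=; exact: lunit_nat.
- by move=> *; apply: filterE => i /=; exact: runit_nat.
- by move=> *; apply: filterE => i /=; exact: triangle.
- by move=> *; apply: filterE => i /=; exact: pentagon.
- by move=> *; apply: filterE => i /=; exact: braid_nat.
- by move=> *; apply: filterE => i /=; exact: braid_invol.
- by move=> *; apply: filterE => i /=; exact: hexagon.
Defined.

Lemma ultraproduct_dualizable :
  (forall i (X : C i), dualizable X) -> forall X : ultraproduct, dualizable X.
Proof.
move=> dC X; split.
- have h i : {Y : {Y : C i & {e : hom (Y ⊗ X i) 𝟙 & hom 𝟙 (X i ⊗ Y)}} |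
      is_dual (projT1 (projT2 Y)) (projT2 (projT2 Y))}.
    by apply: cid; have [[Y [e [c d]]] _] := dC i (X i); exists (existT _ Y (existT _ e c)).
  exists (fun i => projT1 (sval (h i)) : C i).
  exists (fun i => projT1 (projT2 (sval (h i)))), (fun i => projT2 (projT2 (sval (h i)))).
  by split; apply: filterE => i; have [] := svalP (h i).
- have h i : {Y : {Y : C i & {e : hom (X i ⊗ Y) 𝟙 & hom 𝟙 (Y ⊗ X i)}} |
      is_dual (projT1 (projT2 Y)) (projT2 (projT2 Y))}.
    by apply: cid; have [_ [Y [e [c d]]]] := dC i (X i); exists (existT _ Y (existT _ e c)).
  exists (fun i => projT1 (sval (h i)) : C i).
  exists (fun i => projT1 (projT2 (sval (h i)))), (fun i => projT2 (projT2 (sval (h i)))).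
  by split; apply: filterE => i; have [] := svalP (h i).
Qed.

End Ultraproduct.

Arguments ultraproduct {I} U {FU} C.

Record algebra (C : tensorCat) := Algebra {
  aobj :> C;
  amul : hom (aobj ⊗ aobj) aobj;
  aone : hom 𝟙 aobj
}.

Section Algebras.
Variable C : tensorCat.
Implicit Types (X Y Z W P Q : C) (A B : algebra C).

Definition alg_laws A :=
  [/\ amul A ⊠ idm A ;; amul A =~ assoc A A A ;; idm A ⊠ amul A ;; amul A,
      aone A ⊠ idm A ;; amul A =~ lunit A &
      idm A ⊠ aone A ;; amul A =~ runit A].

Definition alg_iso A B := exists f : hom A B,
  [/\ is_iso f, amul A ;; f =~ f ⊠ f ;; amul B & aone A ;; f =~ aone B].

Definition unit_alg : algebra C := Algebra (lunit 𝟙) (idm 𝟙).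

Definition swap_mid X Y Z W : hom ((X ⊗ Y) ⊗ (Z ⊗ W)) ((X ⊗ Z) ⊗ (Y ⊗ W)) :=
  assoc X Y (Z ⊗ W)
  ;; idm X ⊠ (assocV Y Z W ;; braid Y Z ⊠ idm W ;; assoc Z Y W)
  ;; assocV X Z (Y ⊗ W).

Definition tens_alg A B : algebra C :=
  @Algebra C (A ⊗ B) (swap_mid A B A B ;; amul A ⊠ amul B)
    (lunitV 𝟙 ;; aone A ⊠ aone B).

Definition op_alg A : algebra C := Algebra (braid A A ;; amul A) (aone A).

(* (p ⊗ ξ) (q ⊗ η) = p ⊗ ξ(q) η *)
Definition end_alg P (D : dual_of P) : algebra C :=
  @Algebra C (P ⊗ dob D)
    (assoc P (dob D) (P ⊗ dob D)
     ;; idm P ⊠ (assocV (dob D) P (dob D) ;; ev D ⊠ idm (dob D) ;; lunit (dob D)))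
    (coev D).

(* a ⊗ b ↦ (x ↦ a x b), as the composite
   a ⊗ b ↦ Σ (a ⊗ b) ⊗ (x ⊗ ξ) ↦ Σ a (x b) ⊗ ξ over dual bases x, ξ *)
Definition sandwich A (D : dual_of (aobj A)) :
    hom (A ⊗ op_alg A) (end_alg D) :=
  runitV (A ⊗ A) ;; idm (A ⊗ A) ⊠ coev D ;; assocV (A ⊗ A) A (dob D)
  ;; (assoc A A A ;; idm A ⊠ (braid A A ;; amul A) ;; amul A) ⊠ idm (dob D).

Definition azumaya A :=
  alg_laws A /\ exists D : dual_of (aobj A), is_iso (sandwich D).

Definition brauer_equiv A B := exists P Q (D : dual_of P) (E : dual_of Q),
  [/\ ~ is_zero P, ~ is_zero Q &
      alg_iso (tens_alg A (end_alg D)) (tens_alg B (end_alg E))].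

(* The zero algebra meets the definition of [azumaya] but is not invertible, and
   has to be left out for the Brauer classes to form a group. *)
Definition azumaya0 A := azumaya A /\ ~ is_zero A.

Definition brauer_class A : set (algebra C) :=
  [set B | azumaya0 B /\ brauer_equiv A B].

Definition brauer_group : set (set (algebra C)) :=
  [set a | exists2 A, azumaya0 A & a = brauer_class A].

(* The classes in the unions below do not depend on the representatives, so that
   each union is a single class. *)
Definition brauer_one := brauer_class unit_alg.
Definition brauer_mul (a b : set (algebra C)) : set (algebra C) :=
  \bigcup_(A in a) \bigcup_(B in b) brauer_class (tens_alg A B).
Definition brauer_inv (a : set (algebra C)) : set (algebra C) :=
  \bigcup_(A in a) brauer_class (op_alg A).

Definition brauer_subgroup (H : set (set (algebra C))) :=
  [/\ H `<=` brauer_group, H brauer_one,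
      forall a b, H a -> H b -> H (brauer_mul a b) &
      forall a, H a -> H (brauer_inv a)].

Definition brauer_cycle (a : set (algebra C)) : set (set (algebra C)) :=
  smallest brauer_subgroup [set a].

End Algebras.

Definition full_alg (C : tensorCat) (P : C -> Prop) P1 PT (A : algebra C)
    (PA : P A) : algebra (@full_subcat C P P1 PT) :=
  @Algebra (full_subcat P1 PT) (exist _ (aobj A) PA) (amul A) (aone A).

Definition ultra_alg (I : Type) (U : set_system I) {FU : Filter U}
    (C : I -> tensorCat) (A : forall i, algebra (C i)) :
    algebra (ultraproduct U C) :=
  @Algebra (ultraproduct U C) (fun i => aobj (A i))
    (fun i => amul (A i)) (fun i => aone (A i)).

Local Open Scope ring_scope.

Section TensorMatrices.
Variable K : fieldType.

Lemma mxP m n (A B : 'M[K]_(m, n)) : (forall x y, A x y = B x y) -> A = B.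
Proof. by move=> e; apply/matrixP. Qed.

Lemma big_mxtens m n (F : 'I_(m * n) -> K) :
  \sum_k F k = \sum_i \sum_j F (mxtens_index (i, j)).
Proof.
rewrite pair_big (reindex (@mxtens_index m n)) /=.
  by apply: eq_bigr => -[].
by exists (@mxtens_unindex m n) => k _; rewrite ?mxtens_indexK ?mxtens_unindexK.
Qed.

Lemma sum_only n (z : 'I_n) (F : 'I_n -> K) :
  (forall i, i != z -> F i = 0) -> \sum_i F i = F z.
Proof. by move=> F0; rewrite (bigD1 z) //= big1 ?addr0. Qed.

(* the matrix of the linear map sending the basis vector x to the basis vector h x *)
Definition funmx m n (h : 'I_m -> 'I_n) : 'M[K]_(m, n) :=
  \matrix_(x, y) (y == h x)%:R.

Lemma funmx_mul m n p (h : 'I_m -> 'I_n) (B : 'M[K]_(n, p)) x z :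
  (funmx h *m B) x z = B (h x) z.
Proof.
rewrite mxE (bigD1 (h x)) //= mxE eqxx mul1r big1 ?addr0 // => y /negPf ne.
by rewrite mxE ne mul0r.
Qed.

Lemma mul_funmx m n p (h : 'I_n -> 'I_p) (h' : 'I_p -> 'I_n) (A : 'M[K]_(m, n)) x z :
  cancel h h' -> cancel h' h -> (A *m funmx h) x z = A x (h' z).
Proof.
move=> hK h'K.
rewrite mxE (bigD1 (h' z)) //= mxE h'K eqxx mulr1 big1 ?addr0 // => y ne.
rewrite mxE; case: eqP => [e|_]; last by rewrite mulr0.
by case/eqP: ne; rewrite e hK.
Qed.

Lemma funmx_id n : funmx (@id 'I_n) = 1%:M.
Proof. by apply: mxP => x y; rewrite !mxE eq_sym. Qed.
Lemma funmx_comp m n p (h : 'I_m -> 'I_n) (k : 'I_n -> 'I_p) :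
  funmx h *m funmx k = funmx (k \o h).
Proof. by apply: mxP => x y; rewrite funmx_mul !mxE. Qed.
Lemma eq_funmx m n (h h' : 'I_m -> 'I_n) : h =1 h' -> funmx h = funmx h'.
Proof. by move=> e; apply: mxP => x y; rewrite !mxE e. Qed.

Definition pairmap_idx m m' n n' (h : 'I_m -> 'I_m') (k : 'I_n -> 'I_n')
    (x : 'I_(m * n)) : 'I_(m' * n') :=
  mxtens_index (h (mxtens_unindex x).1, k (mxtens_unindex x).2).

Lemma tensmx_fun m m' n n' (h : 'I_m -> 'I_m') (k : 'I_n -> 'I_n') :
  funmx h *t funmx k = funmx (pairmap_idx h k).
Proof.
apply: mxP => x y.
case: x / (mxtens_indexP x) => x1 x2; case: y / (mxtens_indexP y) => y1 y2.
rewrite tensmxE !mxE /pairmap_idx mxtens_indexK (can_eq (@mxtens_indexK _ _)) xpair_eqE.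
by case: eqP; case: eqP; rewrite ?mulr1 ?mulr0.
Qed.

Lemma tensmx1 m n : (1%:M : 'M[K]_m) *t (1%:M : 'M[K]_n) = 1%:M.
Proof.
rewrite -!funmx_id tensmx_fun; apply: eq_funmx => x.
by rewrite /pairmap_idx -surjective_pairing mxtens_unindexK.
Qed.

Definition reassoc m n p (x : 'I_(m * n * p)) : 'I_(m * (n * p)) :=
  mxtens_index ((mxtens_unindex (mxtens_unindex x).1).1,
    mxtens_index ((mxtens_unindex (mxtens_unindex x).1).2, (mxtens_unindex x).2)).
Definition reassocV m n p (x : 'I_(m * (n * p))) : 'I_(m * n * p) :=
  mxtens_index (mxtens_index ((mxtens_unindex x).1,
    (mxtens_unindex (mxtens_unindex x).2).1), (mxtens_unindex (mxtens_unindex x).2).2).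
Definition flip_idx m n (x : 'I_(m * n)) : 'I_(n * m) :=
  mxtens_index ((mxtens_unindex x).2, (mxtens_unindex x).1).
Definition drop_l n (x : 'I_(1 * n)) : 'I_n := (mxtens_unindex x).2.
Definition add_l n (x : 'I_n) : 'I_(1 * n) := mxtens_index (ord0, x).
Definition drop_r n (x : 'I_(n * 1)) : 'I_n := (mxtens_unindex x).1.
Definition add_r n (x : 'I_n) : 'I_(n * 1) := mxtens_index (x, ord0).

Lemma reassocK m n p : cancel (@reassoc m n p) (@reassocV m n p).
Proof.
move=> x; case: x / (mxtens_indexP x) => x z; case: x / (mxtens_indexP x) => x y.
by rewrite /reassoc /reassocV !mxtens_indexK.
Qed.
Lemma reassocVK m n p : cancel (@reassocV m n p) (@reassoc m n p).
Proof.
move=> x; case: x / (mxtens_indexP x) => x y; case: y / (mxtens_indexP y) => y z.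
by rewrite /reassoc /reassocV !mxtens_indexK.
Qed.
Lemma flipK m n : cancel (@flip_idx m n) (@flip_idx n m).
Proof. by move=> x; case: x / (mxtens_indexP x) => x y; rewrite /flip_idx !mxtens_indexK. Qed.
Lemma drop_lK n : cancel (@drop_l n) (@add_l n).
Proof.
by move=> x; case: x / (mxtens_indexP x) => x y; rewrite /drop_l /add_l !mxtens_indexK (ord1 x).
Qed.
Lemma add_lK n : cancel (@add_l n) (@drop_l n).
Proof. by move=> x; rewrite /drop_l /add_l mxtens_indexK. Qed.
Lemma drop_rK n : cancel (@drop_r n) (@add_r n).
Proof.
by move=> x; case: x / (mxtens_indexP x) => x y; rewrite /drop_r /add_r !mxtens_indexK (ord1 y).
Qed.
Lemma add_rK n : cancel (@add_r n) (@drop_r n).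
Proof. by move=> x; rewrite /drop_r /add_r mxtens_indexK. Qed.

Lemma reassocE m n p (x : 'I_m) (y : 'I_n) (z : 'I_p) :
  reassoc (mxtens_index (mxtens_index (x, y), z)) =
  mxtens_index (x, mxtens_index (y, z)).
Proof. by rewrite /reassoc !mxtens_indexK. Qed.
Lemma reassocVE m n p (x : 'I_m) (y : 'I_n) (z : 'I_p) :
  reassocV (mxtens_index (x, mxtens_index (y, z))) =
  mxtens_index (mxtens_index (x, y), z).
Proof. by rewrite /reassocV !mxtens_indexK. Qed.
Lemma flipE m n (x : 'I_m) (y : 'I_n) :
  flip_idx (mxtens_index (x, y)) = mxtens_index (y, x).
Proof. by rewrite /flip_idx !mxtens_indexK. Qed.
Lemma drop_lE n (x : 'I_1) (y : 'I_n) : drop_l (mxtens_index (x, y)) = y.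
Proof. by rewrite /drop_l !mxtens_indexK. Qed.
Lemma drop_rE n (x : 'I_1) (y : 'I_n) : drop_r (mxtens_index (y, x)) = y.
Proof. by rewrite /drop_r !mxtens_indexK. Qed.
Lemma pairmap_idxE m m' n n' (h : 'I_m -> 'I_m') (k : 'I_n -> 'I_n') x y :
  pairmap_idx h k (mxtens_index (x, y)) = mxtens_index (h x, k y).
Proof. by rewrite /pairmap_idx mxtens_indexK. Qed.
Definition idxE := (mxtens_indexK, pairmap_idxE, reassocE, reassocVE, flipE, drop_lE, drop_rE).

End TensorMatrices.

Section Rep.
Variables (K : fieldType) (gT : finGroupType) (G : {group gT}).

(* Every finite-dimensional representation is isomorphic to one of these; the chosen
   basis makes tensor products Kronecker products of matrices. *)
Record rep := Rep { rdim : nat; rrep :> mx_representation K G rdim }.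

Record rep_hom (X Y : rep) := RepHom {
  hmx :> 'M[K]_(rdim X, rdim Y);
  hmxP : {in G, forall g, X g *m hmx = hmx *m Y g}
}.

Lemma rep_tens_subproof (X Y : rep) : mx_repr G (fun g => X g *t Y g).
Proof.
split=> [|g h gG hG]; first by rewrite !repr_mx1 tensmx1.
by rewrite !repr_mxM // tensmx_mul.
Qed.
Definition rep_tens (X Y : rep) : rep := Rep (MxRepresentation (rep_tens_subproof X Y)).

Lemma rep_unit_subproof : mx_repr G (fun _ => 1%:M : 'M[K]_1).
Proof. by split=> // g h _ _; rewrite mul1mx. Qed.
Definition rep_unit : rep := Rep (MxRepresentation rep_unit_subproof).

Section Homs.
Implicit Types X Y Z W : rep.

Definition rh_id X : rep_hom X X.
Proof. by exists 1%:M => g _; rewrite mulmx1 mul1mx. Defined.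
Definition rh_comp X Y Z (f : rep_hom X Y) (g : rep_hom Y Z) : rep_hom X Z.
Proof.
by exists (f *m g) => x xG; rewrite mulmxA hmxP // -!mulmxA hmxP.
Defined.
Definition rh_zero X Y : rep_hom X Y.
Proof. by exists 0 => g _; rewrite mulmx0 mul0mx. Defined.
Definition rh_add X Y (f g : rep_hom X Y) : rep_hom X Y.
Proof. by exists (hmx f + hmx g) => x xG; rewrite mulmxDr mulmxDl !hmxP. Defined.
Definition rh_opp X Y (f : rep_hom X Y) : rep_hom X Y.
Proof. by exists (- hmx f) => x xG; rewrite mulmxN mulNmx !hmxP. Defined.
Definition rh_tens X X' Y Y' (f : rep_hom X X') (g : rep_hom Y Y') :
  rep_hom (rep_tens X Y) (rep_tens X' Y').
Proof. by exists (f *t g) => x xG; rewrite !tensmx_mul !hmxP. Defined.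

Definition rh_bij X Y (h : 'I_(rdim X) -> 'I_(rdim Y)) (h' : 'I_(rdim Y) -> 'I_(rdim X))
    (hK : cancel h h') (h'K : cancel h' h)
    (hG : {in G, forall g, forall x y, X g x y = Y g (h x) (h y)}) :
  rep_hom X Y.
Proof.
exists (funmx K h) => g gG; apply: mxP => x y.
by rewrite funmx_mul (mul_funmx _ _ _ hK h'K) hG // h'K.
Defined.

Definition rh_assoc X Y Z :
  rep_hom (rep_tens (rep_tens X Y) Z) (rep_tens X (rep_tens Y Z)).
Proof.
apply: (@rh_bij (rep_tens (rep_tens X Y) Z) (rep_tens X (rep_tens Y Z)) _ _
  (@reassocK _ _ _) (@reassocVK _ _ _)) => g _ x y.
case: x / (mxtens_indexP x) => x x3; case: x / (mxtens_indexP x) => x1 x2.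
case: y / (mxtens_indexP y) => y y3; case: y / (mxtens_indexP y) => y1 y2.
by rewrite !idxE /= !tensmxE mulrA.
Defined.
Definition rh_assocV X Y Z :
  rep_hom (rep_tens X (rep_tens Y Z)) (rep_tens (rep_tens X Y) Z).
Proof.
apply: (@rh_bij (rep_tens X (rep_tens Y Z)) (rep_tens (rep_tens X Y) Z) _ _
  (@reassocVK _ _ _) (@reassocK _ _ _)) => g _ x y.
case: x / (mxtens_indexP x) => x1 x; case: x / (mxtens_indexP x) => x2 x3.
case: y / (mxtens_indexP y) => y1 y; case: y / (mxtens_indexP y) => y2 y3.
by rewrite !idxE /= !tensmxE mulrA.
Defined.
Definition rh_lunit X : rep_hom (rep_tens rep_unit X) X.
Proof.
apply: (@rh_bij (rep_tens rep_unit X) X _ _ (@drop_lK _) (@add_lK _)) => g _ x y.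
case: x / (mxtens_indexP x) => i x; case: y / (mxtens_indexP y) => j y.
by rewrite !idxE /= tensmxE (ord1 i) (ord1 j) mxE mul1r.
Defined.
Definition rh_lunitV X : rep_hom X (rep_tens rep_unit X).
Proof.
apply: (@rh_bij X (rep_tens rep_unit X) _ _ (@add_lK _) (@drop_lK _)) => g _ x y.
by rewrite /= tensmxE mxE mul1r.
Defined.
Definition rh_runit X : rep_hom (rep_tens X rep_unit) X.
Proof.
apply: (@rh_bij (rep_tens X rep_unit) X _ _ (@drop_rK _) (@add_rK _)) => g _ x y.
case: x / (mxtens_indexP x) => x i; case: y / (mxtens_indexP y) => y j.
by rewrite !idxE /= tensmxE (ord1 i) (ord1 j) mxE mulr1.
Defined.
Definition rh_runitV X : rep_hom X (rep_tens X rep_unit).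
Proof.
apply: (@rh_bij X (rep_tens X rep_unit) _ _ (@add_rK _) (@drop_rK _)) => g _ x y.
by rewrite /= tensmxE mxE mulr1.
Defined.
Definition rh_braid X Y : rep_hom (rep_tens X Y) (rep_tens Y X).
Proof.
apply: (@rh_bij (rep_tens X Y) (rep_tens Y X) _ _ (@flipK _ _) (@flipK _ _)) => g _ x y.
case: x / (mxtens_indexP x) => x1 x2; case: y / (mxtens_indexP y) => y1 y2.
by rewrite !idxE /= !tensmxE mulrC.
Defined.
End Homs.

Definition rep_cat : tensorCat.
Proof.
refine (@TensorCat rep rep_hom (fun X Y f g => hmx f = hmx g)
  rh_id rh_comp rh_zero rh_add rh_opp rep_tens rh_tens rep_unit
  rh_assoc rh_assocV rh_lunit rh_lunitV rh_runit rh_runitV rh_braid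
  _ _ _ _ _ _ _ _ _ _ _ _ _ _ _ _ _ _ _ _ _ _ _ _ _ _ _ _ _ _ _ _ _ _) => /=.
- by [].
- by [].
- by move=> X Y f g h ->.
- by move=> X Y Z f f' -> g g' ->.
- by move=> X Y f f' -> g g' ->.
- by move=> X Y f f' ->.
- by move=> X X' Y Y' f f' -> g g' ->.
- by move=> *; rewrite mul1mx.
- by move=> *; rewrite mulmx1.
- by move=> *; rewrite mulmxA.
- by move=> *; rewrite addrA.
- by move=> *; rewrite addrC.
- by move=> *; rewrite add0r.
- by move=> *; rewrite addNr.
- by move=> *; rewrite mulmxDl.
- by move=> *; rewrite mulmxDr.
- by move=> *; rewrite tensmx1.
- by move=> *; rewrite tensmx_mul.
- by move=> *; apply: mxP => x y; rewrite !mxE mulrDl.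
- by move=> *; apply: mxP => x y; rewrite !mxE mulrDr.
- by move=> *; rewrite funmx_comp -funmx_id; apply: eq_funmx; exact: reassocK.
- by move=> *; rewrite funmx_comp -funmx_id; apply: eq_funmx; exact: reassocVK.
- by move=> *; rewrite funmx_comp -funmx_id; apply: eq_funmx; exact: drop_lK.
- by move=> *; rewrite funmx_comp -funmx_id; apply: eq_funmx; exact: add_lK.
- by move=> *; rewrite funmx_comp -funmx_id; apply: eq_funmx; exact: drop_rK.
- by move=> *; rewrite funmx_comp -funmx_id; apply: eq_funmx; exact: add_rK.
- move=> X X' Y Y' Z Z' f g h; apply: mxP => x y.
  rewrite (mul_funmx _ _ _ (@reassocK _ _ _) (@reassocVK _ _ _)) funmx_mul.
  case: x / (mxtens_indexP x) => x x3; case: x / (mxtens_indexP x) => x1 x2.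
  case: y / (mxtens_indexP y) => y1 y; case: y / (mxtens_indexP y) => y2 y3.
  by rewrite !idxE !tensmxE mulrA.
- move=> X X' f; apply: mxP => x y.
  rewrite (mul_funmx _ _ _ (@drop_lK _) (@add_lK _)) funmx_mul.
  case: x / (mxtens_indexP x) => i x.
  by rewrite !idxE tensmxE (ord1 i) mxE mul1r.
- move=> X X' f; apply: mxP => x y.
  rewrite (mul_funmx _ _ _ (@drop_rK _) (@add_rK _)) funmx_mul.
  case: x / (mxtens_indexP x) => x i.
  by rewrite !idxE tensmxE (ord1 i) mxE mulr1.
- move=> X Y; rewrite -!funmx_id !tensmx_fun funmx_comp.
  apply: eq_funmx => x; case: x / (mxtens_indexP x) => x x3; case: x / (mxtens_indexP x) => x1 x2.
  by rewrite /= !idxE.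
- move=> X Y Z W; rewrite -!funmx_id !tensmx_fun !funmx_comp.
  apply: eq_funmx => x; case: x / (mxtens_indexP x) => x x4.
  case: x / (mxtens_indexP x) => x x3; case: x / (mxtens_indexP x) => x1 x2.
  by rewrite /= !idxE.
- move=> X X' Y Y' f g; apply: mxP => x y.
  rewrite (mul_funmx _ _ _ (@flipK _ _) (@flipK _ _)) funmx_mul.
  case: x / (mxtens_indexP x) => x1 x2; case: y / (mxtens_indexP y) => y1 y2.
  by rewrite !idxE !tensmxE mulrC.
- by move=> *; rewrite funmx_comp -funmx_id; apply: eq_funmx; exact: flipK.
- move=> X Y Z; rewrite -!funmx_id !tensmx_fun !funmx_comp.
  apply: eq_funmx => x; case: x / (mxtens_indexP x) => x x3; case: x / (mxtens_indexP x) => x1 x2.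
  by rewrite /= !idxE.
Defined.

Lemma contragredient_subproof (X : rep) : mx_repr G (fun g => (X g^-1%g)^T).
Proof.
split=> [|g h gG hG]; first by rewrite invg1 repr_mx1 trmx1.
by rewrite invMg repr_mxM ?groupV // trmx_mul.
Qed.
Definition contragredient (X : rep) : rep :=
  Rep (MxRepresentation (contragredient_subproof X)).

Lemma dual_paired n (r s : mx_representation K G n) :
  {in G, forall g, r g *m (s g)^T = 1%:M} ->
  let X : rep_cat := Rep r in let Y : rep_cat := Rep s in
  exists (e : hom (Y ⊗ X) 𝟙) (c : hom 𝟙 (X ⊗ Y)), is_dual e c.
Proof.
move=> rs X Y.
have sr g : g \in G -> (r g)^T *m s g = 1%:M.
  by move=> gG; rewrite -[LHS]trmxK trmx_mul trmxK mulmx1C ?trmx1 ?rs.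
pose E : 'M[K]_(n * n, 1) := \matrix_(p, _) ((mxtens_unindex p).1 == (mxtens_unindex p).2)%:R.
have eP : {in G, forall g, (s g *t r g) *m E = E *m 1%:M}.
  move=> g gG; rewrite mulmx1; apply: mxP => p q.
  case: p / (mxtens_indexP p) => i k; rewrite !mxE mxtens_indexK /= big_mxtens.
  have /matrixP/(_ k i) := rs _ gG; rewrite !mxE eq_sym => <-.
  apply: eq_bigr => j _; rewrite (bigD1 j) //= big1 ?addr0.
    by rewrite tensmxE !mxE mxtens_indexK eqxx mulr1 mulrC.
  by move=> l ne; rewrite [E _ _]mxE mxtens_indexK eq_sym (negPf ne) mulr0.
have cP : {in G, forall g, 1%:M *m E^T = E^T *m (r g *t s g)}.
  move=> g gG; rewrite mul1mx; apply: mxP => q p.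
  case: p / (mxtens_indexP p) => j l; rewrite !mxE mxtens_indexK /= big_mxtens.
  have /matrixP/(_ j l) := sr _ gG; rewrite !mxE => <-.
  apply: eq_bigr => i _; rewrite (bigD1 i) //= big1 ?addr0.
    by rewrite tensmxE !mxE mxtens_indexK eqxx mul1r.
  by move=> k ne; rewrite [E^T _ _]mxE [E _ _]mxE mxtens_indexK eq_sym (negPf ne) mul0r.
exists (RepHom (X := rep_tens Y X) (Y := rep_unit) eP),
  (RepHom (X := rep_unit) (Y := rep_tens X Y) cP).
split => /=; apply: mxP => x z.
- rewrite (mul_funmx _ _ _ (@drop_rK _) (@add_rK _)) -!mulmxA funmx_mul mulmxA.
  rewrite mxE big_mxtens (sum_only (z := z)); last first.
    move=> a ne; rewrite big1 // => p _.
    by rewrite tensmxE [1%:M _ _]mxE (negPf ne) mul0r mulr0.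
  rewrite big_mxtens (sum_only (z := z)); last first.
    move=> b ne; rewrite big1 // => c _.
    rewrite (mul_funmx _ _ _ (@reassocK _ _ _) (@reassocVK _ _ _)) idxE tensmxE.
    by rewrite [E^T _ _]mxE [E _ _]mxE idxE eq_sym (negPf ne) !mul0r.
  rewrite (sum_only (z := z)); last first.
    move=> c ne; rewrite [X in _ * X]tensmxE [E _ _]mxE idxE eq_sym (negPf ne).
    by rewrite !mulr0.
  rewrite (mul_funmx _ _ _ (@reassocK _ _ _) (@reassocVK _ _ _)) idxE !tensmxE !mxE.
  by rewrite !idxE !eqxx !mulr1 mul1r.
- rewrite (mul_funmx _ _ _ (@drop_lK _) (@add_lK _)) -!mulmxA funmx_mul mulmxA.
  rewrite mxE big_mxtens exchange_big (sum_only (z := z)); last first.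
    move=> a ne; rewrite big1 // => p _.
    by rewrite tensmxE [1%:M _ _]mxE (negPf ne) !mulr0.
  rewrite big_mxtens exchange_big (sum_only (z := z)); last first.
    move=> b ne; rewrite big1 // => c _.
    rewrite (mul_funmx _ _ _ (@reassocVK _ _ _) (@reassocK _ _ _)) idxE tensmxE.
    by rewrite [E^T _ _]mxE [E _ _]mxE idxE (negPf ne) mulr0 mul0r.
  rewrite (sum_only (z := z)); last first.
    move=> c ne; rewrite [X in _ * X]tensmxE [E _ _]mxE idxE (negPf ne).
    by rewrite mul0r mulr0.
  rewrite (mul_funmx _ _ _ (@reassocVK _ _ _) (@reassocK _ _ _)) idxE !tensmxE !mxE.
  by rewrite !idxE !eqxx !mulr1.
Qed.

Lemma rep_dualizable (X : rep_cat) : dualizable X.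
Proof.
case: X => n r; split; exists (contragredient (Rep r)); apply: dual_paired => g gG /=.
  by rewrite trmxK -repr_mxM ?groupV // mulgV repr_mx1.
by rewrite -trmx_mul -repr_mxM ?groupV // mulgV repr_mx1 trmx1.
Qed.

End Rep.

Section PermutationRep.
Variables (K : fieldType) (T : finType) (G : {group {perm T}}).

Lemma perm_rep_subproof :
  mx_repr G (fun g => \matrix_(i < #|T|, j < #|T|)
                        (enum_val j == g (enum_val i))%:R : 'M[K]_#|T|).
Proof.
have E (g : {perm T}) : \matrix_(i < #|T|, j < #|T|) (enum_val j == g (enum_val i))%:R =
    funmx K (fun i => enum_rank (g (enum_val i))).
  apply: mxP => i j; rewrite !mxE.
  by rewrite -[in RHS](enum_valK j) (inj_eq enum_rank_inj).
split=> [|g h _ _]; rewrite !E.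
  by rewrite -funmx_id; apply: eq_funmx => i; rewrite perm1 enum_valK.
by rewrite funmx_comp; apply: eq_funmx => i /=; rewrite enum_rankK permM.
Qed.

(* K[T]: g maps [x] to [g x], matrices acting on row vectors *)
Definition perm_rep : rep_cat K G := Rep (MxRepresentation perm_rep_subproof).

End PermutationRep.

Section Symplectic.
Variables (F : finFieldType) (d : nat) (omega : {skew_symmetric 'rV[F]_d}).
Local Notation E := 'rV[F]_d.

Definition Sp_set : {set {perm E}} :=
  [set s : {perm E} | [forall a : F, forall x : E, forall y : E,
              s (a *: x + y) == a *: s x + s y]
        && [forall x : E, forall y : E, omega (s x) (s y) == omega x y]].

Lemma Sp_setP (s : {perm E}) :
  reflect (linear s /\ forall x y, omega (s x) (s y) = omega x y) (s \in Sp_set).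
Proof.
rewrite inE; apply: (iffP andP) => -[sl so]; split.
- by move=> a x y; have /forallP/(_ a)/forallP/(_ x)/forallP/(_ y)/eqP := sl.
- by move=> x y; have /forallP/(_ x)/forallP/(_ y)/eqP := so.
- by apply/forallP=> a; apply/forallP=> x; apply/forallP=> y; apply/eqP; exact: sl.
- by apply/forallP=> x; apply/forallP=> y; apply/eqP; exact: so.
Qed.

Lemma Sp_group_set : group_set Sp_set.
Proof.
apply/group_setP; split.
  by apply/Sp_setP; split=> [a x y|x y]; rewrite !perm1.
move=> s t /Sp_setP[sl so] /Sp_setP[tl t_o]; apply/Sp_setP.
by split=> [a x y|x y]; rewrite !permM ?sl ?tl ?t_o ?so.
Qed.
Definition Sp : {group {perm E}} := Group Sp_group_set.

Variables (K : fieldType) (psi : F -> K).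
Let V := perm_rep K Sp.

(* [x] · [y] = ψ(⟨x, y⟩) [x + y] *)
Definition twisted_mul_mx : 'M[K]_(#|{: E}| * #|{: E}|, #|{: E}|) :=
  \matrix_(p, k)
    let x := enum_val (mxtens_unindex p).1 in
    let y := enum_val (mxtens_unindex p).2 in
    psi (omega x y) * (enum_val k == x + y)%:R.

Definition twisted_one_mx : 'M[K]_(1, #|{: E}|) := \matrix_(_, k) (enum_val k == 0)%:R.

Lemma twisted_mul_subproof : {in Sp, forall g,
  (V ⊗ V) g *m twisted_mul_mx = twisted_mul_mx *m V g}.
Proof.
move=> g /Sp_setP[gl go]; apply: mxP => p k.
case: p / (mxtens_indexP p) => i j.
rewrite mxE big_mxtens (sum_only (z := enum_rank (g (enum_val i)))); last first.
  move=> i' ne; rewrite big1 // => j' _; rewrite tensmxE mxE.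
  case: eqP => [e|_]; last by rewrite !mul0r.
  by case/eqP: ne; rewrite -e enum_valK.
rewrite (sum_only (z := enum_rank (g (enum_val j)))); last first.
  move=> j' ne; rewrite tensmxE [perm_rep _ _ _ j j']mxE.
  case: eqP => [e|_]; last by rewrite mulr0 mul0r.
  by case/eqP: ne; rewrite -e enum_valK.
rewrite [RHS]mxE (sum_only (z := enum_rank (enum_val i + enum_val j))); last first.
  move=> k' ne; rewrite [twisted_mul_mx _ _]mxE mxtens_indexK /=; case: eqP => [e|_].
    by case/eqP: ne; rewrite -e enum_valK.
  by rewrite mulr0 mul0r.
have gD x y : g (x + y) = g x + g y by have := gl 1 x y; rewrite !scale1r.
by rewrite tensmxE !mxE !mxtens_indexK /= !enum_rankK !eqxx go gD !mulr1 mul1r.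
Qed.

Lemma twisted_one_subproof : {in Sp, forall g,
  (𝟙 : rep_cat K Sp) g *m twisted_one_mx = twisted_one_mx *m V g}.
Proof.
move=> g /Sp_setP[gl go]; rewrite mul1mx; apply: mxP => p k.
rewrite [RHS]mxE (sum_only (z := enum_rank 0)); last first.
  move=> k' ne; rewrite mxE; case: eqP => [e|_]; last by rewrite mul0r.
  by case/eqP: ne; rewrite -e enum_valK.
have g0 : g 0 = 0.
  have := gl 1 0 0; rewrite !scale1r addr0 => /(congr1 (fun u => u - g 0)).
  by rewrite subrr addrK.
by rewrite !mxE !enum_rankK eqxx mul1r g0.
Qed.

Definition twisted_alg : algebra (rep_cat K Sp) :=
  @Algebra (rep_cat K Sp) V (RepHom (X := V ⊗ V) (Y := V) twisted_mul_subproof)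
    (RepHom (X := rep_unit K Sp) (Y := V) twisted_one_subproof).

End Symplectic.

Section Interpolation.
Variables (I : Type) (U : set_system I).
Context {FU : Filter U}.
Variables (F : finFieldType) (d : I -> nat).
Variables (omega : forall i, {skew_symmetric 'rV[F]_(d i)}) (K : fieldType).

Definition sp_ultraproduct : tensorCat := ultraproduct U (fun i => rep_cat K (Sp (omega i))).

Definition sp_perm : sp_ultraproduct := fun i => perm_rep K (Sp (omega i)).

Definition sp_interpolation : tensorCat :=
  full_subcat (in_gen_tunit sp_perm)
    (fun X Y => @in_gen_tens _ sp_perm X Y
      (ultraproduct_dualizable (fun i => @rep_dualizable K _ (Sp (omega i))))).

Definition sp_twisted_alg (psi : F -> K) : algebra sp_interpolation :=
  full_alg _ _ (A := ultra_alg (U := U) (fun i => twisted_alg (omega i) psi))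
    (in_gen_self sp_perm).

End Interpolation.

Arguments sp_interpolation {I} U {FU F d} omega K.
Arguments sp_twisted_alg {I} U {FU F d} omega {K} psi.

Definition nontrivial_additive_character (F : finFieldType) (K : fieldType) (psi : F -> K) :=
  [/\ psi 0 = 1, {morph psi : a b / a + b >-> a * b} & exists a, psi a != 1].

(* Main.v *)
Require Import Defs.
From mathcomp Require Import all_boot all_order all_algebra all_fingroup cyclic.
From mathcomp Require Import sesquilinear mxrepresentation complex mxtens ring.
From mathcomp Require Import boolp classical_sets functions cardinality filter.
From mathcomp Require Import reals.

Set Implicit Arguments.
Unset Strict Implicit.
Unset Printing Implicit Defensive.

Import Defs GRing.Theory Num.Theory.
Local Open Scope classical_set_scope.
Local Open Scope ring_scope.

(** With a² + b² = -1 in F, the rotation [x] ⊗ [y] ↦ [a x + b y] ⊗ [a y - b x] identifies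
    A ⊗ A with A^op ⊗ A^op, so that [A] has order dividing 4, and it remains to see that
    A ⊗ A does not split.  If (A ⊗ A) ⊗ End P ≅ End Q, then for almost all i the matrix
    algebra End Q_i contains Heisenberg operators b(u), u ∈ E_i ⊕ E_i, and the action of a
    transvection T, corrected by its action on P_i, is an operator β_T with
    b(u) β_T = β_T b(T u).  As P and Q are subquotients of sums of bounded tensor powers of
    V, a nonzero vector λ is fixed by all β_T such that T fixes a bounded number of points,
    in particular by those of a hyperbolic space with basis e1, f1, e2, f2.  Up to a scalar
    which is the same for conjugate transvections, β_T is inverse to multiplication by the
    Gaussian ψ(s (y² + z²) / 4) on the weight spaces of b(x, 0) and b(0, x), where x is the
    axis of T.  Hence y² + z² takes the same value for the isotropic vectors e1, e2, e1 + e2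
    and e1 - e2, and this value is 0 by the parallelogram identity.  As -1 is not a square,
    y = z = 0: the vector λ is fixed by the Heisenberg operators of e1 and f1, which do not
    commute. *)

(** * Algebras and duality in matrix form *)

(** No single index carries an obstruction. As q is odd, each A_i is the endomorphism algebra of the
    Weil representation of Sp(E_i), of dimension q^(d_i/2), so A_i splits in its own category. What
    has to be used is that P and Q come from bounded tensor powers of V; this enters as a number of
    points that stays bounded while d_i exceeds every integer. The hypothesis on -1 must enter too:
    if a² = -1, then [x] ↦ [a x] would identify A with A^op, hence A ⊗ A with End V. It enters as
    the anisotropy of y² + z², the two squares coming from the two copies of E in A ⊗ A. No Weil
    representation is constructed. Its operators for transvections are written as explicit
    combinations of the Heisenberg operators, and they are compared with the given β_T by showing
    that a product of the two commutes with everything. The scalar left open by this comparison is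
    never computed; it is eliminated by comparing several transvections. *)

Section MatrixAlgebras.
Variable K : fieldType.
Local Notation ix x y := (mxtens_index (x, y)).

Definition swap_idx a b c d (x : 'I_((a * b) * (c * d))) : 'I_((a * c) * (b * d)) :=
  let: (p, q) := mxtens_unindex x in
  let: (i, j) := mxtens_unindex p in
  let: (k, l) := mxtens_unindex q in ix (ix i k) (ix j l).

Lemma swap_idxE a b c d (i : 'I_a) (j : 'I_b) (k : 'I_c) (l : 'I_d) :
  swap_idx (ix (ix i j) (ix k l)) = ix (ix i k) (ix j l).
Proof. by rewrite /swap_idx !mxtens_indexK. Qed.

Lemma swap_idxK a b c d : cancel (@swap_idx a b c d) (@swap_idx a c b d).
Proof.
move=> x; case: x / (mxtens_indexP x) => x y.
case: x / (mxtens_indexP x) => i j; case: y / (mxtens_indexP y) => k l.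
by rewrite !swap_idxE.
Qed.

Definition swapmx a b c d : 'M[K]_((a * b) * (c * d), (a * c) * (b * d)) :=
  funmx K (@swap_idx a b c d).

(** Matrices act on row vectors, and a product is the matrix [mu] of its structure constants:
    [mu (ix a b) x] is the coefficient of x in a b. From here to [sandwich_mx] stand the matrices
    that underlie the constructions on algebras and dual pairs in [rep_cat]. *)
Definition tens_mul m n (mu : 'M[K]_(m * m, m)) (nu : 'M[K]_(n * n, n)) :
  'M[K]_((m * n) * (m * n), m * n) := swapmx m n m n *m (mu *t nu).
Definition tens_one m n (u : 'M[K]_(1, m)) (v : 'M[K]_(1, n)) : 'M[K]_(1, m * n) :=
  funmx K (@add_l 1) *m (u *t v).
Definition op_mul m (mu : 'M[K]_(m * m, m)) : 'M[K]_(m * m, m) :=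
  funmx K (@flip_idx m m) *m mu.
Definition end_mul n d (e : 'M[K]_(d * n, 1)) : 'M[K]_((n * d) * (n * d), n * d) :=
  funmx K (@reassoc n d (n * d)) *m
    (1%:M *t (funmx K (@reassocV d n d) *m (e *t 1%:M) *m funmx K (@drop_l d))).
Definition tens_ev n d n' d' (e : 'M[K]_(d * n, 1)) (e' : 'M[K]_(d' * n', 1)) :
  'M[K]_((d * d') * (n * n'), 1) := swapmx d d' n n' *m (e *t e') *m funmx K (@drop_l 1).
Definition tens_coev n d n' d' (c : 'M[K]_(1, n * d)) (c' : 'M[K]_(1, n' * d')) :
  'M[K]_(1, (n * n') * (d * d')) := funmx K (@add_l 1) *m (c *t c') *m swapmx n d n' d'.
Definition sandwich_mx n d (mu : 'M[K]_(n * n, n)) (c : 'M[K]_(1, n * d)) :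
    'M[K]_(n * n, n * d) :=
  funmx K (@add_r (n * n)) *m (1%:M *t c) *m funmx K (@reassocV (n * n) n d)
  *m ((funmx K (@reassoc n n n) *m (1%:M *t (funmx K (@flip_idx n n) *m mu)) *m mu) *t 1%:M).

(* matrix of x ↦ a x b, where the products are those of [mu] *)
Definition bimul n (mu : 'M[K]_(n * n, n)) (a b : 'I_n) : 'M[K]_n :=
  \matrix_(x, y) \sum_w mu (ix x b) w * mu (ix a w) y.

Lemma swapmxE a b c d n (A : 'M[K]_(_, n)) i j k l y :
  (swapmx a b c d *m A) (ix (ix i j) (ix k l)) y = A (ix (ix i k) (ix j l)) y.
Proof. by rewrite funmx_mul swap_idxE. Qed.

Lemma mul_swapmxE a b c d n (A : 'M[K]_(n, _)) x i j k l :
  (A *m swapmx a b c d) x (ix (ix i j) (ix k l)) = A x (ix (ix i k) (ix j l)).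
Proof. by rewrite (mul_funmx _ _ _ (@swap_idxK _ _ _ _) (@swap_idxK _ _ _ _)) swap_idxE. Qed.

Lemma tens_mulE m n (mu : 'M[K]_(m * m, m)) (nu : 'M[K]_(n * n, n)) a b a' b' x y :
  tens_mul mu nu (ix (ix a b) (ix a' b')) (ix x y) = mu (ix a a') x * nu (ix b b') y.
Proof. by rewrite swapmxE tensmxE. Qed.

Lemma tens_oneE m n (u : 'M[K]_(1, m)) (v : 'M[K]_(1, n)) i x y :
  tens_one u v i (ix x y) = u 0 x * v 0 y.
Proof. by rewrite /tens_one funmx_mul /add_l tensmxE (ord1 i) !ord1. Qed.

Lemma op_mulE m (mu : 'M[K]_(m * m, m)) a b x : op_mul mu (ix a b) x = mu (ix b a) x.
Proof. by rewrite funmx_mul flipE. Qed.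

Lemma end_mulE n d (e : 'M[K]_(d * n, 1)) p xi q eta r zeta :
  end_mul e (ix (ix p xi) (ix q eta)) (ix r zeta) =
  (r == p)%:R * (e (ix xi q) 0 * (eta == zeta)%:R).
Proof.
rewrite funmx_mul reassocE tensmxE [1%:M _ _]mxE eq_sym; congr (_ * _).
rewrite (mul_funmx _ _ _ (@drop_lK _) (@add_lK _)) funmx_mul reassocVE /add_l tensmxE.
by rewrite [1%:M _ _]mxE.
Qed.

Lemma tens_evE n d n' d' (e : 'M[K]_(d * n, 1)) (e' : 'M[K]_(d' * n', 1)) xi xi' x x' i :
  tens_ev e e' (ix (ix xi xi') (ix x x')) i = e (ix xi x) 0 * e' (ix xi' x') 0.
Proof.
by rewrite (mul_funmx _ _ _ (@drop_lK _) (@add_lK _)) swapmxE /add_l tensmxE !ord1.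
Qed.

Lemma tens_coevE n d n' d' (c : 'M[K]_(1, n * d)) (c' : 'M[K]_(1, n' * d')) xi xi' x x' i :
  tens_coev c c' i (ix (ix x x') (ix xi xi')) = c 0 (ix x xi) * c' 0 (ix x' xi').
Proof. by rewrite mul_swapmxE funmx_mul /add_l tensmxE !ord1. Qed.

Lemma bimulE n (mu : 'M[K]_(n * n, n)) a b x y :
  (funmx K (@reassoc n n n) *m (1%:M *t (funmx K (@flip_idx n n) *m mu)) *m mu)
    (ix (ix a b) x) y = bimul mu a b x y.
Proof.
rewrite -mulmxA funmx_mul reassocE !mxE big_mxtens (sum_only (z := a)); last first.
  move=> a' ne; rewrite big1 // => w _.
  by rewrite tensmxE [1%:M _ _]mxE eq_sym (negPf ne) !mul0r.
by apply: eq_bigr => w _; rewrite tensmxE [1%:M _ _]mxE eqxx mul1r op_mulE.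
Qed.

Lemma sandwich_mxE n d (mu : 'M[K]_(n * n, n)) (c : 'M[K]_(1, n * d)) a b y xi :
  sandwich_mx mu c (ix a b) (ix y xi) = \sum_x c 0 (ix x xi) * bimul mu a b x y.
Proof.
rewrite mxE big_mxtens.
under eq_bigr => P _.
  rewrite (sum_only (z := xi)); last first.
    by move=> z ne; rewrite tensmxE [1%:M _ _]mxE (negPf ne) !mulr0.
  rewrite tensmxE [1%:M xi xi]mxE eqxx mulr1.
  rewrite (mul_funmx _ _ _ (@reassocVK _ _ _) (@reassocK _ _ _)) funmx_mul /add_r.
  over.
rewrite big_mxtens (sum_only (z := ix a b)); last first.
  move=> P ne; rewrite big1 // => x _.
  by rewrite reassocE tensmxE [1%:M _ _]mxE eq_sym (negPf ne) !mul0r.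
apply: eq_bigr => x _.
by rewrite bimulE reassocE tensmxE [1%:M _ _]mxE eqxx mul1r.
Qed.
End MatrixAlgebras.

Section MatrixAlgebraMorphisms.
Variable K : fieldType.
Local Notation ix x y := (mxtens_index (x, y)).

(** For a bijection between bases, multiplicativity is an equality of structure constants. The
    associativity, commutativity, unit and interchange isomorphisms, and later the rotation of A ⊗
    A, are all of this kind. *)
Lemma funmx_alg_hom m n (h : 'I_m -> 'I_n) (h' : 'I_n -> 'I_m)
    (mu : 'M[K]_(m * m, m)) (nu : 'M[K]_(n * n, n)) :
  cancel h h' -> cancel h' h ->
  (forall a b x, mu (ix a b) x = nu (ix (h a) (h b)) (h x)) ->
  mu *m funmx K h = (funmx K h *t funmx K h) *m nu.
Proof.
move=> hK h'K e; apply: mxP => p x; case: p / (mxtens_indexP p) => a b.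
by rewrite (mul_funmx _ _ _ hK h'K) tensmx_fun funmx_mul pairmap_idxE e h'K.
Qed.

Lemma funmx_one_hom m n (h : 'I_m -> 'I_n) (h' : 'I_n -> 'I_m)
    (u : 'M[K]_(1, m)) (v : 'M[K]_(1, n)) :
  cancel h h' -> cancel h' h -> (forall x, u 0 x = v 0 (h x)) -> u *m funmx K h = v.
Proof.
move=> hK h'K e; apply: mxP => p x.
by rewrite (mul_funmx _ _ _ hK h'K) (ord1 p) e h'K.
Qed.

Lemma tens_mul_assoc m n p (mu : 'M[K]_(m * m, m)) (nu : 'M[K]_(n * n, n))
    (rho : 'M[K]_(p * p, p)) (r := funmx K (@reassoc m n p)) :
  tens_mul (tens_mul mu nu) rho *m r = (r *t r) *m tens_mul mu (tens_mul nu rho).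
Proof.
apply: (funmx_alg_hom (@reassocK _ _ _) (@reassocVK _ _ _)) => a b x.
case: a / (mxtens_indexP a) => a a3; case: a / (mxtens_indexP a) => a1 a2.
case: b / (mxtens_indexP b) => b b3; case: b / (mxtens_indexP b) => b1 b2.
case: x / (mxtens_indexP x) => x x3; case: x / (mxtens_indexP x) => x1 x2.
by rewrite !reassocE !tens_mulE mulrA.
Qed.

Lemma tens_one_assoc m n p (u : 'M[K]_(1, m)) (v : 'M[K]_(1, n)) (w : 'M[K]_(1, p)) :
  tens_one (tens_one u v) w *m funmx K (@reassoc m n p) = tens_one u (tens_one v w).
Proof.
apply: (funmx_one_hom (@reassocK _ _ _) (@reassocVK _ _ _)) => x.
case: x / (mxtens_indexP x) => x x3; case: x / (mxtens_indexP x) => x1 x2.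
by rewrite reassocE !tens_oneE mulrA.
Qed.

Lemma tens_mul_flip m n (mu : 'M[K]_(m * m, m)) (nu : 'M[K]_(n * n, n))
    (f := funmx K (@flip_idx m n)) :
  tens_mul mu nu *m f = (f *t f) *m tens_mul nu mu.
Proof.
apply: (funmx_alg_hom (@flipK _ _) (@flipK _ _)) => a b x.
case: a / (mxtens_indexP a) => a1 a2; case: b / (mxtens_indexP b) => b1 b2.
case: x / (mxtens_indexP x) => x1 x2.
by rewrite !flipE !tens_mulE mulrC.
Qed.

Lemma tens_one_flip m n (u : 'M[K]_(1, m)) (v : 'M[K]_(1, n)) :
  tens_one u v *m funmx K (@flip_idx m n) = tens_one v u.
Proof.
apply: (funmx_one_hom (@flipK _ _) (@flipK _ _)) => x.
by case: x / (mxtens_indexP x) => x1 x2; rewrite flipE !tens_oneE mulrC.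
Qed.

Lemma tens_mul_unit m (mu : 'M[K]_(m * m, m)) (l := funmx K (@drop_l m)) :
  tens_mul (funmx K (@drop_l 1)) mu *m l = (l *t l) *m mu.
Proof.
apply: (funmx_alg_hom (@drop_lK _) (@add_lK _)) => a b x.
case: a / (mxtens_indexP a) => a1 a2; case: b / (mxtens_indexP b) => b1 b2.
case: x / (mxtens_indexP x) => x1 x2.
by rewrite !drop_lE !tens_mulE mxE !ord1 eqxx mul1r.
Qed.

Lemma tens_one_unit m (u : 'M[K]_(1, m)) :
  tens_one 1%:M u *m funmx K (@drop_l m) = u.
Proof.
apply: (funmx_one_hom (@drop_lK _) (@add_lK _)) => x.
by case: x / (mxtens_indexP x) => x1 x2; rewrite drop_lE tens_oneE mxE !ord1 mul1r.
Qed.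

Lemma tens_end_mul n d n' d' (e : 'M[K]_(d * n, 1)) (e' : 'M[K]_(d' * n', 1))
    (s := swapmx K n d n' d') :
  tens_mul (end_mul e) (end_mul e') *m s = (s *t s) *m end_mul (tens_ev e e').
Proof.
apply: (funmx_alg_hom (@swap_idxK _ _ _ _) (@swap_idxK _ _ _ _)) => a b x.
case: a / (mxtens_indexP a) => a a'; case: a / (mxtens_indexP a) => p xi.
case: a' / (mxtens_indexP a') => p' xi'.
case: b / (mxtens_indexP b) => b b'; case: b / (mxtens_indexP b) => q eta.
case: b' / (mxtens_indexP b') => q' eta'.
case: x / (mxtens_indexP x) => x x'; case: x / (mxtens_indexP x) => r zeta.
case: x' / (mxtens_indexP x') => r' zeta'.
rewrite !swap_idxE tens_mulE !end_mulE tens_evE.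
rewrite !(can_eq (@mxtens_indexK _ _)) !xpair_eqE -!mulnb !natrM; ring.
Qed.

(** These are the two triangle identities with the identity factors contracted: read as matrices,
    [c] and [e] are inverse to each other. *)
Definition mx_dual n d (e : 'M[K]_(d * n, 1)) (c : 'M[K]_(1, n * d)) :=
  (forall p q, \sum_xi c 0 (ix p xi) * e (ix xi q) 0 = (p == q)%:R) /\
  (forall xi eta, \sum_p e (ix xi p) 0 * c 0 (ix p eta) = (xi == eta)%:R).

Lemma mx_dual_tens n d n' d' (e : 'M[K]_(d * n, 1)) (e' : 'M[K]_(d' * n', 1)) c c' :
  mx_dual e c -> mx_dual e' c' -> mx_dual (tens_ev e e') (tens_coev c c').
Proof.
move=> [ce ec] [ce' ec']; split=> p q;
  case: p / (mxtens_indexP p) => p p'; case: q / (mxtens_indexP q) => q q';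
  rewrite (can_eq (@mxtens_indexK _ _)) xpair_eqE -mulnb natrM.
  rewrite -ce -ce' big_mxtens mulr_suml; apply: eq_bigr => i _.
  rewrite mulr_sumr; apply: eq_bigr => j _; rewrite tens_evE tens_coevE; ring.
rewrite -ec -ec' big_mxtens mulr_suml; apply: eq_bigr => i _.
rewrite mulr_sumr; apply: eq_bigr => j _; rewrite tens_evE tens_coevE; ring.
Qed.

Definition mx_alg_laws n (mu : 'M[K]_(n * n, n)) (u : 'M[K]_(1, n)) :=
  [/\ forall a b c y, \sum_w mu (ix a b) w * mu (ix w c) y
        = \sum_w mu (ix b c) w * mu (ix a w) y,
      forall a y, \sum_w u 0 w * mu (ix w a) y = (a == y)%:R &
      forall a y, \sum_w u 0 w * mu (ix a w) y = (a == y)%:R].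

Lemma mx_alg_laws_tens m n mu u nu v :
  @mx_alg_laws m mu u -> @mx_alg_laws n nu v ->
  mx_alg_laws (tens_mul mu nu) (tens_one u v).
Proof.
move=> [am lm rm] [an ln rn].
have S p q (A : 'I_p -> K) (B : 'I_q -> K) :
  (\sum_i A i) * (\sum_j B j) = \sum_i \sum_j A i * B j.
  by rewrite mulr_suml; apply: eq_bigr => i _; rewrite mulr_sumr.
split=> [a b c y|a y|a y]; case: a / (mxtens_indexP a) => a1 a2;
  case: y / (mxtens_indexP y) => y1 y2.
- case: b / (mxtens_indexP b) => b1 b2; case: c / (mxtens_indexP c) => c1 c2.
  transitivity ((\sum_w mu (ix a1 b1) w * mu (ix w c1) y1)
              * (\sum_w nu (ix a2 b2) w * nu (ix w c2) y2)).
    rewrite big_mxtens S; apply: eq_bigr => i _; apply: eq_bigr => j _.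
    by rewrite !tens_mulE mulrACA.
  rewrite am an big_mxtens S; apply: eq_bigr => i _; apply: eq_bigr => j _.
  by rewrite !tens_mulE mulrACA.
- rewrite (can_eq (@mxtens_indexK _ _)) xpair_eqE -mulnb natrM -lm -ln.
  rewrite big_mxtens S; apply: eq_bigr => i _; apply: eq_bigr => j _.
  by rewrite !tens_mulE tens_oneE mulrACA.
- rewrite (can_eq (@mxtens_indexK _ _)) xpair_eqE -mulnb natrM -rm -rn.
  rewrite big_mxtens S; apply: eq_bigr => i _; apply: eq_bigr => j _.
  by rewrite !tens_mulE tens_oneE mulrACA.
Qed.

(** Two-sided multiplication in a tensor product acts on each factor separately, so up to
    interchanges the sandwich matrix is a Kronecker product and inherits invertibility from its
    factors. *)
Lemma sandwich_mx_tens n d n' d' mu nu (c : 'M[K]_(1, n * d)) (c' : 'M[K]_(1, n' * d')) :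
  sandwich_mx (tens_mul mu nu) (tens_coev c c') =
  swapmx K n n' n n' *m (sandwich_mx mu c *t sandwich_mx nu c') *m swapmx K n d n' d'.
Proof.
apply: mxP => x y.
case: x / (mxtens_indexP x) => a b.
case: a / (mxtens_indexP a) => a a'; case: b / (mxtens_indexP b) => b b'.
case: y / (mxtens_indexP y) => y xi.
case: y / (mxtens_indexP y) => y y'; case: xi / (mxtens_indexP xi) => xi xi'.
rewrite mul_swapmxE swapmxE tensmxE !sandwich_mxE big_mxtens mulr_suml.
apply: eq_bigr => i _; rewrite mulr_sumr; apply: eq_bigr => j _.
rewrite tens_coevE mulrACA; congr (_ * _).
rewrite !mxE big_mxtens mulr_suml; apply: eq_bigr => w _; rewrite mulr_sumr.
by apply: eq_bigr => w' _; rewrite !tens_mulE mulrACA.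
Qed.

Definition lmul_mx n (mu : 'M[K]_(n * n, n)) (a : 'I_n) : 'M[K]_n :=
  \matrix_(x, y) mu (ix a x) y.
Definition rmul_mx n (mu : 'M[K]_(n * n, n)) (b : 'I_n) : 'M[K]_n :=
  \matrix_(x, y) mu (ix x b) y.

Lemma bimul_lr n (mu : 'M[K]_(n * n, n)) a b : bimul mu a b = rmul_mx mu b *m lmul_mx mu a.
Proof. by apply: mxP => x y; rewrite !mxE; apply: eq_bigr => w _; rewrite !mxE. Qed.

Section SandwichMorphism.
Variables (n d : nat) (mu : 'M[K]_(n * n, n)) (u : 'M[K]_(1, n)).
Variables (e : 'M[K]_(d * n, 1)) (c : 'M[K]_(1, n * d)).
Hypotheses (laws : mx_alg_laws mu u) (ec : mx_dual e c).

Lemma lrmul_comm a b : lmul_mx mu a *m rmul_mx mu b = rmul_mx mu b *m lmul_mx mu a.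
Proof.
have [as_ _ _] := laws; apply: mxP => x y; rewrite !mxE.
under eq_bigr => w _ do rewrite !mxE.
by rewrite as_; apply: eq_bigr => w _; rewrite !mxE.
Qed.

(** On row vectors the matrix applied first stands on the left, whence the reversed order of a and
    a'. *)
Lemma lmul_mul a a' : \sum_w mu (ix a a') w *: lmul_mx mu w = lmul_mx mu a' *m lmul_mx mu a.
Proof.
have [as_ _ _] := laws; apply: mxP => x y; rewrite summxE !mxE.
under eq_bigr => w _ do rewrite !mxE.
by rewrite as_; apply: eq_bigr => w _; rewrite !mxE.
Qed.

Lemma rmul_mul b b' : \sum_w mu (ix b' b) w *: rmul_mx mu w = rmul_mx mu b' *m rmul_mx mu b.
Proof.
have [as_ _ _] := laws; apply: mxP => x y; rewrite summxE !mxE.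
under eq_bigr => w _ do rewrite !mxE.
by rewrite -as_; apply: eq_bigr => w _; rewrite !mxE.
Qed.

Lemma lmul_one : \sum_w u 0 w *: lmul_mx mu w = 1%:M.
Proof.
have [_ lu _] := laws; apply: mxP => x y; rewrite summxE [RHS]mxE -lu.
by apply: eq_bigr => w _; rewrite !mxE.
Qed.

Lemma rmul_one : \sum_w u 0 w *: rmul_mx mu w = 1%:M.
Proof.
have [_ _ ru] := laws; apply: mxP => x y; rewrite summxE [RHS]mxE -ru.
by apply: eq_bigr => w _; rewrite !mxE.
Qed.

(** A pure tensor f ⊗ g goes to the operator z ↦ f z g. Stated for arbitrary coefficients, this
    serves both for products of basis elements and for the unit. *)
Lemma sandwich_mx_row p q (f g : 'I_n -> K) (x : 'I_p) (w : 'M[K]_(p, n * n)) :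
  (forall a b, w x (ix a b) = f a * g b) -> forall y,
  (w *m sandwich_mx mu c) x (ix y q) =
  \sum_z c 0 (ix z q) *
    ((\sum_b g b *: rmul_mx mu b) *m (\sum_a f a *: lmul_mx mu a)) z y.
Proof.
move=> wE y; rewrite mxE big_mxtens.
under eq_bigr => a _ do under eq_bigr => b _ do
  rewrite wE sandwich_mxE mulr_sumr.
under eq_bigr => a _ do rewrite exchange_big.
rewrite exchange_big; apply: eq_bigr => z _.
rewrite mulmx_sumr summxE mulr_sumr; apply: eq_bigr => a _.
rewrite -scalemxAr mulmx_suml mxE summxE !mulr_sumr; apply: eq_bigr => b _.
rewrite bimul_lr -scalemxAl [X in _ = _ * (_ * X)]mxE; ring.
Qed.

Lemma sandwich_mx_mul (S := sandwich_mx mu c) :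
  tens_mul mu (op_mul mu) *m S = (S *t S) *m end_mul e.
Proof.
apply: mxP => x y; case: x / (mxtens_indexP x) => p p'.
case: p / (mxtens_indexP p) => a b; case: p' / (mxtens_indexP p') => a' b'.
case: y / (mxtens_indexP y) => y q.
rewrite (@sandwich_mx_row _ _ (fun w => mu (ix a a') w) (fun w => mu (ix b' b) w));
  last by move=> i j; rewrite tens_mulE op_mulE.
rewrite lmul_mul rmul_mul.
(* In A ⊗ A^op the product of a ⊗ b and a' ⊗ b' is a a' ⊗ b' b. It acts as the composite of the two
   factors because left and right multiplications commute. *)
have -> : rmul_mx mu b' *m rmul_mx mu b *m (lmul_mx mu a' *m lmul_mx mu a) =
    bimul mu a' b' *m bimul mu a b.
  by rewrite !bimul_lr -!mulmxA; congr (_ *m _); rewrite !mulmxA lrmul_comm.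
have [ce _] := ec.
rewrite [RHS]mxE big_mxtens big_mxtens [RHS](sum_only (z := y)); last first.
  move=> z ne; rewrite big1 // => xi _; rewrite big_mxtens big1 // => r _.
  by rewrite big1 // => eta _; rewrite end_mulE eq_sym (negPf ne) mul0r mulr0.
(* Contraction with [e] removes the dual basis contributed by [c] and leaves the matrix of the
   operator. *)
have E r : \sum_xi S (ix a b) (ix y xi) * e (ix xi r) 0 = bimul mu a b r y.
  under eq_bigr => xi _ do rewrite sandwich_mxE mulr_suml.
  rewrite exchange_big (sum_only (z := r)); last first.
    move=> z /negPf ne; transitivity ((z == r)%:R * bimul mu a b z y); last by rewrite ne mul0r.
    by rewrite -ce mulr_suml; apply: eq_bigr => xi _; rewrite mulrAC.
  transitivity ((r == r)%:R * bimul mu a b r y); last by rewrite eqxx mul1r.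
  by rewrite -ce mulr_suml; apply: eq_bigr => xi _; rewrite mulrAC.
transitivity (\sum_r bimul mu a b r y * S (ix a' b') (ix r q)); last first.
  under eq_bigr => r _ do rewrite -E mulr_suml.
  rewrite exchange_big; apply: eq_bigr => xi _; rewrite big_mxtens; apply: eq_bigr => r _.
  rewrite (sum_only (z := q)); last first.
    by move=> z /negPf ne; rewrite end_mulE ne !mulr0.
  by rewrite end_mulE !eqxx tensmxE mul1r mulr1 mulrAC.
under [RHS]eq_bigr => r _ do rewrite sandwich_mxE mulr_sumr.
rewrite exchange_big; apply: eq_bigr => z _; rewrite mxE mulr_sumr.
by apply: eq_bigr => r _; rewrite mulrA mulrC.
Qed.

Lemma sandwich_mx_one : tens_one u u *m sandwich_mx mu c = c.
Proof.
apply: mxP => x y; case: y / (mxtens_indexP y) => y q.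
rewrite (@sandwich_mx_row _ _ (fun w => u 0 w) (fun w => u 0 w));
  last by move=> i j; rewrite tens_oneE.
rewrite lmul_one rmul_one mulmx1 (sum_only (z := y)); last first.
  by move=> z ne; rewrite mxE (negPf ne) mulr0.
by rewrite mxE eqxx mulr1 (ord1 x).
Qed.

End SandwichMorphism.
End MatrixAlgebraMorphisms.

(** * Coherence in representation categories, ultraproducts and full subcategories *)

Section CoherentCategories.
Local Open Scope tcat_scope.
Variable C : tensorCat.
Implicit Types (X Y : C) (A B D : algebra C).

(** Here and in [sandwich_of] the duality data come without the proof of duality: the components of
    a dual pair in an ultraproduct are dual only for almost all indices, so they do not form a
    [dual_of] at each index. *)
Definition end_alg_of X Y (e : hom (Y ⊗ X) 𝟙) (c : hom 𝟙 (X ⊗ Y)) : algebra C :=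
  @Algebra C (X ⊗ Y)
    (assoc X Y (X ⊗ Y) ;; idm X ⊠ (assocV Y X Y ;; e ⊠ idm Y ;; lunit Y)) c.

Definition sandwich_of A Y (c : hom 𝟙 (A ⊗ Y)) : hom (A ⊗ A) (A ⊗ Y) :=
  runitV (A ⊗ A) ;; idm (A ⊗ A) ⊠ c ;; assocV (A ⊗ A) A Y
  ;; (assoc A A A ;; idm A ⊠ (braid A A ;; amul A) ;; amul A) ⊠ idm Y.

Definition tens_evm X Y X' Y' (e : hom (Y ⊗ X) 𝟙) (e' : hom (Y' ⊗ X') 𝟙) :
    hom ((Y ⊗ Y') ⊗ (X ⊗ X')) 𝟙 := swap_mid Y Y' X X' ;; e ⊠ e' ;; lunit 𝟙.
Definition tens_coevm X Y X' Y' (c : hom 𝟙 (X ⊗ Y)) (c' : hom 𝟙 (X' ⊗ Y')) :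
    hom 𝟙 ((X ⊗ X') ⊗ (Y ⊗ Y')) := lunitV 𝟙 ;; c ⊠ c' ;; swap_mid X Y X' Y'.

(* The coherence facts that the theory of Brauer classes rests on. In any symmetric
   monoidal category they follow from the axioms; proving them by components in
   [rep_cat] and transporting them to ultraproducts and full subcategories is shorter. *)
Record coherent : Prop := Coherent {
  coh_dual : forall X Y X' Y' (e : hom (Y ⊗ X) 𝟙) c (e' : hom (Y' ⊗ X') 𝟙) c',
    is_dual e c -> is_dual e' c' -> is_dual (tens_evm e e') (tens_coevm c c');
  coh_unit_dual : is_dual (lunit 𝟙 : hom (𝟙 ⊗ 𝟙) 𝟙) (lunitV (𝟙 : C));
  coh_end : forall X Y X' Y' (e : hom (Y ⊗ X) 𝟙) c (e' : hom (Y' ⊗ X') 𝟙) c',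
    alg_iso (tens_alg (end_alg_of e c) (end_alg_of e' c'))
            (end_alg_of (tens_evm e e') (tens_coevm c c'));
  coh_assoc : forall A B D, alg_iso (tens_alg (tens_alg A B) D) (tens_alg A (tens_alg B D));
  coh_comm : forall A B, alg_iso (tens_alg A B) (tens_alg B A);
  coh_unit : forall A, alg_iso (tens_alg (unit_alg C) A) A;
  coh_laws : forall A B, alg_laws A -> alg_laws B -> alg_laws (tens_alg A B);
  coh_unit_laws : alg_laws (unit_alg C);
  coh_sandwich : forall A Y (e : hom (Y ⊗ A) 𝟙) c, alg_laws A -> is_dual e c ->
    is_iso (sandwich_of c) -> alg_iso (tens_alg A (op_alg A)) (end_alg_of e c);
  coh_sandwich_tens : forall A B Y Y' (c : hom 𝟙 (A ⊗ Y)) (c' : hom 𝟙 (B ⊗ Y')),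
    is_iso (sandwich_of c) -> is_iso (sandwich_of c') ->
    is_iso (@sandwich_of (tens_alg A B) _ (tens_coevm c c'));
  coh_unit_sandwich : is_iso (@sandwich_of (unit_alg C) _ (lunitV 𝟙));
  coh_nonzero : forall X Y, ~ is_zero X -> ~ is_zero Y -> ~ is_zero (X ⊗ Y);
  coh_unit_nonzero : ~ is_zero (𝟙 : C)
}.

End CoherentCategories.

Section UnitMatrixAlgebra.
Variable K : fieldType.
Local Notation ix x y := (mxtens_index (x, y)).

Lemma unit_mx_alg_laws : mx_alg_laws (funmx K (@drop_l 1)) 1%:M.
Proof.
by split=> *; rewrite !big_ord1 ?mxE ?ord1 ?eqxx ?mul1r.
Qed.

Lemma unit_mx_dual : mx_dual (funmx K (@drop_l 1)) (funmx K (@add_l 1)).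
Proof. by split=> *; rewrite !big_ord1 !mxE !ord1 ?eqxx ?mul1r. Qed.

Lemma unit_sandwich_mx : sandwich_mx (funmx K (@drop_l 1)) (funmx K (@add_l 1)) = 1%:M.
Proof.
apply: mxP => x y; case: x / (mxtens_indexP x) => a b; case: y / (mxtens_indexP y) => y xi.
by rewrite sandwich_mxE !(big_ord1, mxE) !ord1 ?eqxx !mul1r.
Qed.
End UnitMatrixAlgebra.

Section MatrixDuality.
Variable K : fieldType.
Local Notation ix x y := (mxtens_index (x, y)).

Lemma zig_mxE n d (e : 'M[K]_(d * n, 1)) (c : 'M[K]_(1, n * d)) x y :
  (funmx K (@add_l n) *m (c *t 1%:M) *m funmx K (@reassoc n d n) *m (1%:M *t e)
    *m funmx K (@drop_r n)) x y = \sum_xi c 0 (ix y xi) * e (ix xi x) 0.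
Proof.
rewrite (mul_funmx _ _ _ (@drop_rK _) (@add_rK _)) -!mulmxA funmx_mul mulmxA.
rewrite mxE big_mxtens (sum_only (z := y)); last first.
  move=> a ne; rewrite big1 // => p _.
  by rewrite tensmxE [1%:M _ _]mxE (negPf ne) mul0r mulr0.
rewrite big_mxtens; apply: eq_bigr => xi _; rewrite (sum_only (z := x)); last first.
  move=> b ne; rewrite (mul_funmx _ _ _ (@reassocK _ _ _) (@reassocVK _ _ _)).
  by rewrite reassocVE tensmxE [1%:M _ _]mxE eq_sym (negPf ne) mulr0 mul0r.
rewrite (mul_funmx _ _ _ (@reassocK _ _ _) (@reassocVK _ _ _)) reassocVE !tensmxE.
by rewrite ![1%:M _ _]mxE !eqxx mulr1 mul1r.
Qed.

Lemma zag_mxE n d (e : 'M[K]_(d * n, 1)) (c : 'M[K]_(1, n * d)) x y :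
  (funmx K (@add_r d) *m (1%:M *t c) *m funmx K (@reassocV d n d) *m (e *t 1%:M)
    *m funmx K (@drop_l d)) x y = \sum_p e (ix x p) 0 * c 0 (ix p y).
Proof.
rewrite (mul_funmx _ _ _ (@drop_lK _) (@add_lK _)) -!mulmxA funmx_mul mulmxA.
rewrite mxE big_mxtens exchange_big (sum_only (z := y)); last first.
  move=> a ne; rewrite big1 // => p _.
  by rewrite tensmxE [1%:M _ _]mxE (negPf ne) !mulr0.
rewrite big_mxtens (sum_only (z := x)); last first.
  move=> b ne; rewrite big1 // => p _.
  rewrite (mul_funmx _ _ _ (@reassocVK _ _ _) (@reassocK _ _ _)).
  by rewrite reassocE tensmxE [1%:M _ _]mxE eq_sym (negPf ne) !mul0r.
apply: eq_bigr => p _.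
rewrite (mul_funmx _ _ _ (@reassocVK _ _ _) (@reassocK _ _ _)) reassocE !tensmxE.
by rewrite ![1%:M _ _]mxE !eqxx mulr1 mul1r mulrC.
Qed.

Lemma swap_mid_mx a b c d :
  funmx K (@reassoc a b (c * d))
  *m (1%:M *t (funmx K (@reassocV b c d) *m (funmx K (@flip_idx b c) *t 1%:M)
               *m funmx K (@reassoc c b d)))
  *m funmx K (@reassocV a c (b * d)) = swapmx K a b c d.
Proof.
rewrite -!funmx_id !tensmx_fun !(funmx_comp, tensmx_fun).
apply: eq_funmx => x; case: x / (mxtens_indexP x) => x y.
case: x / (mxtens_indexP x) => i j; case: y / (mxtens_indexP y) => k l.
by rewrite /= !idxE swap_idxE.
Qed.

Lemma mx_alg_lawsP n (mu : 'M[K]_(n * n, n)) (u : 'M[K]_(1, n)) :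
  mx_alg_laws mu u <->
  [/\ (mu *t 1%:M) *m mu = funmx K (@reassoc n n n) *m (1%:M *t mu) *m mu,
      (u *t 1%:M) *m mu = funmx K (@drop_l n) &
      (1%:M *t u) *m mu = funmx K (@drop_r n)].
Proof.
have L a b c y : ((mu *t 1%:M) *m mu) (ix (ix a b) c) y =
    \sum_w mu (ix a b) w * mu (ix w c) y.
  rewrite mxE big_mxtens; apply: eq_bigr => w _; rewrite (sum_only (z := c)).
    by rewrite tensmxE [1%:M _ _]mxE eqxx mulr1.
  by move=> z ne; rewrite tensmxE [1%:M _ _]mxE eq_sym (negPf ne) mulr0 mul0r.
have R a b c y : (funmx K (@reassoc n n n) *m (1%:M *t mu) *m mu) (ix (ix a b) c) y =
    \sum_w mu (ix b c) w * mu (ix a w) y.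
  rewrite -mulmxA funmx_mul reassocE mxE big_mxtens exchange_big.
  apply: eq_bigr => w _; rewrite (sum_only (z := a)).
    by rewrite tensmxE [1%:M _ _]mxE eqxx mul1r.
  by move=> z ne; rewrite tensmxE [1%:M _ _]mxE eq_sym (negPf ne) !mul0r.
have L1 i a y : ((u *t 1%:M) *m mu) (ix i a) y = \sum_w u 0 w * mu (ix w a) y.
  rewrite (ord1 i) mxE big_mxtens; apply: eq_bigr => w _; rewrite (sum_only (z := a)).
    by rewrite tensmxE [1%:M _ _]mxE eqxx mulr1.
  by move=> z ne; rewrite tensmxE [1%:M _ _]mxE eq_sym (negPf ne) mulr0 mul0r.
have R1 i a y : ((1%:M *t u) *m mu) (ix a i) y = \sum_w u 0 w * mu (ix a w) y.
  rewrite (ord1 i) mxE big_mxtens exchange_big; apply: eq_bigr => w _.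
  rewrite (sum_only (z := a)); first by rewrite tensmxE [1%:M _ _]mxE eqxx mul1r.
  by move=> z ne; rewrite tensmxE [1%:M _ _]mxE eq_sym (negPf ne) !mul0r.
split=> -[e1 e2 e3]; split.
- apply: mxP => x y; case: x / (mxtens_indexP x) => x c.
  by case: x / (mxtens_indexP x) => a b; rewrite L R e1.
- apply: mxP => x y; case: x / (mxtens_indexP x) => i a.
  by rewrite L1 e2 mxE drop_lE eq_sym.
- apply: mxP => x y; case: x / (mxtens_indexP x) => a i.
  by rewrite R1 e3 mxE drop_rE eq_sym.
- by move=> a b c y; rewrite -L -R e1.
- by move=> a y; rewrite -(L1 ord0) e2 mxE drop_lE eq_sym.
- by move=> a y; rewrite -(R1 ord0) e3 mxE drop_rE eq_sym.
Qed.
End MatrixDuality.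

Section RepresentationCoherence.
Local Open Scope tcat_scope.
Variables (K : fieldType) (gT : finGroupType) (G : {group gT}).
Local Notation RC := (rep_cat K G).
Implicit Types (X Y Z W : RC) (A B : algebra RC).

Lemma hmx_swap_mid X Y Z W :
  hmx (swap_mid X Y Z W) = swapmx K (rdim X) (rdim Y) (rdim Z) (rdim W).
Proof. exact: swap_mid_mx. Qed.

Lemma rep_is_dual X Y (e : hom (Y ⊗ X) 𝟙) (c : hom 𝟙 (X ⊗ Y)) :
  is_dual e c <-> @mx_dual K (rdim X) (rdim Y) (hmx e) (hmx c).
Proof.
split=> -[h1 h2]; split.
- move=> p q; apply: etrans (esym (zig_mxE _ _ _ _)) _.
  by apply: (etrans (congr1 (fun M : 'M[K]_(rdim X) => M q p) h1)); rewrite mxE eq_sym.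
- move=> p q; apply: etrans (esym (zag_mxE _ _ _ _)) _.
  by apply: (etrans (congr1 (fun M : 'M[K]_(rdim Y) => M p q) h2)); rewrite mxE.
- apply: mxP => x y; apply: (etrans (zig_mxE (hmx e) (hmx c) x y)).
  by rewrite h1 mxE eq_sym.
- apply: mxP => x y; apply: (etrans (zag_mxE (hmx e) (hmx c) x y)).
  by rewrite h2 mxE.
Qed.

Lemma rep_alg_laws A :
  alg_laws A <-> @mx_alg_laws K (rdim (aobj A)) (hmx (amul A)) (hmx (aone A)).
Proof. exact: (iff_sym (mx_alg_lawsP (hmx (amul A)) (hmx (aone A)))). Qed.

Lemma hmx_tens_amul A B :
  hmx (amul (tens_alg A B)) =
  @tens_mul K (rdim (aobj A)) (rdim (aobj B)) (hmx (amul A)) (hmx (amul B)).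
Proof.
exact: (congr1 (fun M => M *m (hmx (amul A) *t hmx (amul B))) (hmx_swap_mid _ _ _ _)).
Qed.

(** The inverse of an equivariant matrix is equivariant, so isomorphisms may be tested on
    matrices. *)
Lemma rep_is_iso X Y (f : hom X Y) (g : 'M[K]_(rdim Y, rdim X)) :
  hmx f *m g = 1%:M -> g *m hmx f = 1%:M -> is_iso f.
Proof.
move=> fg gf; have gP : {in G, forall x, Y x *m g = g *m X x}.
  move=> x xG; rewrite -[LHS]mul1mx -gf -!mulmxA (mulmxA (hmx f)) -hmxP //.
  by rewrite -!mulmxA fg mulmx1.
by exists (RepHom gP).
Qed.

Lemma swapmxK a b c d : swapmx K a b c d *m swapmx K a c b d = 1%:M.
Proof. by rewrite funmx_comp -funmx_id; apply: eq_funmx; exact: swap_idxK. Qed.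

Lemma rep_swap_mid_iso X Y Z W : is_iso (swap_mid X Y Z W).
Proof.
by apply: rep_is_iso; rewrite hmx_swap_mid; exact: swapmxK.
Qed.

Lemma iso_comp (C : tensorCat) (X Y Z : C) (f : hom X Y) (g : hom Y Z) :
  is_iso f -> is_iso g -> is_iso (f ;; g).
Proof.
move=> [f' [ff' f'f]] [g' [gg' g'g]]; exists (g' ;; f'); split.
  by rewrite comp_assoc -(comp_assoc g) gg' comp_id_l.
by rewrite comp_assoc -(comp_assoc f') f'f comp_id_l.
Qed.

Lemma is_iso_tens (C : tensorCat) (X Y X' Y' : C) (f : hom X Y) (g : hom X' Y') :
  is_iso f -> is_iso g -> is_iso (f ⊠ g).
Proof.
move=> [f' [ff' f'f]] [g' [gg' g'g]]; exists (f' ⊠ g').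
by split; rewrite -tensm_comp ?ff' ?gg' ?f'f ?g'g tensm_id.
Qed.

Lemma is_iso_heq (C : tensorCat) (X Y : C) (f g : hom X Y) :
  f =~ g -> is_iso f -> is_iso g.
Proof. by move=> fg [f' [e1 e2]]; exists f'; split; rewrite -fg. Qed.

Lemma rep_is_zero X : is_zero X <-> rdim X = 0%N.
Proof.
split=> [h|]; last first.
  by case: X => n r /= n0; apply: mxP => x; exfalso; case: x => m /=; rewrite n0.
case E: (rdim X) => [//|n].
have i0 : 'I_(rdim X) by rewrite E; exact: ord0.
have := congr1 (fun M : 'M[K]_(rdim X) => M i0 i0) h.
by rewrite !mxE eqxx => /eqP; rewrite oner_eq0.
Qed.

Lemma hmx_tens_coevm X Y X' Y' (c : hom 𝟙 (X ⊗ Y)) (c' : hom 𝟙 (X' ⊗ Y')) :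
  hmx (tens_coevm c c') =
  @tens_coev K (rdim X) (rdim Y) (rdim X') (rdim Y') (hmx c) (hmx c').
Proof.
exact: (congr1 (fun M => funmx K (@add_l 1) *m (hmx c *t hmx c') *m M)
  (hmx_swap_mid _ _ _ _)).
Qed.

Lemma hmx_tens_evm X Y X' Y' (e : hom (Y ⊗ X) 𝟙) (e' : hom (Y' ⊗ X') 𝟙) :
  hmx (tens_evm e e') =
  @tens_ev K (rdim X) (rdim Y) (rdim X') (rdim Y') (hmx e) (hmx e').
Proof.
exact: (congr1 (fun M => M *m (hmx e *t hmx e') *m funmx K (@drop_l 1))
  (hmx_swap_mid _ _ _ _)).
Qed.

Lemma rep_coh_dual X Y X' Y' (e : hom (Y ⊗ X) 𝟙) c (e' : hom (Y' ⊗ X') 𝟙) c' :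
  is_dual e c -> is_dual e' c' -> is_dual (tens_evm e e') (tens_coevm c c').
Proof.
move=> /rep_is_dual d /rep_is_dual d'; apply/rep_is_dual.
rewrite hmx_tens_evm hmx_tens_coevm; exact: mx_dual_tens.
Qed.

Lemma rep_alg_iso A B (f : hom (aobj A) (aobj B)) : is_iso f ->
  hmx (amul A) *m hmx f = (hmx f *t hmx f) *m hmx (amul B) ->
  hmx (aone A) *m hmx f = hmx (aone B) -> alg_iso A B.
Proof. by move=> h1 h2 h3; exists f. Qed.

Lemma rep_coh_end X Y X' Y' (e : hom (Y ⊗ X) 𝟙) c (e' : hom (Y' ⊗ X') 𝟙) c' :
  alg_iso (tens_alg (end_alg_of e c) (end_alg_of e' c'))
          (end_alg_of (tens_evm e e') (tens_coevm c c')).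
Proof.
apply: (@rep_alg_iso (tens_alg (end_alg_of e c) (end_alg_of e' c'))
  (end_alg_of (tens_evm e e') (tens_coevm c c')) (swap_mid X Y X' Y')).
- exact: rep_swap_mid_iso.
-
  rewrite hmx_tens_amul hmx_swap_mid.
  apply: etrans (tens_end_mul (hmx e) (hmx e')) _.
  by congr (_ *m end_mul _); rewrite hmx_tens_evm.
- by rewrite hmx_tens_coevm hmx_swap_mid.
Qed.

Lemma rep_coh_assoc A B D :
  alg_iso (tens_alg (tens_alg A B) D) (tens_alg A (tens_alg B D)).
Proof.
apply: (@rep_alg_iso (tens_alg (tens_alg A B) D) (tens_alg A (tens_alg B D)) (assoc _ _ _)).
- by exists (assocV _ _ _); split; [exact: assocK|exact: assocVK].
- rewrite !hmx_tens_amul; exact: tens_mul_assoc.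
- exact: tens_one_assoc.
Qed.

Lemma rep_coh_comm A B : alg_iso (tens_alg A B) (tens_alg B A).
Proof.
apply: (@rep_alg_iso (tens_alg A B) (tens_alg B A) (braid _ _)).
- by exists (braid _ _); split; exact: braid_invol.
- rewrite !hmx_tens_amul; exact: tens_mul_flip.
- exact: tens_one_flip.
Qed.

Lemma rep_coh_unit A : alg_iso (tens_alg (unit_alg RC) A) A.
Proof.
apply: (@rep_alg_iso (tens_alg (unit_alg RC) A) A (lunit _)).
- by exists (lunitV _); split; [exact: lunitK|exact: lunitVK].
- rewrite !hmx_tens_amul; exact: tens_mul_unit.
- exact: tens_one_unit.
Qed.

Lemma rep_coh_laws A B : alg_laws A -> alg_laws B -> alg_laws (tens_alg A B).
Proof.
move=> /rep_alg_laws a /rep_alg_laws b; apply/rep_alg_laws.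
rewrite hmx_tens_amul; exact: mx_alg_laws_tens.
Qed.

Lemma hmx_sandwich A Y (c : hom 𝟙 (A ⊗ Y)) :
  hmx (sandwich_of c) = @sandwich_mx K (rdim (aobj A)) (rdim Y) (hmx (amul A)) (hmx c).
Proof. by []. Qed.

Lemma hmx_op_amul A : hmx (amul (op_alg A)) = @op_mul K (rdim (aobj A)) (hmx (amul A)).
Proof. by []. Qed.

Lemma hmx_end_amul X Y (e : hom (Y ⊗ X) 𝟙) (c : hom 𝟙 (X ⊗ Y)) :
  hmx (amul (end_alg_of e c)) = @end_mul K (rdim X) (rdim Y) (hmx e).
Proof. by []. Qed.

Lemma rep_coh_sandwich A Y (e : hom (Y ⊗ A) 𝟙) c : alg_laws A -> is_dual e c ->
  is_iso (sandwich_of c) -> alg_iso (tens_alg A (op_alg A)) (end_alg_of e c).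
Proof.
move=> /rep_alg_laws l /rep_is_dual d si; apply: (@rep_alg_iso (tens_alg A (op_alg A)) (end_alg_of e c)
  (sandwich_of c) si).
  rewrite hmx_tens_amul hmx_op_amul hmx_end_amul hmx_sandwich.
  exact: (sandwich_mx_mul l d).
rewrite hmx_sandwich; exact: (sandwich_mx_one (hmx c) l).
Qed.

Lemma rep_coh_sandwich_tens A B Y Y' (c : hom 𝟙 (A ⊗ Y)) (c' : hom 𝟙 (B ⊗ Y')) :
  is_iso (sandwich_of c) -> is_iso (sandwich_of c') ->
  is_iso (@sandwich_of RC (tens_alg A B) _ (tens_coevm c c')).
Proof.
move=> s s'.
apply: (@is_iso_heq _ _ _ (swap_mid A B A B ;; sandwich_of c ⊠ sandwich_of c'
                            ;; swap_mid A Y B Y')).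
  change (hmx (swap_mid A B A B) *m (hmx (sandwich_of c) *t hmx (sandwich_of c'))
     *m hmx (swap_mid (aobj A) Y B Y')
    = @sandwich_mx K (rdim (aobj A) * rdim (aobj B)) (rdim Y * rdim Y')
        (hmx (amul (tens_alg A B))) (hmx (tens_coevm c c'))).
  rewrite !hmx_swap_mid hmx_tens_amul hmx_tens_coevm !hmx_sandwich.
  exact: esym (sandwich_mx_tens (hmx (amul A)) (hmx (amul B)) (hmx c) (hmx c')).
apply: iso_comp; last exact: rep_swap_mid_iso.
by apply: iso_comp; [exact: rep_swap_mid_iso|exact: is_iso_tens].
Qed.

Lemma rep_coherent : coherent RC.
Proof.
split.
- exact: rep_coh_dual.
- apply/rep_is_dual; exact: unit_mx_dual.
- exact: rep_coh_end.
- exact: rep_coh_assoc.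
- exact: rep_coh_comm.
- exact: rep_coh_unit.
- exact: rep_coh_laws.
- apply/rep_alg_laws; exact: unit_mx_alg_laws.
- exact: rep_coh_sandwich.
- exact: rep_coh_sandwich_tens.
- have e : hmx (@sandwich_of RC (unit_alg RC) _ (lunitV 𝟙)) = 1%:M.
    exact: unit_sandwich_mx.
  by apply: (@rep_is_iso _ _ _ 1%:M); rewrite e mulmx1.
- move=> X Y /rep_is_zero x0 /rep_is_zero y0 /rep_is_zero/eqP.
  by rewrite muln_eq0 => /orP[/eqP|/eqP].
- by move=> /rep_is_zero.
Qed.

End RepresentationCoherence.

(** * Passage to full subcategories *)

Section FullCoherent.
Local Open Scope tcat_scope.
Variables (C : tensorCat) (P : C -> Prop) (P1 : P 𝟙).
Hypothesis PT : forall X Y, P X -> P Y -> P (X ⊗ Y).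
Local Notation FC := (full_subcat P1 PT).

Definition forget_alg (A : algebra FC) : algebra C :=
  @Algebra C (sval (aobj A)) (amul A) (aone A).

Lemma full_alg_iso (A B : algebra FC) :
  alg_iso (forget_alg A) (forget_alg B) -> alg_iso A B.
Proof. by move=> [f [[g [fg gf]] h1 h2]]; exists f; split=> //; exists g. Qed.

Lemma alg_iso_forget (A B : algebra FC) :
  alg_iso A B -> alg_iso (forget_alg A) (forget_alg B).
Proof. by move=> [f [[g [fg gf]] h1 h2]]; exists f; split=> //; exists g. Qed.

Lemma full_alg_laws (A : algebra FC) : alg_laws (forget_alg A) -> alg_laws A.
Proof. by case; split. Qed.

Lemma alg_laws_forget (A : algebra FC) : alg_laws A -> alg_laws (forget_alg A).
Proof. by case; split. Qed.

Lemma full_is_iso (X Y : FC) (f : hom X Y) : @is_iso C _ _ f -> is_iso f.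
Proof. by move=> [g [fg gf]]; exists g; split. Qed.

Lemma is_iso_forget (X Y : FC) (f : hom X Y) : is_iso f -> @is_iso C _ _ f.
Proof. by move=> [g [fg gf]]; exists g; split. Qed.

(** The dual object has to satisfy [P] as well. For the twisted group algebra it is V itself. *)
Lemma full_azumaya (A : algebra C) (PA : P A) (Y : C) (PY : P Y)
    (e : hom (Y ⊗ A) 𝟙) (c : hom 𝟙 (A ⊗ Y)) :
  alg_laws A -> is_dual e c -> is_iso (sandwich_of c) -> azumaya (full_alg P1 PT PA).
Proof.
move=> l d s; split; first exact: (@full_alg_laws (full_alg P1 PT PA)).
exists (@DualOf FC (exist _ (aobj A) PA) (exist _ Y PY) e c d).
exact: (@full_is_iso _ _ (@sandwich_of FC (full_alg P1 PT PA) (exist _ Y PY) c)).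
Qed.

Lemma full_square_op (A : algebra C) (PA : P A) (B := full_alg P1 PT PA) :
  alg_iso (tens_alg A A) (tens_alg (op_alg A) (op_alg A)) ->
  alg_iso (tens_alg B B) (tens_alg (op_alg B) (op_alg B)).
Proof. exact: (@full_alg_iso (tens_alg B B) (tens_alg (op_alg B) (op_alg B))). Qed.

Lemma full_coherent : coherent C -> coherent FC.
Proof.
move=> coh; split.
- move=> X Y X' Y' e c e' c' d d'.
  exact: (@coh_dual C coh (sval X) (sval Y) (sval X') (sval Y') e c e' c' d d').
- exact: (coh_unit_dual coh).
- move=> X Y X' Y' e c e' c'; apply: full_alg_iso.
  exact: (@coh_end C coh (sval X) (sval Y) (sval X') (sval Y') e c e' c').
- move=> A B D; apply: full_alg_iso.
  exact: (coh_assoc coh (forget_alg A) (forget_alg B) (forget_alg D)).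
- move=> A B; apply: full_alg_iso.
  exact: (coh_comm coh (forget_alg A) (forget_alg B)).
- move=> A; apply: full_alg_iso; exact: (coh_unit coh (forget_alg A)).
- move=> A B /alg_laws_forget a /alg_laws_forget b; apply: full_alg_laws.
  exact: (coh_laws coh a b).
- apply: full_alg_laws; exact: (coh_unit_laws coh).
- move=> A Y e c /alg_laws_forget a d /is_iso_forget s; apply: full_alg_iso.
  exact: (@coh_sandwich C coh (forget_alg A) (sval Y) e c a d s).
- move=> A B Y Y' c c' /is_iso_forget s /is_iso_forget s'; apply: full_is_iso.
  exact: (@coh_sandwich_tens C coh (forget_alg A) (forget_alg B) (sval Y) (sval Y') c c' s s').
- apply: full_is_iso; exact: (coh_unit_sandwich coh).
- move=> X Y; exact: (@coh_nonzero C coh (sval X) (sval Y)).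
- exact: (coh_unit_nonzero coh).
Qed.

End FullCoherent.

(** * Passage to ultraproducts *)

Section UltraCoherent.
Local Open Scope tcat_scope.
Variables (I : Type) (U : set_system I).
Context {FU : Filter U}.
Variable C : I -> tensorCat.
Local Notation UC := (ultraproduct U C).

Definition comp_alg (A : algebra UC) (i : I) : algebra (C i) :=
  @Algebra (C i) (aobj A i) (amul A i) (aone A i).

Lemma ultra_is_iso (X Y : UC) (f : hom X Y) :
  U [set i | is_iso (f i)] -> is_iso f.
Proof.
move=> Uf; have h i : {g : hom (Y i) (X i) | is_iso (f i) -> is_inverse (f i) g}.
  apply: cid; have [[g gP]|n] := pselect (is_iso (f i)); first by exists g.
  (* The zero morphism is a default value at the exceptional indices, where nothing is required of
     it. *)
  by exists (hzero _ _).
exists (fun i => sval (h i)); split; apply: filterS Uf => i /(svalP (h i)) [fg gf] //.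
Qed.

Lemma is_iso_comp (X Y : UC) (f : hom X Y) :
  is_iso f -> U [set i | is_iso (f i)].
Proof. by move=> [g [fg gf]]; apply: filterS2 fg gf => i fg gf; exists (g i). Qed.

Lemma ultra_alg_iso (A B : algebra UC) :
  U [set i | alg_iso (comp_alg A i) (comp_alg B i)] -> alg_iso A B.
Proof.
move=> UAB.
pose good i (f : hom (aobj A i) (aobj B i)) :=
  [/\ is_iso f, amul A i ;; f =~ f ⊠ f ;; amul B i & aone A i ;; f =~ aone B i].
have h i : {f : hom (aobj A i) (aobj B i) |
    alg_iso (comp_alg A i) (comp_alg B i) -> good i f}.
  apply: cid; have [[f fP]|n] := pselect (alg_iso (comp_alg A i) (comp_alg B i)).
    by exists f.
  by exists (hzero _ _).
exists (fun i => sval (h i)); split.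
- by apply: ultra_is_iso; apply: filterS UAB => i /(svalP (h i)) [].
- by apply: filterS UAB => i /(svalP (h i)) [].
- by apply: filterS UAB => i /(svalP (h i)) [].
Qed.

Lemma alg_iso_comp (A B : algebra UC) :
  alg_iso A B -> U [set i | alg_iso (comp_alg A i) (comp_alg B i)].
Proof.
move=> [f [/is_iso_comp Uf U1 U2]].
by apply: filterS3 Uf U1 U2 => i h1 h2 h3; exists (f i).
Qed.

Lemma alg_laws_comp (A : algebra UC) :
  alg_laws A -> U [set i | alg_laws (comp_alg A i)].
Proof. by move=> [U1 U2 U3]; apply: filterS3 U1 U2 U3 => i h1 h2 h3; split. Qed.

Lemma ultra_alg_laws (A : algebra UC) :
  U [set i | alg_laws (comp_alg A i)] -> alg_laws A.
Proof. by move=> UA; split; apply: filterS UA => i []. Qed.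

Lemma is_dual_comp (X Y : UC) (e : hom (Y ⊗ X) 𝟙) (c : hom 𝟙 (X ⊗ Y)) :
  is_dual e c -> U [set i | is_dual (e i : hom (Y i ⊗ X i) 𝟙) (c i)].
Proof. by move=> [U1 U2]; apply: filterS2 U1 U2 => i h1 h2; split. Qed.

Lemma ultra_is_dual (X Y : UC) (e : hom (Y ⊗ X) 𝟙) (c : hom 𝟙 (X ⊗ Y)) :
  U [set i | is_dual (e i : hom (Y i ⊗ X i) 𝟙) (c i)] -> is_dual e c.
Proof. by move=> Uec; split; apply: filterS Uec => i []. Qed.

Lemma ultra_sandwich (A : forall i, algebra (C i)) (Y : UC)
    (c : @hom UC 𝟙 (ultra_alg (U := U) A ⊗ Y)) :
  (forall i, is_iso (@sandwich_of (C i) (A i) (Y i) (c i))) -> is_iso (sandwich_of c).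
Proof. by move=> h; apply: ultra_is_iso; apply: filterE => i; exact: h. Qed.

Lemma ultra_square_op (A : forall i, algebra (C i)) (B := ultra_alg (U := U) A) :
  (forall i, alg_iso (tens_alg (A i) (A i)) (tens_alg (op_alg (A i)) (op_alg (A i)))) ->
  alg_iso (tens_alg B B) (tens_alg (op_alg B) (op_alg B)).
Proof.
move=> h; apply: (@ultra_alg_iso (tens_alg B B) (tens_alg (op_alg B) (op_alg B))).
by apply: filterE => i; exact: h.
Qed.

Hypothesis FU' : UltraFilter U.

Lemma ultraN (P : set I) : ~ U P -> U (~` P).
Proof. by have [] := in_ultra_setVsetC P FU'. Qed.

Lemma ultra_coherent : (forall i, coherent (C i)) -> coherent UC.
Proof.
move=> coh; split.
- move=> X Y X' Y' e c e' c' /is_dual_comp Ud /is_dual_comp Ud'.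
  apply: ultra_is_dual; apply: filterS2 Ud Ud' => i d d'.
  exact: (coh_dual (coh i) d d').
- by apply: ultra_is_dual; apply: filterE => i; exact: (coh_unit_dual (coh i)).
- move=> X Y X' Y' e c e' c'; apply: ultra_alg_iso; apply: filterE => i.
  exact: (@coh_end _ (coh i) (X i) (Y i) (X' i) (Y' i) (e i) (c i) (e' i) (c' i)).
- move=> A B D; apply: ultra_alg_iso; apply: filterE => i.
  exact: (coh_assoc (coh i) (comp_alg A i) (comp_alg B i) (comp_alg D i)).
- move=> A B; apply: ultra_alg_iso; apply: filterE => i.
  exact: (coh_comm (coh i) (comp_alg A i) (comp_alg B i)).
- move=> A; apply: ultra_alg_iso; apply: filterE => i.
  exact: (coh_unit (coh i) (comp_alg A i)).
- move=> A B /alg_laws_comp UA /alg_laws_comp UB; apply: ultra_alg_laws.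
  apply: filterS2 UA UB => i a b; exact: (coh_laws (coh i) a b).
- apply: ultra_alg_laws; apply: filterE => i; exact: (coh_unit_laws (coh i)).
- move=> A Y e c /alg_laws_comp UA /is_dual_comp Ud /is_iso_comp Us.
  apply: ultra_alg_iso; apply: filterS3 UA Ud Us => i a d s.
  exact: (@coh_sandwich _ (coh i) (comp_alg A i) (Y i) (e i) (c i) a d s).
- move=> A B Y Y' c c' /is_iso_comp Us /is_iso_comp Us'; apply: ultra_is_iso.
  apply: filterS2 Us Us' => i s s'.
  exact: (@coh_sandwich_tens _ (coh i) (comp_alg A i) (comp_alg B i) (Y i) (Y' i)
    (c i) (c' i) s s').
- apply: ultra_is_iso; apply: filterE => i; exact: (coh_unit_sandwich (coh i)).
(* Being nonzero in the ultraproduct only denies that an object vanishes almost everywhere;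
   maximality of the ultrafilter turns this into being nonzero almost everywhere, and the large sets
   meet. *)
- move=> X Y /ultraN Ux /ultraN Uy Uxy.
  have [i [/= x [y xy]]] := filter_ex (filterI Ux (filterI Uy Uxy)).
  exact: (coh_nonzero (coh i) x y xy).
- move=> U1; have [i /= h] := filter_ex U1; exact: (coh_unit_nonzero (coh i) h).
Qed.

End UltraCoherent.

(** * Brauer classes *)

Section BrauerClasses.
Local Open Scope tcat_scope.
Variable C : tensorCat.
Hypothesis coh : coherent C.
Implicit Types (P Q : C) (A B D E : algebra C).

Lemma alg_iso_refl A : alg_iso A A.
Proof.
exists (idm A); split; rewrite ?tensm_id ?comp_id_l ?comp_id_r //.
by exists (idm A); split; exact: comp_id_l.
Qed.

Lemma alg_iso_sym A B : alg_iso A B -> alg_iso B A.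
Proof.
move=> [f [[g [fg gf]] fM f1]]; exists g; split.
- by exists f.
- have e : g ⊠ g ;; f ⊠ f =~ idm _ by rewrite -tensm_comp gf tensm_id.
  rewrite -(comp_id_l (amul B)) -e (comp_assoc (g ⊠ g)) -fM.
  by rewrite !comp_assoc fg comp_id_r.
- by rewrite -f1 comp_assoc fg comp_id_r.
Qed.

Lemma alg_iso_trans A B D : alg_iso A B -> alg_iso B D -> alg_iso A D.
Proof.
move=> [f [fi fM f1]] [g [gi gM g1]]; exists (f ;; g); split.
- exact: iso_comp.
- by rewrite -comp_assoc fM comp_assoc gM -comp_assoc tensm_comp.
- by rewrite -comp_assoc f1.
Qed.

Lemma swap_mid_nat X X' Y Y' Z Z' W W' (f : @hom C X X') (g : @hom C Y Y')
    (h : @hom C Z Z') (k : @hom C W W') :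
  (f ⊠ g) ⊠ (h ⊠ k) ;; swap_mid X' Y' Z' W' =~ swap_mid X Y Z W ;; (f ⊠ h) ⊠ (g ⊠ k).
Proof.
have mid : g ⊠ (h ⊠ k) ;; (assocV Y' Z' W' ;; braid Y' Z' ⊠ idm W' ;; assoc Z' Y' W') =~
    (assocV Y Z W ;; braid Y Z ⊠ idm W ;; assoc Z Y W) ;; h ⊠ (g ⊠ k).
  rewrite -!comp_assoc assocV_nat !comp_assoc -assoc_nat -!comp_assoc.
  rewrite (comp_assoc (assocV Y Z W) ((g ⊠ h) ⊠ k)) -tensm_comp braid_nat.
  rewrite (comp_assoc (assocV Y Z W) (braid Y Z ⊠ idm W)) -tensm_comp.
  by rewrite comp_id_l comp_id_r.
rewrite /swap_mid -!comp_assoc assoc_nat (comp_assoc _ (f ⊠ _)) -tensm_comp mid.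
rewrite comp_id_r -{1}(comp_id_l f) tensm_comp.
by rewrite -!comp_assoc (comp_assoc _ (f ⊠ (h ⊠ (g ⊠ k)))) assocV_nat -!comp_assoc.
Qed.

Lemma alg_iso_tens A A' B B' :
  alg_iso A A' -> alg_iso B B' -> alg_iso (tens_alg A B) (tens_alg A' B').
Proof.
move=> [f [fi fM f1]] [g [gi gM g1]]; exists (f ⊠ g); split.
- exact: is_iso_tens.
- rewrite /= -comp_assoc swap_mid_nat !comp_assoc -!tensm_comp.
  by rewrite fM gM.
- by rewrite /= comp_assoc -tensm_comp f1 g1.
Qed.

Lemma alg_iso_swap A B D E : alg_iso (tens_alg (tens_alg A B) (tens_alg D E))
  (tens_alg (tens_alg A D) (tens_alg B E)).
Proof.
apply: alg_iso_trans (coh_assoc coh A B (tens_alg D E)) _.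
apply: alg_iso_trans _ (alg_iso_sym (coh_assoc coh A D (tens_alg B E))).
apply: alg_iso_tens; first exact: alg_iso_refl.
apply: alg_iso_trans (alg_iso_sym (coh_assoc coh _ _ _)) _.
apply: alg_iso_trans _ (coh_assoc coh _ _ _).
by apply: alg_iso_tens; [exact: (coh_comm coh)|exact: alg_iso_refl].
Qed.

Definition tens_dual P Q (D : dual_of P) (E : dual_of Q) : dual_of (P ⊗ Q) :=
  DualOf (coh_dual coh (dual_ofP D) (dual_ofP E)).
Definition unit_dual : dual_of (𝟙 : C) := DualOf (coh_unit_dual coh).

Lemma end_alg_tens P Q (D : dual_of P) (E : dual_of Q) :
  alg_iso (tens_alg (end_alg D) (end_alg E)) (end_alg (tens_dual D E)).
Proof. exact: (coh_end coh (ev D) (coev D) (ev E) (coev E)). Qed.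

Local Notation "A ~~ B" := (brauer_equiv A B) (at level 70).

Lemma brauer_sym A B : A ~~ B -> B ~~ A.
Proof.
by move=> [P [Q [D [E [hP hQ h]]]]]; exists Q, P, E, D; split=> //; exact: alg_iso_sym.
Qed.

(** Each equivalence is stabilized by the matrix algebra of the other: A ⊗ End P ⊗ End P' ≅ B ⊗ End
    Q ⊗ End P' ≅ B ⊗ End P' ⊗ End Q ≅ D ⊗ End Q' ⊗ End Q. This explains the witnesses P ⊗ P' and Q'
    ⊗ Q. *)
Lemma brauer_trans A B D : A ~~ B -> B ~~ D -> A ~~ D.
Proof.
move=> [P [Q [dP [dQ [hP hQ h]]]]] [P' [Q' [dP' [dQ' [hP' hQ' h']]]]].
exists (P ⊗ P'), (Q' ⊗ Q), (tens_dual dP dP'), (tens_dual dQ' dQ); split.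
- exact: (coh_nonzero coh hP hP').
- exact: (coh_nonzero coh hQ' hQ).
have refl := alg_iso_refl.
apply: alg_iso_trans (alg_iso_tens (refl _) (alg_iso_sym (end_alg_tens _ _))) _.
apply: alg_iso_trans (alg_iso_sym (coh_assoc coh _ _ _)) _.
apply: alg_iso_trans (alg_iso_tens h (refl _)) _.
apply: alg_iso_trans (coh_assoc coh _ _ _) _.
apply: alg_iso_trans (alg_iso_tens (refl _) (coh_comm coh _ _)) _.
apply: alg_iso_trans (alg_iso_sym (coh_assoc coh _ _ _)) _.
apply: alg_iso_trans (alg_iso_tens h' (refl _)) _.
apply: alg_iso_trans (coh_assoc coh _ _ _) _.
exact: alg_iso_tens (refl _) (end_alg_tens _ _).
Qed.

Lemma brauer_iso A B : alg_iso A B -> A ~~ B.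
Proof.
move=> h; exists 𝟙, 𝟙, unit_dual, unit_dual; split; try exact: (coh_unit_nonzero coh).
exact: alg_iso_tens h (alg_iso_refl _).
Qed.

Lemma brauer_refl A : A ~~ A. Proof. exact/brauer_iso/alg_iso_refl. Qed.

Lemma brauer_tens A A' B B' : A ~~ A' -> B ~~ B' -> tens_alg A B ~~ tens_alg A' B'.
Proof.
move=> [P [Q [dP [dQ [hP hQ h]]]]] [P' [Q' [dP' [dQ' [hP' hQ' h']]]]].
exists (P ⊗ P'), (Q ⊗ Q'), (tens_dual dP dP'), (tens_dual dQ dQ'); split.
- exact: (coh_nonzero coh hP hP').
- exact: (coh_nonzero coh hQ hQ').
apply: alg_iso_trans (alg_iso_tens (alg_iso_refl _) (alg_iso_sym (end_alg_tens _ _))) _.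
apply: alg_iso_trans (alg_iso_swap _ _ _ _) _.
apply: alg_iso_trans (alg_iso_tens h h') _.
apply: alg_iso_trans (alg_iso_swap _ _ _ _) _.
exact: alg_iso_tens (alg_iso_refl _) (end_alg_tens _ _).
Qed.

Lemma brauer_assoc A B D : tens_alg (tens_alg A B) D ~~ tens_alg A (tens_alg B D).
Proof. exact/brauer_iso/(coh_assoc coh). Qed.
Lemma brauer_comm A B : tens_alg A B ~~ tens_alg B A.
Proof. exact/brauer_iso/(coh_comm coh). Qed.
Lemma brauer_unit A : tens_alg (unit_alg C) A ~~ A.
Proof. exact/brauer_iso/(coh_unit coh). Qed.

Lemma brauer_op A : azumaya0 A -> tens_alg A (op_alg A) ~~ unit_alg C.
Proof.
move=> [[laws [D si]] nz].
(* The sandwich map gives A ⊗ A^op ≅ End A. The factor 𝟙 in the second witness absorbs the End 𝟙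
   that the relation puts on the left. *)
exists 𝟙, (aobj A ⊗ 𝟙), unit_dual, (tens_dual D unit_dual); split.
- exact: (coh_unit_nonzero coh).
- exact: (coh_nonzero coh nz (coh_unit_nonzero coh)).
have h : alg_iso (tens_alg A (op_alg A)) (end_alg D).
  exact: (coh_sandwich coh laws (dual_ofP D) si).
apply: alg_iso_trans (alg_iso_tens h (alg_iso_refl _)) _.
apply: alg_iso_trans (end_alg_tens _ _) _.
exact: alg_iso_sym (coh_unit coh _).
Qed.

Lemma azumaya0_tens A B : azumaya0 A -> azumaya0 B -> azumaya0 (tens_alg A B).
Proof.
move=> [[lA [D sA]] nA] [[lB [E sB]] nB]; split; last exact: (coh_nonzero coh nA nB).
split; first exact: (coh_laws coh lA lB).
by exists (tens_dual D E); exact: (coh_sandwich_tens coh sA sB).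
Qed.

Lemma azumaya0_unit : azumaya0 (unit_alg C).
Proof.
split; last exact: (coh_unit_nonzero coh).
split; first exact: (coh_unit_laws coh).
by exists unit_dual; exact: (coh_unit_sandwich coh).
Qed.

Lemma brauer_class_eq A B : A ~~ B -> brauer_class A = brauer_class B.
Proof.
move=> AB; apply/seteqP; split=> D [hD h]; split=> //.
  exact: brauer_trans (brauer_sym AB) h.
exact: brauer_trans AB h.
Qed.

Lemma brauer_class_inj A B : azumaya0 B -> brauer_class A = brauer_class B -> A ~~ B.
Proof.
move=> zB e; have : brauer_class B B by split=> //; exact: brauer_refl.
by rewrite -e => -[].
Qed.

Lemma brauer_mul_class A B : azumaya0 A -> azumaya0 B ->
  brauer_mul (brauer_class A) (brauer_class B) = brauer_class (tens_alg A B).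
Proof.
move=> zA zB; apply/seteqP; split=> D.
  move=> [A' [_ AA'] [B' [_ BB'] [zD h]]]; split=> //.
  exact: brauer_trans (brauer_tens AA' BB') h.
move=> h; exists A; first by split=> //; exact: brauer_refl.
by exists B => //; split=> //; exact: brauer_refl.
Qed.

(** Inverses are unique: A^op ~ (A ⊗ B) ⊗ A^op ~ B ⊗ (A ⊗ A^op) ~ B. *)
Lemma brauer_op_inv A B : azumaya0 A -> tens_alg A B ~~ unit_alg C -> op_alg A ~~ B.
Proof.
move=> zA h.
apply: brauer_trans (brauer_sym (brauer_unit _)) _.
apply: brauer_trans (brauer_tens (brauer_sym h) (brauer_refl _)) _.
apply: brauer_trans (brauer_tens (brauer_comm _ _) (brauer_refl _)) _.
apply: brauer_trans (brauer_assoc _ _ _) _.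
apply: brauer_trans (brauer_tens (brauer_refl _) (brauer_op zA)) _.
exact: brauer_trans (brauer_comm _ _) (brauer_unit _).
Qed.

(** Expressing the inverse through any B with A ⊗ B split makes the inverse of a power of A again a
    power of A. *)
Lemma brauer_inv_class A B : azumaya0 A -> tens_alg A B ~~ unit_alg C ->
  brauer_inv (brauer_class A) = brauer_class B.
Proof.
move=> zA h; have inv A' : azumaya0 A' -> A ~~ A' -> op_alg A' ~~ B.
  move=> zA' AA'; apply: brauer_op_inv => //.
  exact: brauer_trans (brauer_tens (brauer_sym AA') (brauer_refl _)) h.
apply/seteqP; split=> D.
  move=> [A' [zA' AA'] [zD h']]; split=> //.
  exact: brauer_trans (brauer_sym (inv _ zA' AA')) h'.
move=> [zD h']; exists A; first by split=> //; exact: brauer_refl.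
by split=> //; exact: brauer_trans (inv _ zA (brauer_refl _)) h'.
Qed.

Fixpoint alg_pow A n := if n is n'.+1 then tens_alg A (alg_pow A n') else unit_alg C.

Lemma azumaya0_pow A n : azumaya0 A -> azumaya0 (alg_pow A n).
Proof.
by move=> zA; elim: n => [|n IH] /=; [exact: azumaya0_unit|exact: azumaya0_tens].
Qed.

Lemma brauer_powD A m n : tens_alg (alg_pow A m) (alg_pow A n) ~~ alg_pow A (m + n).
Proof.
elim: m => [|m IH] /=; first exact: brauer_unit.
exact: brauer_trans (brauer_assoc _ _ _) (brauer_tens (brauer_refl _) IH).
Qed.

Lemma brauer_pow1 A : alg_pow A 1 ~~ A.
Proof. exact: brauer_trans (brauer_comm _ _) (brauer_unit _). Qed.

Lemma brauer_pow2 A : alg_pow A 2 ~~ tens_alg A A.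
Proof. exact: brauer_tens (brauer_refl _) (brauer_pow1 _). Qed.

Section OrderFour.
Variable A : algebra C.
Hypotheses (zA : azumaya0 A) (square_op : tens_alg A A ~~ tens_alg (op_alg A) (op_alg A)).

(** One of the two squares is replaced by A^op ⊗ A^op, and the four factors are regrouped into two
    copies of A ⊗ A^op. *)
Lemma brauer_pow4 : alg_pow A 4 ~~ unit_alg C.
Proof.
apply: brauer_trans (brauer_sym (brauer_powD A 2 2)) _.
have h : alg_pow A 2 ~~ tens_alg (op_alg A) (op_alg A).
  exact: brauer_trans (brauer_pow2 _) square_op.
apply: brauer_trans (brauer_tens (brauer_pow2 _) h) _.
apply: brauer_trans (brauer_iso (alg_iso_swap _ _ _ _)) _.
apply: brauer_trans (brauer_tens (brauer_op zA) (brauer_op zA)) _.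
exact: brauer_unit.
Qed.

Lemma brauer_pow_mul4 n : alg_pow A (4 * n) ~~ unit_alg C.
Proof.
elim: n => [|n IH]; first by rewrite muln0; exact: brauer_refl.
rewrite mulnS; apply: brauer_trans (brauer_sym (brauer_powD _ _ _)) _.
exact: brauer_trans (brauer_tens brauer_pow4 IH) (brauer_unit _).
Qed.

Lemma brauer_pow_mod4 n : alg_pow A n ~~ alg_pow A (n %% 4).
Proof.
rewrite {1}(divn_eq n 4) mulnC; apply: brauer_trans (brauer_sym (brauer_powD _ _ _)) _.
exact: brauer_trans (brauer_tens (brauer_pow_mul4 _) (brauer_refl _)) (brauer_unit _).
Qed.

Let cl n := brauer_class (alg_pow A n).

Lemma brauer_cycle_pow : brauer_cycle (brauer_class A) = range cl.
Proof.
have cl1 : cl 1%N = brauer_class A by apply: brauer_class_eq; exact: brauer_pow1.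
apply/seteqP; split.
- apply: smallest_sub; last by move=> _ ->; exists 1%N.
  split.
  + by move=> _ [n _ <-]; exists (alg_pow A n) => //; exact: azumaya0_pow.
  + by exists 0%N.
  + move=> _ _ [m _ <-] [n _ <-]; exists (m + n)%N => //.
    rewrite /cl brauer_mul_class; try exact: azumaya0_pow.
    exact/esym/brauer_class_eq/brauer_powD.
  (* The power 3 n inverts the power n, since the power 4 n splits. *)
  + move=> _ [n _ <-]; exists (3 * n)%N => //.
    rewrite /cl (@brauer_inv_class _ (alg_pow A (3 * n))) //; first exact: azumaya0_pow.
    apply: brauer_trans (brauer_powD _ _ _) _.
    by rewrite -mulSn; exact: brauer_pow_mul4.
- move=> _ [n _ <-] H [[_ H1 HM _] HA].
  elim: n => [|n IH]; first exact: H1.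
  have -> : cl n.+1 = brauer_mul (brauer_class A) (cl n).
    by rewrite /cl brauer_mul_class //; exact: azumaya0_pow.
  by apply: HM => //; exact: HA.
Qed.

Lemma brauer_cycle_card4 : ~ tens_alg A A ~~ unit_alg C ->
  (brauer_cycle (brauer_class A) #= `I_4)%card.
Proof.
move=> n2; rewrite brauer_cycle_pow.
have -> : range cl = cl @` `I_4.
  apply/seteqP; split=> _ [n h <-]; last by exists n.
  exists (n %% 4)%N; first by rewrite /= ltn_mod.
  exact/esym/brauer_class_eq/brauer_pow_mod4.
have n2' : ~ alg_pow A 2 ~~ unit_alg C.
  by move=> h; apply: n2; apply: brauer_trans (brauer_sym (brauer_pow2 _)) h.
(* Splitting of the d-th power implies that of the square: for d = 2 directly, for d = 1 and d = 3
   after doubling, as 6 is 2 modulo 4. *)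
have nd d : (0 < d < 4)%N -> ~ alg_pow A d ~~ unit_alg C.
  move=> d4 h; have h2 : alg_pow A (d + d) ~~ unit_alg C.
    apply: brauer_trans (brauer_sym (brauer_powD _ _ _)) _.
    exact: brauer_trans (brauer_tens h h) (brauer_unit _).
  move: d4 h h2; case: d => [|[|[|[|//]]]] //= _ h h2.
  by apply: n2'; exact: brauer_trans (brauer_sym (brauer_pow_mod4 6)) h2.
have lt_inj m n : (m < n < 4)%N -> cl m <> cl n.
  move=> /andP[mn n4] e; have := brauer_class_inj (azumaya0_pow n zA) e.
  move=> {}e; apply: (@nd (n - m)%N).
    by rewrite subn_gt0 mn (leq_ltn_trans (leq_subr _ _) n4).
  (* Multiplication by the power 4 - m turns the coincidence of the powers m and n into a splitting
     of the power n - m. *)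
  have := brauer_tens (brauer_refl (alg_pow A (4 - m))) e.
  move=> /(brauer_trans (brauer_sym (brauer_powD _ _ _))).
  move=> /brauer_trans/(_ (brauer_powD _ _ _)).
  have m4 : (m <= 4)%N by apply: ltnW; exact: ltn_trans mn n4.
  rewrite subnK // => /(brauer_trans (brauer_sym brauer_pow4)).
  have -> : (4 - m + n = 4 + (n - m))%N by rewrite addnBA ?(ltnW mn) // addnC addnBA // addnC.
  move=> /brauer_trans/(_ (brauer_sym (brauer_powD _ _ _))).
  move=> /brauer_trans/(_ (brauer_tens brauer_pow4 (brauer_refl _))).
  by move=> /brauer_trans/(_ (brauer_unit _))/brauer_sym.
apply: inj_card_eq => m n; rewrite !inE /= => m4 n4 e.
case: (ltngtP m n) => // h.
  by case: (@lt_inj m n) => //; rewrite h.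
by case: (@lt_inj n m) => //; rewrite h.
Qed.
End OrderFour.
End BrauerClasses.

Section SquareSplits.
Local Open Scope tcat_scope.

(** Splitting is stated for unbundled dual pairs so that it passes to the components of an
    ultraproduct. *)
Definition square_splits (C : tensorCat) (A : algebra C) (X Y X' Y' : C)
    (e : hom (Y ⊗ X) 𝟙) (c : hom 𝟙 (X ⊗ Y)) (e' : hom (Y' ⊗ X') 𝟙) (c' : hom 𝟙 (X' ⊗ Y')) :=
  [/\ is_dual e c, is_dual e' c' &
      alg_iso (tens_alg (tens_alg A A) (end_alg_of e c)) (end_alg_of e' c')].

Lemma brauer_square_splits (C : tensorCat) (coh : coherent C) (A : algebra C) :
  brauer_equiv (tens_alg A A) (unit_alg C) ->
  exists X Y X' Y' (e : hom (Y ⊗ X) 𝟙) (c : hom 𝟙 (X ⊗ Y)) (e' : hom (Y' ⊗ X') 𝟙) c',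
    ~ is_zero X' /\ square_splits A e c e' c'.
Proof.
move=> [P [Q [D [E [_ hQ h]]]]].
exists P, (dob D), Q, (dob E), (ev D), (coev D), (ev E), (coev E); split=> //.
split; [exact: dual_ofP|exact: dual_ofP|].
exact: alg_iso_trans h (coh_unit coh (end_alg E)).
Qed.

Lemma full_square_splits (C : tensorCat) (P : C -> Prop) (P1 : P 𝟙)
    (PT : forall X Y, P X -> P Y -> P (X ⊗ Y)) (A : algebra C) (PA : P A)
    (X Y X' Y' : full_subcat P1 PT) (e : hom (Y ⊗ X) 𝟙) (c : hom 𝟙 (X ⊗ Y))
    (e' : hom (Y' ⊗ X') 𝟙) (c' : hom 𝟙 (X' ⊗ Y')) :
  square_splits (full_alg P1 PT PA) e c e' c' ->
  @square_splits C A (sval X) (sval Y) (sval X') (sval Y') e c e' c'.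
Proof. by move=> [h1 h2 h3]; split=> //; exact: (alg_iso_forget h3). Qed.

Lemma square_splits_comp (I : Type) (U : set_system I) (FU : Filter U) (C : I -> tensorCat)
    (A : forall i, algebra (C i)) (X Y X' Y' : ultraproduct U C)
    (e : hom (Y ⊗ X) 𝟙) (c : hom 𝟙 (X ⊗ Y))
    (e' : hom (Y' ⊗ X') 𝟙) (c' : hom 𝟙 (X' ⊗ Y')) :
  square_splits (ultra_alg (U := U) A) e c e' c' ->
  U [set i | @square_splits (C i) (A i) (X i) (Y i) (X' i) (Y' i) (e i) (c i) (e' i) (c' i)].
Proof.
move=> [/is_dual_comp h1 /is_dual_comp h2 /alg_iso_comp h3].
by apply: filterS3 h1 h2 h3 => i; split.
Qed.
End SquareSplits.

(** * Characters and symplectic forms *)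

Section Characters.
Variables (F : finFieldType) (K : fieldType) (psi : F -> K).
Hypothesis psi_char : nontrivial_additive_character psi.

Lemma char0 : psi 0 = 1. Proof. by case: psi_char. Qed.
Lemma charD a b : psi (a + b) = psi a * psi b. Proof. by case: psi_char. Qed.
Lemma char_unit a : psi a * psi (- a) = 1.
Proof. by rewrite -charD subrr char0. Qed.

Lemma sum_char_eq0 (M : finZmodType) (f : M -> F) x0 :
  {morph f : x y / x + y} -> psi (f x0) != 1 -> \sum_x psi (f x) = 0.
Proof.
move=> fD n1; apply/eqP; move: n1; apply: contraNT => s0.
suff : psi (f x0) * (\sum_x psi (f x)) = \sum_x psi (f x).
  by move/eqP; rewrite -subr_eq0 -{2}[\sum_x _]mul1r -mulrBl mulf_eq0 subr_eq0 (negPf s0) orbF.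
rewrite mulr_sumr [RHS](reindex_inj (addrI x0)).
by apply: eq_bigr => x _; rewrite fD charD.
Qed.

Lemma char_scale_nontrivial c : c != 0 -> exists a, psi (a * c) != 1.
Proof.
by move=> c0; have [_ _ [a na]] := psi_char; exists (a / c); rewrite divfK.
Qed.

Lemma sum_char_scale c : \sum_a psi (a * c) = if c == 0 then #|F|%:R else 0.
Proof.
case: eqP => [->|/eqP c0].
  under eq_bigr => a _ do rewrite mulr0 char0.
  by rewrite sumr_const cardT -cardE.
have [a na] := char_scale_nontrivial c0.
by apply: (@sum_char_eq0 F (fun a => a * c) a) => // x y; rewrite mulrDl.
Qed.

Lemma char_trivial c : (forall s, psi (s * c) = 1) -> c = 0.
Proof.
move=> h; apply/eqP; apply: contraT => /char_scale_nontrivial [a].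
by rewrite h eqxx.
Qed.
End Characters.

Section SymplecticForms.
Variables (F : finFieldType) (E : lmodType F).

Record symplectic_form (w : E -> E -> F) : Prop := SymplecticForm {
  formDl : forall x y z, w (x + y) z = w x z + w y z;
  formZl : forall a x z, w (a *: x) z = a * w x z;
  formC : forall x y, w x y = - w y x;
  form_nondeg : forall y, (forall x, w x y = 0) -> y = 0
}.

Variable w : E -> E -> F.
Hypothesis hw : symplectic_form w.

Lemma formDr x y z : w z (x + y) = w z x + w z y.
Proof. by rewrite formC // formDl // opprD -!(formC hw z). Qed.
Lemma formZr a x z : w z (a *: x) = a * w z x.
Proof. by rewrite formC // formZl // -mulrN -formC. Qed.
Lemma form0l x : w 0 x = 0.
Proof. by rewrite -(scale0r 0) formZl // mul0r. Qed.
Lemma form0r x : w x 0 = 0.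
Proof. by rewrite formC // form0l oppr0. Qed.
Lemma formNl x y : w (- x) y = - w x y.
Proof. by rewrite -scaleN1r formZl // mulN1r. Qed.
Lemma formNr x y : w x (- y) = - w x y.
Proof. by rewrite -scaleN1r formZr // mulN1r. Qed.
Hypothesis two_neq0 : 2 != 0 :> F.
Lemma formxx x : w x x = 0.
Proof.
apply/eqP; have/eqP := formC hw x x; rewrite -addr_eq0 -mulr2n -mulr_natl mulf_eq0.
by rewrite (negPf two_neq0).
Qed.
End SymplecticForms.

(** If 2 = 0, then 1 has order 2 in the additive group, which has odd order. *)
Lemma odd_field_two_neq0 (F : finFieldType) : odd #|F| -> 2 != 0 :> F.
Proof.
apply: contraTN => /eqP e; rewrite -dvdn2.
have o2 : #[1%R : F]%g = 2%N.
  by apply: nt_prime_order; rewrite ?zmodXgE ?e //; exact: oner_neq0.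
have H (gT : finGroupType) (x : gT) : (#[x]%g %| #|gT|)%N.
  by rewrite -cardsT; apply: order_dvdG; rewrite inE.
by rewrite -o2; exact: H.
Qed.

Definition form_fun (F : finFieldType) d (omega : {skew_symmetric 'rV[F]_d})
  (x y : 'rV[F]_d) : F := omega x y.

Lemma psymplectic_form (F : finFieldType) d (omega : {skew_symmetric 'rV[F]_d}) :
  is_psymplectic omega -> symplectic_form (form_fun omega).
Proof.
move=> [/eqP nd _ _]; have C x y : omega x y = - omega y x.
  by rewrite hermC expr1 mulN1r.
split=> [x y z|a x z|//|y hy].
- exact: linearDl.
- exact: linearZl_LR.
- apply/eqP; rewrite -memv0 -nd; apply/mem_orthovP => v _.
  by rewrite C [omega v y]hy oppr0.
Qed.

(** * The twisted group algebra *)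

Section TwistedAlgebra.
Variables (F : finFieldType) (d : nat) (omega : {skew_symmetric 'rV[F]_d}).
Variables (K : fieldType) (psi : F -> K).
Hypotheses (two_neq0 : 2 != 0 :> F) (psi_char : nontrivial_additive_character psi).
Hypothesis (omega_symp : is_psymplectic omega).
Local Notation E := 'rV[F]_d.
Local Notation N := #|{: E}|.
Local Notation ix x y := (mxtens_index (x, y)).
Local Notation w := (form_fun omega).
Local Notation V := (perm_rep K (Sp omega)).
Local Notation A := (twisted_alg omega psi).
Local Notation mu := (twisted_mul_mx omega psi).

Let hw := psymplectic_form omega_symp.

Lemma twisted_mulE (i j k : 'I_N) :
  mu (ix i j) k = psi (w (enum_val i) (enum_val j))
                  * (enum_val k == enum_val i + enum_val j)%:R.
Proof. by rewrite mxE mxtens_indexK. Qed.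

Lemma sum_twisted_mul (i j : 'I_N) (f : 'I_N -> K) :
  \sum_k mu (ix i j) k * f k =
  psi (w (enum_val i) (enum_val j)) * f (enum_rank (enum_val i + enum_val j)).
Proof.
rewrite (sum_only (z := enum_rank (enum_val i + enum_val j))).
  by rewrite twisted_mulE enum_rankK eqxx mulr1.
move=> k ne; rewrite twisted_mulE; case: eqP => [e|_]; last by rewrite mulr0 mul0r.
by case/eqP: ne; rewrite -e enum_valK.
Qed.

Lemma twisted_mx_alg_laws : mx_alg_laws mu (twisted_one_mx F d K).
Proof.
have S1 f : \sum_w twisted_one_mx F d K 0 w * f w = f (enum_rank 0).
  rewrite (sum_only (z := enum_rank 0)); first by rewrite mxE enum_rankK eqxx mul1r.
  move=> k ne; rewrite mxE; case: eqP => [e|_]; last by rewrite mul0r.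
  by case/eqP: ne; rewrite -e enum_valK.
have E0 (a y : 'I_N) : (enum_val y == enum_val a)%:R = (a == y)%:R :> K.
  by rewrite (inj_eq enum_val_inj) eq_sym.
split=> [a b c y|a y|a y].
- rewrite !sum_twisted_mul !twisted_mulE !enum_rankK !mulrA -!(charD psi_char).
  rewrite (formDl hw) (formDr hw) !addrA; congr (psi _ * _); ring.
- by rewrite S1 twisted_mulE enum_rankK (form0l hw) char0 // mul1r add0r E0.
- by rewrite S1 twisted_mulE enum_rankK (form0r hw) char0 // mul1r addr0 E0.
Qed.

Lemma twisted_alg_laws : alg_laws A.
Proof. apply/rep_alg_laws; exact: twisted_mx_alg_laws. Qed.

Lemma perm_repE g (i j : 'I_N) : V g i j = (enum_val j == g (enum_val i))%:R.
Proof. by rewrite mxE. Qed.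

(** The bilinear form for which the points are orthonormal is invariant under permutations and makes
    V its own dual. *)
Definition perm_ev_mx : 'M[K]_(N * N, 1) :=
  \matrix_(p, _) ((mxtens_unindex p).1 == (mxtens_unindex p).2)%:R.
Definition perm_coev_mx : 'M[K]_(1, N * N) := perm_ev_mx^T.

Lemma perm_ev_mxE i j k : perm_ev_mx (ix i j) k = (i == j)%:R.
Proof. by rewrite mxE mxtens_indexK. Qed.
Lemma perm_coev_mxE i j k : perm_coev_mx k (ix i j) = (i == j)%:R.
Proof. by rewrite mxE perm_ev_mxE. Qed.

Lemma perm_rep_row g (f : 'I_N -> K) i : \sum_j V g i j * f j = f (enum_rank (g (enum_val i))).
Proof.
rewrite (sum_only (z := enum_rank (g (enum_val i)))).
  by rewrite perm_repE enum_rankK eqxx mul1r.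
move=> k ne; rewrite perm_repE; case: eqP => [e|_]; last by rewrite mul0r.
by case/eqP: ne; rewrite -e enum_valK.
Qed.

Lemma perm_rep_col g (f : 'I_N -> K) j :
  \sum_i f i * V g i j = f (enum_rank (g^-1%g (enum_val j))).
Proof.
rewrite (sum_only (z := enum_rank (g^-1%g (enum_val j)))).
  by rewrite perm_repE enum_rankK permKV eqxx mulr1.
move=> k ne; rewrite perm_repE; case: eqP => [e|_]; last by rewrite mulr0.
by case/eqP: ne; rewrite e permK enum_valK.
Qed.

Lemma perm_ev_subproof : {in Sp omega, forall g,
  ((V ⊗ V) g *m perm_ev_mx = perm_ev_mx *m (𝟙 : rep_cat K (Sp omega)) g)%tcat}.
Proof.
move=> g _; rewrite mulmx1; apply: mxP => p k; case: p / (mxtens_indexP p) => i j.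
rewrite mxE big_mxtens perm_ev_mxE.
under eq_bigr => a _ do under eq_bigr => b _ do
  rewrite tensmxE perm_ev_mxE -mulrA.
under eq_bigr => a _ do rewrite -mulr_sumr perm_rep_row.
rewrite perm_rep_row (inj_eq enum_rank_inj) (inj_eq perm_inj).
by rewrite (inj_eq enum_val_inj).
Qed.

Lemma perm_coev_subproof : {in Sp omega, forall g,
  ((𝟙 : rep_cat K (Sp omega)) g *m perm_coev_mx = perm_coev_mx *m (V ⊗ V) g)%tcat}.
Proof.
move=> g _; rewrite mul1mx; apply: mxP => k p; case: p / (mxtens_indexP p) => i j.
rewrite [RHS]mxE big_mxtens perm_coev_mxE.
under eq_bigr => a _ do under eq_bigr => b _ do
  rewrite tensmxE perm_coev_mxE mulrCA.
under eq_bigr => a _ do rewrite -mulr_sumr perm_rep_col mulrC.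
rewrite perm_rep_col (inj_eq enum_rank_inj) (inj_eq perm_inj).
by rewrite (inj_eq enum_val_inj).
Qed.

Definition perm_ev : hom (V ⊗ V)%tcat (𝟙%tcat : rep_cat K (Sp omega)) :=
  RepHom (X := (V ⊗ V)%tcat) (Y := rep_unit K (Sp omega)) perm_ev_subproof.
Definition perm_coev : hom (𝟙%tcat : rep_cat K (Sp omega)) (V ⊗ V)%tcat :=
  RepHom (X := rep_unit K (Sp omega)) (Y := (V ⊗ V)%tcat) perm_coev_subproof.

Lemma perm_is_dual : is_dual perm_ev perm_coev.
Proof.
apply/rep_is_dual; split=> p q; rewrite (sum_only (z := p)).
- by rewrite perm_ev_mxE perm_coev_mxE eqxx mul1r.
- by move=> x ne; rewrite perm_coev_mxE eq_sym (negPf ne) mul0r.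
- by rewrite perm_ev_mxE perm_coev_mxE eqxx mul1r.
- by move=> x ne; rewrite perm_ev_mxE eq_sym (negPf ne) mul0r.
Qed.

Lemma twisted_bimulE a b x y : bimul mu a b x y =
  psi (w (enum_val x) (enum_val b) + w (enum_val a) (enum_val x + enum_val b))
  * (enum_val y == enum_val a + (enum_val x + enum_val b))%:R.
Proof. by rewrite mxE sum_twisted_mul twisted_mulE enum_rankK mulrA (charD psi_char). Qed.

Lemma twisted_sandwichE a b y x : sandwich_mx mu perm_coev_mx (ix a b) (ix y x) =
  psi (w (enum_val x) (enum_val b) + w (enum_val a) (enum_val x + enum_val b))
  * (enum_val y == enum_val a + (enum_val x + enum_val b))%:R.
Proof.
rewrite sandwich_mxE (sum_only (z := x)).
  by rewrite perm_coev_mxE eqxx mul1r twisted_bimulE.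
by move=> z ne; rewrite perm_coev_mxE (negPf ne) mul0r.
Qed.

(** For fixed a + b the sandwich matrix is, up to diagonal factors, the Fourier matrix of E with
    respect to the form. Its inverse is therefore the conjugate transpose divided by the order of E,
    with ψ(-·) in the role of complex conjugation. *)
Definition sandwich_inv_mx : 'M[K]_(N * N, N * N) :=
  \matrix_(p, q)
    let y := enum_val (mxtens_unindex p).1 in let x := enum_val (mxtens_unindex p).2 in
    let a := enum_val (mxtens_unindex q).1 in let b := enum_val (mxtens_unindex q).2 in
    N%:R^-1 * (psi (- (w x b + w a (x + b))) * (y == a + (x + b))%:R).

Hypothesis N_neq0 : N%:R != 0 :> K.

Lemma sandwich_invE y x a b : sandwich_inv_mx (ix y x) (ix a b) =
  N%:R^-1 * (psi (- (w (enum_val x) (enum_val b)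
                     + w (enum_val a) (enum_val x + enum_val b)))
  * (enum_val y == enum_val a + (enum_val x + enum_val b))%:R).
Proof. by rewrite mxE !mxtens_indexK. Qed.

Lemma sum_char_form y : \sum_(x : E) psi (w x y) = if y == 0 then N%:R else 0.
Proof.
case: eqP => [->|/eqP y0].
  under eq_bigr => x _ do rewrite (form0r hw) char0 //.
  by rewrite sumr_const cardT -cardE.
have [x xy] : exists x, w x y != 0.
  apply: contrapT => n; move/eqP: y0; apply; apply: (form_nondeg hw) => x.
  by apply/eqP; apply: contrapT => h; apply: n; exists x; apply/negP.
have [a na] := char_scale_nontrivial psi_char xy.
apply: (@sum_char_eq0 _ _ _ psi_char _ (fun x => w x y) (a *: x)).
  by move=> u v; rewrite (formDl hw).
by rewrite (formZl hw).
Qed.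

Lemma sandwich_invK : sandwich_mx mu perm_coev_mx *m sandwich_inv_mx = 1%:M.
Proof.
apply: mxP => p q; case: p / (mxtens_indexP p) => a b; case: q / (mxtens_indexP q) => a' b'.
rewrite mxE big_mxtens exchange_big [RHS]mxE (can_eq (@mxtens_indexK _ _)) xpair_eqE.
set va := enum_val a; set vb := enum_val b; set va' := enum_val a'; set vb' := enum_val b'.
transitivity (N%:R^-1 * \sum_(x : E)
   (psi (w x vb + w va (x + vb) - (w x vb' + w va' (x + vb')))
    * (va + vb == va' + vb')%:R)).
  rewrite mulr_sumr [RHS](reindex_onto enum_val enum_rank) /=; last by move=> x _; rewrite enum_rankK.
  apply: eq_big => [x|x _]; first by rewrite enum_valK eqxx.
  set vx := enum_val x.
  rewrite (sum_only (z := enum_rank (va + (vx + vb)))); last first.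
    move=> y ne; rewrite twisted_sandwichE; case: eqP => [e|_]; last by rewrite mulr0 mul0r.
    by case/eqP: ne; rewrite -e enum_valK.
  rewrite twisted_sandwichE sandwich_invE enum_rankK eqxx mulr1 mulrCA; congr (_ * _).
  rewrite mulrA -(charD psi_char); congr (_ * (nat_of_bool _)%:R).
  by rewrite addrCA (addrCA va') (inj_eq (addrI _)).
rewrite -mulr_suml.
have -> : (a == a') && (b == b') = (va + vb == va' + vb') && (vb - vb' == 0).
  rewrite subr_eq0 -(inj_eq enum_val_inj a) -(inj_eq enum_val_inj b) -/va -/vb.
  case: (vb =P _) => [->|]; last by rewrite !andbF.
  by rewrite !andbT (inj_eq (addIr _)).
case: eqP => /= [e|_]; last by rewrite !mulr0.
have e' : va - va' = vb' - vb.
  by apply/eqP; rewrite subr_eq addrAC eq_sym subr_eq eq_sym e addrC.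
rewrite mulr1.
(* When a + b = a' + b', left and right multiplication contribute equally to the dependence on x.
   Hence the factor 2, whose invertibility lets the character sum detect b = b'. *)
have H x : w x vb + w va (x + vb) - (w x vb' + w va' (x + vb')) =
   w (2 *: x) (vb - vb') + (w va vb - w va' vb').
  have -> : w (2 *: x) (vb - vb') = w x (vb - vb') - w x (va - va').
    rewrite e' -(opprB vb vb') (formZl hw) (formNr hw); ring.
  rewrite !(formDr hw) !(formNr hw) (formC hw va x) (formC hw va' x); ring.
under eq_bigr => x _ do rewrite H (charD psi_char).
rewrite -mulr_suml.
have -> : \sum_(x : E) psi (w (2 *: x) (vb - vb')) = \sum_(x : E) psi (w x (vb - vb')).
  rewrite [RHS](reindex_inj (h := fun x => 2 *: x)) //.
  exact: scalerI.
rewrite sum_char_form; case: eqP => [b0|_]; last by rewrite mul0r mulr0.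
have -> : vb' = vb by apply/esym/eqP; rewrite -subr_eq0 b0.
have -> : va' = va by apply/esym/eqP; rewrite -subr_eq0 e' -opprB b0 oppr0.
by rewrite subrr char0 // mulr1 mulVf.
Qed.

Lemma twisted_sandwich_iso : is_iso (@sandwich_of _ A V perm_coev).
Proof.
have e : hmx (@sandwich_of _ A V perm_coev) = sandwich_mx mu perm_coev_mx.
  exact: hmx_sandwich.
apply: (@rep_is_iso K _ (Sp omega) (V ⊗ V)%tcat (V ⊗ V)%tcat
    (@sandwich_of _ A V perm_coev) sandwich_inv_mx); rewrite e.
  exact: sandwich_invK.
by apply: mulmx1C; exact: sandwich_invK.
Qed.

Lemma twisted_op_mulE (i j k : 'I_N) : op_mul mu (ix i j) k =
  psi (- w (enum_val i) (enum_val j)) * (enum_val k == enum_val i + enum_val j)%:R.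
Proof. by rewrite op_mulE twisted_mulE -(formC hw) addrC. Qed.

Section SquareOp.
Variables a b : F.
Hypothesis ab : a ^+ 2 + b ^+ 2 = -1.

(* [x] ⊗ [y] ↦ [a x + b y] ⊗ [a y - b x] multiplies the form ω ⊕ ω by a² + b² *)
Definition rotate_idx (x : 'I_(N * N)) : 'I_(N * N) :=
  let: (i, j) := mxtens_unindex x in
  ix (enum_rank (a *: enum_val i + b *: enum_val j))
     (enum_rank (a *: enum_val j - b *: enum_val i)).
(** This is the transpose of the matrix of the rotation divided by its determinant a² + b² = -1. *)
Definition unrotate_idx (x : 'I_(N * N)) : 'I_(N * N) :=
  let: (i, j) := mxtens_unindex x in
  ix (enum_rank (b *: enum_val j - a *: enum_val i))
     (enum_rank (- (b *: enum_val i + a *: enum_val j))).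

Lemma rotate_idxE i j : rotate_idx (ix i j) =
  ix (enum_rank (a *: enum_val i + b *: enum_val j))
     (enum_rank (a *: enum_val j - b *: enum_val i)).
Proof. by rewrite /rotate_idx mxtens_indexK. Qed.
Lemma unrotate_idxE i j : unrotate_idx (ix i j) =
  ix (enum_rank (b *: enum_val j - a *: enum_val i))
     (enum_rank (- (b *: enum_val i + a *: enum_val j))).
Proof. by rewrite /unrotate_idx mxtens_indexK. Qed.

Let coef (x : E) : a *: (a *: x) = - x - b *: (b *: x).
Proof. by rewrite !scalerA -!expr2 -(scaleN1r x) -ab scalerDl addrK. Qed.

Lemma rotate_idxK : cancel rotate_idx unrotate_idx.
Proof.
move=> p; case: p / (mxtens_indexP p) => i j.
rewrite rotate_idxE unrotate_idxE !enum_rankK.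
rewrite -[in RHS](enum_valK i) -[in RHS](enum_valK j).
set x := enum_val i; set y := enum_val j.
rewrite !scalerDr !scalerN !coef !(scalerA b a) !(scalerA a b) (mulrC b a).
congr (ix (enum_rank _) (enum_rank _)); apply/rowP => z; rewrite !mxE; ring.
Qed.

Lemma unrotate_idxK : cancel unrotate_idx rotate_idx.
Proof.
move=> p; case: p / (mxtens_indexP p) => i j.
rewrite unrotate_idxE rotate_idxE !enum_rankK.
rewrite -[in RHS](enum_valK i) -[in RHS](enum_valK j).
set x := enum_val i; set y := enum_val j.
rewrite !scalerN !scalerDr !scalerN !coef !(scalerA b a) !(scalerA a b) (mulrC b a).
congr (ix (enum_rank _) (enum_rank _)); apply/rowP => z; rewrite !mxE; ring.
Qed.

Lemma rotate_mul (r := funmx K rotate_idx) :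
  tens_mul mu mu *m r = (r *t r) *m tens_mul (op_mul mu) (op_mul mu).
Proof.
apply: (funmx_alg_hom rotate_idxK unrotate_idxK) => p q s.
case: p / (mxtens_indexP p) => i j; case: q / (mxtens_indexP q) => k l.
case: s / (mxtens_indexP s) => m n.
rewrite !rotate_idxE !tens_mulE !twisted_mulE !twisted_op_mulE !enum_rankK.
set x := enum_val i; set y := enum_val j; set x' := enum_val k; set y' := enum_val l.
set x'' := enum_val m; set y'' := enum_val n.
rewrite mulrACA [RHS]mulrACA -!(charD psi_char) -!natrM !mulnb.
congr (psi _ * (nat_of_bool _)%:R).
  rewrite !(formDl hw) !(formDr hw) !(formNl hw) !(formNr hw) !(formZl hw) !(formZr hw).
  transitivity (- (a ^+ 2 + b ^+ 2) * (w x x' + w y y')); last by ring.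
  by rewrite ab opprK mul1r.
have inj p q : (p == q) = (rotate_idx p == rotate_idx q).
  by rewrite (can_eq rotate_idxK).
transitivity (ix m n == ix (enum_rank (x + x')) (enum_rank (y + y'))).
  rewrite (can_eq (@mxtens_indexK _ _)) xpair_eqE -!(inj_eq enum_val_inj) !enum_rankK //.
rewrite inj !rotate_idxE !enum_rankK (can_eq (@mxtens_indexK _ _)) xpair_eqE.
rewrite !(inj_eq enum_rank_inj) !scalerDr.
by rewrite opprD (addrACA (a *: x)) (addrACA (a *: y)).
Qed.

Lemma rotate_one : tens_one (twisted_one_mx F d K) (twisted_one_mx F d K)
  *m funmx K rotate_idx = tens_one (twisted_one_mx F d K) (twisted_one_mx F d K).
Proof.
apply: (funmx_one_hom rotate_idxK unrotate_idxK) => p.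
case: p / (mxtens_indexP p) => i j; rewrite rotate_idxE !tens_oneE !mxE !enum_rankK.
set x := enum_val i; set y := enum_val j.
rewrite -!natrM !mulnb; congr (nat_of_bool _)%:R.
apply/andP/andP => -[/eqP e /eqP e'].
  by rewrite e e' !scaler0 subrr addr0.
have := rotate_idxK (ix i j); rewrite rotate_idxE -/x -/y e e' unrotate_idxE !enum_rankK.
rewrite !scaler0 subrr addr0 oppr0.
move=> /(congr1 (@mxtens_unindex _ _)); rewrite !mxtens_indexK => -[ei ej].
by rewrite /x /y -ei -ej enum_rankK.
Qed.

Lemma rotate_equivariant : {in Sp omega, forall g,
  rep_tens V V g *m funmx K rotate_idx = funmx K rotate_idx *m rep_tens V V g}.
Proof.
move=> g /Sp_setP[gl _]; apply: mxP => p q.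
have gD x y : g (x + y) = g x + g y by have := gl 1 x y; rewrite !scale1r.
have g0 : g 0 = 0 by apply: (addrI (g 0)); rewrite -gD !addr0.
have gZ c x : g (c *: x) = c *: g x by have := gl c x 0; rewrite !addr0 g0 addr0.
have gN x : g (- x) = - g x by rewrite -scaleN1r gZ scaleN1r.
rewrite (mul_funmx _ _ _ rotate_idxK unrotate_idxK) funmx_mul.
rewrite -[q in RHS]unrotate_idxK; move: (unrotate_idx q) => {}q.
case: p / (mxtens_indexP p) => i j; case: q / (mxtens_indexP q) => k l.
rewrite !rotate_idxE !tensmxE !perm_repE !enum_rankK -!natrM !mulnb.
congr (nat_of_bool _)%:R; rewrite !gD !gN !gZ.
set x := g (enum_val i); set y := g (enum_val j).
transitivity (ix k l == ix (enum_rank x) (enum_rank y)).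
  by rewrite (can_eq (@mxtens_indexK _ _)) xpair_eqE -!(inj_eq enum_val_inj) !enum_rankK.
rewrite -(can_eq rotate_idxK) !rotate_idxE (can_eq (@mxtens_indexK _ _)) xpair_eqE.
by rewrite !(inj_eq enum_rank_inj) !enum_rankK.
Qed.

Lemma twisted_square_op :
  alg_iso (tens_alg A A) (tens_alg (op_alg A) (op_alg A)).
Proof.
pose f := RepHom (X := rep_tens V V) (Y := rep_tens V V) rotate_equivariant.
have e1 : hmx (amul (tens_alg A A)) = tens_mul mu mu := hmx_tens_amul A A.
have e2 : hmx (amul (tens_alg (op_alg A) (op_alg A))) = tens_mul (op_mul mu) (op_mul mu).
  apply: etrans (hmx_tens_amul (op_alg A) (op_alg A)) _.
  have e : hmx (amul (op_alg A)) = op_mul mu := hmx_op_amul A.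
  exact: (f_equal2 (@tens_mul K N N) e e).
apply: (@rep_alg_iso _ _ _ (tens_alg A A) (tens_alg (op_alg A) (op_alg A)) f).
- apply: (@rep_is_iso K _ (Sp omega) (rep_tens V V) (rep_tens V V) f (funmx K unrotate_idx)).
    by rewrite funmx_comp -funmx_id; apply: eq_funmx; exact: rotate_idxK.
  by rewrite funmx_comp -funmx_id; apply: eq_funmx; exact: unrotate_idxK.
- apply: etrans (congr1 (fun M : 'M[K]_(_, _) => M *m funmx K rotate_idx) e1) _.
  apply: etrans rotate_mul _.
  exact: (congr1 (fun M : 'M[K]_(_, _) => (funmx K rotate_idx *t funmx K rotate_idx) *m M) (esym e2)).
- exact: rotate_one.
Qed.
End SquareOp.
End TwistedAlgebra.

(* The squares and the elements -1 - b² form two subsets with (q + 1) / 2 elements,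
   which meet. *)
Lemma sum_two_squares_N1 (F : finFieldType) :
  exists a b : F, a ^+ 2 + b ^+ 2 = -1.
Proof.
pose S := [set x ^+ 2 | x : F]%SET; pose T : {set F} := [set -1 - x | x in S]%SET.
have cT : #|T| = #|S| by apply: card_imset => x y /addrI /oppr_inj.
have cS : (#|F| < #|S| + #|S|)%N.
  have S0 : 0 \in S by apply/imsetP; exists 0; rewrite ?expr0n.
  (* The single root over 0 makes the count strict: the field has at most 2 |S| - 1 elements, so S
     and T cannot be disjoint. *)
  have fib s : (#|[set x : F | x ^+ 2 == s]%SET| <= 2 - (s == 0%R))%N.
    have [->|s0] := eqVneq s 0.
      rewrite subn1 -[X in (_ <= X)%N]/1%N -(cards1 (0 : F)); apply: subset_leq_card; apply/fintype.subsetP => x.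
      by rewrite !inE expf_eq0.
    have [->|[x]] := set_0Vmem [set x : F | x ^+ 2 == s]%SET; first by rewrite cards0.
    rewrite inE => /eqP xs; apply: leq_trans (_ : #|[set x; - x]%SET| <= _)%N; last first.
      by rewrite cards2; case: (_ != _).
    apply: subset_leq_card; apply/fintype.subsetP => y.
    by rewrite !inE -xs eqf_sqr.
  have -> : #|F| = (\sum_(s in S) #|[set x : F | x ^+ 2 == s]%SET|)%N.
    rewrite -sum1_card (partition_big (fun x => x ^+ 2) [in S]) /=; last first.
      by move=> x _; apply/imsetP; exists x.
    apply: eq_bigr => s _; rewrite -sum1_card; apply: eq_bigl => x.
    by rewrite inE.
  rewrite (bigD1 (0 : F)) //= (cardsD1 0 S) S0.
  apply: (@leq_ltn_trans (1 + \sum_(s in S | s != 0%R) 2)%N).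
    apply: leq_add; first by have := fib 0; rewrite eqxx.
    by apply: leq_sum => s /andP[_ s0]; have := fib s; rewrite (negPf s0).
  have -> : (\sum_(s in S | s != 0%R) 2 = #|S :\ 0%R| * 2)%N.
    rewrite sum_nat_const; congr (_ * _)%N; apply: eq_card => s.
    by rewrite !inE andbC.
  by rewrite muln2 -addnn addnACA ltn_add2r.
have : (0 < #|S :&: T|)%N.
  rewrite -(ltn_add2l #|S :|: T|) addn0 cardsUI cT.
  exact: leq_ltn_trans (max_card _) cS.
move=> /card_gt0P [s]; rewrite inE => /andP[/imsetP[x _ ->] /imsetP[_ /imsetP[y _ ->] e]].
by exists x, y; rewrite e subrK.
Qed.

(** * Heisenberg operators and transvections *)

Section HeisenbergOperators.
Variables (F : finFieldType) (K : fieldType) (psi : F -> K).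
Hypotheses (two_neq0 : 2 != 0 :> F) (psi_char : nontrivial_additive_character psi).
Hypothesis card_neq0 : #|F|%:R != 0 :> K.
Variables (E : lmodType F) (w : E -> E -> F).
Hypothesis hw : symplectic_form w.
Variables (m : nat) (b : E -> 'M[K]_m).
Hypotheses (b0 : b 0 = 1%:M)
  (bM : forall u v, b u *m b v = psi (w u v) *: b (u + v)).
Implicit Types (x u v : E) (s y a : F).

(** Fourier averaging over the line F x: the projection onto the vectors on which b (a x) acts by
    ψ(a y) for all a. *)
Definition weight_proj x y : 'M[K]_m :=
  #|F|%:R^-1 *: \sum_a psi (- (a * y)) *: b (a *: x).

(* The metaplectic operator of the transvection u ↦ u + s ⟨x, u⟩ x: multiplication by
   the Gaussian ψ(s y² / 4) on the weight space y of the operators b (a x). *)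
Definition gauss_op x s : 'M[K]_m := \sum_y psi (s / 4%:R * y ^+ 2) *: weight_proj x y.

Definition has_weight (mu : 'rV[K]_m) x y := forall a, mu *m b (a *: x) = psi (a * y) *: mu.

Lemma b_line x a a' : b (a *: x) *m b (a' *: x) = b ((a + a') *: x).
Proof. by rewrite bM (formZl hw) (formZr hw) (formxx hw) // !mulr0 char0 // scale1r scalerDl. Qed.

Lemma weight_proj_b x y a : weight_proj x y *m b (a *: x) = psi (a * y) *: weight_proj x y.
Proof.
rewrite /weight_proj -scalemxAl scalerA mulrC -scalerA; congr (_ *: _).
rewrite mulmx_suml scaler_sumr [RHS](reindex_inj (addIr a)).
apply: eq_bigr => a' _; rewrite -scalemxAl b_line scalerA; congr (_ *: _).
by rewrite -charD // mulrDl opprD addrCA subrr addr0.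
Qed.

Lemma sum_weight_proj x : \sum_y weight_proj x y = 1%:M.
Proof.
rewrite -scaler_sumr exchange_big (bigD1 0) //= [X in _ + X]big1 => [|a a0].
  rewrite scale0r b0 -scaler_suml addr0.
  under eq_bigr => y _ do rewrite mul0r oppr0 char0 //.
  by rewrite sumr_const cardT -cardE scalerA mulVf // scale1r.
rewrite -scaler_suml.
under eq_bigr => y _ do rewrite -mulNr mulrC.
by rewrite sum_char_scale // oppr_eq0 (negPf a0) scale0r.
Qed.

Lemma b_comm u v : b u *m b v = psi (2 * w u v) *: (b v *m b u).
Proof.
rewrite !bM scalerA -charD // addrC [v + u]addrC (formC hw v u); congr (psi _ *: _).
ring.
Qed.

(** The weights move by 2 ⟨x, u⟩ because the commutator of b u and b v is ψ(2 ⟨u, v⟩), twice the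
    cocycle. *)
Lemma weight_proj_shift x y u :
  weight_proj x y *m b u = b u *m weight_proj x (y - 2 * w x u).
Proof.
rewrite /weight_proj -scalemxAl -scalemxAr; congr (_ *: _).
rewrite mulmx_suml mulmx_sumr; apply: eq_bigr => a _.
rewrite -scalemxAl -scalemxAr b_comm scalerA -charD // (formZl hw).
by congr (psi _ *: _); ring.
Qed.

Lemma weight_proj_comm x y u : w x u = 0 -> weight_proj x y *m b u = b u *m weight_proj x y.
Proof. by move=> xu; rewrite weight_proj_shift xu mulr0 subr0. Qed.

(** Put h = ⟨x, u⟩. Passing b u shifts the weight by 2 h, and s (y + 2 h)² / 4 - s y² / 4 = s h y +
    s h². The linear term is the action of b (s h x) on the weight y, and the constant cancels the
    cocycle of b u and b (s h x). This fixes the coefficient 1/4 of the Gaussian. *)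
Lemma gauss_op_conj x s u :
  gauss_op x s *m b u = b (u + (s * w x u) *: x) *m gauss_op x s.
Proof.
set h := w x u; have n4 : 4%:R != 0 :> F by rewrite -[4%N]/(2 * 2)%N natrM mulf_neq0.
have -> : b (u + (s * h) *: x) = psi (s * h ^+ 2) *: (b u *m b ((s * h) *: x)).
  rewrite bM scalerA -charD // (formZr hw) (formC hw u x) -/h.
  by rewrite (_ : s * h ^+ 2 + s * h * - h = 0) ?char0 ?scale1r //; ring.
have bpi a y : b (a *: x) *m weight_proj x y = psi (a * y) *: weight_proj x y.
  by rewrite -weight_proj_comm ?weight_proj_b // (formZr hw) (formxx hw) ?mulr0.
rewrite mulmx_suml (reindex_inj (addIr (2 * h))) /= -scalemxAl -mulmxA mulmx_sumr.
rewrite mulmx_sumr scaler_sumr; apply: eq_bigr => y _.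
rewrite -scalemxAl weight_proj_shift addrK -(scalemxAr (psi _) (b (_ *: x))) bpi.
have -> : s / 4%:R * (y + 2 * h) ^+ 2 = s * h ^+ 2 + (s / 4%:R * y ^+ 2 + s * h * y).
  by field.
rewrite (charD psi_char (s * h ^+ 2)) (charD psi_char (s / 4%:R * y ^+ 2)).
by rewrite -!scalemxAr !scalerA !mulrA.
Qed.

Lemma has_weight_proj mu x y : has_weight (mu *m weight_proj x y) x y.
Proof. by move=> a; rewrite -mulmxA weight_proj_b scalemxAr. Qed.

Lemma has_weight_comm mu x y x' y' :
  w x' x = 0 -> has_weight mu x y -> has_weight (mu *m weight_proj x' y') x y.
Proof.
move=> xx h a; rewrite -mulmxA weight_proj_comm; last by rewrite (formZr hw) xx mulr0.
by rewrite mulmxA h scalemxAl.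
Qed.

Lemma has_weight_lin mu x y x' y' c c' : w x x' = 0 ->
  has_weight mu x y -> has_weight mu x' y' ->
  has_weight mu (c *: x + c' *: x') (c * y + c' * y').
Proof.
move=> xx h h' a.
have -> : b (a *: (c *: x + c' *: x')) = b ((a * c) *: x) *m b ((a * c') *: x').
  rewrite bM (formZl hw) (formZr hw) xx !mulr0 char0 // scale1r.
  by rewrite scalerDr !scalerA.
rewrite mulmxA h -scalemxAl h' scalerA -charD //; congr (psi _ *: _); ring.
Qed.

Lemma has_weight_gauss mu x y s :
  has_weight mu x y -> mu *m gauss_op x s = psi (s / 4%:R * y ^+ 2) *: mu.
Proof.
move=> h; have hpi z : mu *m weight_proj x z = if z == y then mu else 0.
  rewrite /weight_proj -scalemxAr mulmx_sumr.
  under eq_bigr => a _ do rewrite -scalemxAr h scalerA -charD // -mulrN -mulrDr addrC.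
  rewrite -scaler_suml sum_char_scale // subr_eq0 eq_sym.
  by case: eqP => _; rewrite ?scale0r ?scaler0 // scalerA mulVf // scale1r.
rewrite mulmx_sumr (bigD1 y) //= -scalemxAr hpi eqxx big1 ?addr0 // => z zy.
by rewrite -scalemxAr hpi (negPf zy) scaler0.
Qed.

Lemma exists_weight (mu : 'rV[K]_m) x : mu != 0 -> exists y, mu *m weight_proj x y != 0.
Proof.
move=> mu0; apply: contrapT => n; move/eqP: mu0; apply.
rewrite -(mulmx1 mu) -(sum_weight_proj x) mulmx_sumr big1 // => y _.
by apply/eqP; apply: contrapT => /negP h; apply: n; exists y.
Qed.

Lemma gauss_op_comm x s (M : 'M[K]_m) :
  (forall u, M *m b u = b u *m M) -> M *m gauss_op x s = gauss_op x s *m M.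
Proof.
move=> h; rewrite mulmx_sumr mulmx_suml; apply: eq_bigr => y _.
rewrite -scalemxAr -scalemxAl; congr (_ *: _).
rewrite -scalemxAr -scalemxAl mulmx_sumr mulmx_suml; congr (_ *: _).
by apply: eq_bigr => a _; rewrite -scalemxAr -scalemxAl h.
Qed.

Lemma gauss_op_weight_comm x s x' y' : w x x' = 0 ->
  weight_proj x' y' *m gauss_op x s = gauss_op x s *m weight_proj x' y'.
Proof.
move=> xx; have comm a : b (a *: x') *m gauss_op x s = gauss_op x s *m b (a *: x').
  by rewrite gauss_op_conj (formZr hw) xx !mulr0 scale0r addr0.
move: (gauss_op x s) comm => G comm.
rewrite /weight_proj -scalemxAr -scalemxAl mulmx_sumr mulmx_suml.
by congr (_ *: _); apply: eq_bigr => a _; rewrite -scalemxAr -scalemxAl comm.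
Qed.

Lemma gauss_op_transport x x' s (B : 'M[K]_m) :
  (forall a, b (a *: x) *m B = B *m b (a *: x')) -> gauss_op x s *m B = B *m gauss_op x' s.
Proof.
move=> h; rewrite mulmx_sumr mulmx_suml; apply: eq_bigr => z _.
rewrite -scalemxAr -scalemxAl; congr (_ *: _).
rewrite -scalemxAr -scalemxAl mulmx_sumr mulmx_suml; congr (_ *: _).
by apply: eq_bigr => a _; rewrite -scalemxAr -scalemxAl h.
Qed.
End HeisenbergOperators.

(** * Vanishing of a vector fixed by lifted transvections *)

Section NoInvariant.
Variables (F : finFieldType) (K : fieldType) (psi : F -> K).
Hypotheses (two_neq0 : 2 != 0 :> F) (psi_char : nontrivial_additive_character psi).
Hypothesis card_neq0 : #|F|%:R != 0 :> K.
Hypothesis N1_nonsquare : ~ exists a : F, a ^+ 2 = -1.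
Variables (E : lmodType F) (w : E -> E -> F).
Hypothesis hw : symplectic_form w.
Implicit Types (x v : E) (s : F).

Definition double_form (u v : E * E) := w u.1 v.1 + w u.2 v.2.

Lemma double_formP : symplectic_form double_form.
Proof.
split=> [x y z|a x z|x y|y h].
- by rewrite /double_form /= !(formDl hw) addrACA.
- by rewrite /double_form /= !(formZl hw) mulrDr.
- by rewrite /double_form (formC hw) [w x.2 _](formC hw) opprD.
- case: y h => y y' h; congr (_, _); apply: (form_nondeg hw) => x.
    by have := h (x, 0); rewrite /double_form /= (form0l hw) addr0.
  by have := h (0, x); rewrite /double_form /= (form0l hw) add0r.
Qed.

Lemma scale_inl a x : a *: ((x, 0) : E * E) = (a *: x, 0).
Proof. by congr (_, _); rewrite scaler0. Qed.
Lemma scale_inr a x : a *: ((0, x) : E * E) = (0, a *: x).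
Proof. by congr (_, _); rewrite scaler0. Qed.

Lemma add_inl x y : ((x, 0) : E * E) + (y, 0) = (x + y, 0).
Proof. by congr (_, _); rewrite addr0. Qed.
Lemma add_inr x y : ((0, x) : E * E) + (0, y) = (0, x + y).
Proof. by congr (_, _); rewrite addr0. Qed.

Definition transvection v s x := x + (s * w v x) *: v.

(** In the application [P] holds of the operators coming from End P, [U] consists of the vectors
    orthogonal to the finitely many points attached to [la], and [lift] provides the operators
    β_T. *)
Variables (m : nat) (b : E * E -> 'M[K]_m) (P : 'M[K]_m -> Prop) (la : 'rV[K]_m).
Variable U : E -> Prop.
Hypotheses (b0 : b 0 = 1%:M)
  (bM : forall u v : E * E, b u *m b v = psi (double_form u v) *: b (u + v)).
Hypothesis Pb : forall M, P M -> forall u, M *m b u = b u *m M.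
Hypothesis scalar : forall M, (forall u, M *m b u = b u *m M) ->
  (forall N, P N -> M *m N = N *m M) -> exists c : K, M = c%:M.
Hypothesis UD : forall x y, U x -> U y -> U (x + y).
Hypothesis UZ : forall a x, U x -> U (a *: x).
Hypothesis lift : forall v s, U v -> exists B : 'M[K]_m,
  [/\ forall u, b u *m B = B *m b (transvection v s u.1, transvection v s u.2),
      forall N, P N -> B *m N = N *m B, B \in unitmx & la *m B = la].

Let hW := double_formP.
Local Notation G := (gauss_op psi b).
(** On E ⊕ E a transvection along x acts diagonally, as the product of the transvections along (x,
    0) and (0, x). Its metaplectic operator is thus a product of two Gaussians, which multiplies by
    ψ(s (y² + z²) / 4) on common weight vectors. *)
Definition gauss2 x s := G (x, 0) s *m G (0, x) s.

Lemma gauss2_conj x s u :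
  gauss2 x s *m b u = b (transvection x s u.1, transvection x s u.2) *m gauss2 x s.
Proof.
rewrite /gauss2 -mulmxA (gauss_op_conj two_neq0 psi_char hW bM) mulmxA.
rewrite (gauss_op_conj two_neq0 psi_char hW bM) mulmxA; congr (b _ *m _ *m _).
case: u => u u'; rewrite /double_form /transvection /= !(form0l hw) !add0r !addr0.
congr (_, _); rewrite /= ?scaler0 ?addr0 //=.
Qed.

(** The lift [B] and [gauss2] intertwine b with its transform in opposite directions, so their
    product commutes with all b u and with the operators in [P]; hence it is a scalar. As [B] fixes
    [la], the scalar is that of [gauss2] on [la]. *)
Lemma gauss2_scalar x s : U x -> exists c : K, la *m gauss2 x s = c *: la.
Proof.
move=> Ux; have [B [Bb BP Bu laB]] := lift s Ux.
have PG N : P N -> N *m gauss2 x s = gauss2 x s *m N.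
  move=> PN; rewrite /gauss2 mulmxA (gauss_op_comm psi _ _ (Pb PN)) -mulmxA.
  by rewrite (gauss_op_comm psi _ _ (Pb PN)) mulmxA.
have [||c e] := scalar (M := B *m gauss2 x s).
- by move=> u; rewrite -mulmxA gauss2_conj mulmxA -Bb -mulmxA.
- by move=> N PN; rewrite -mulmxA -PG // mulmxA BP // mulmxA.
by exists c; rewrite -{1}laB -mulmxA e mul_mx_scalar.
Qed.

Lemma transvection_link x y : U x -> U y -> w x y != 0 -> exists B : 'M[K]_m,
  [/\ forall a a', b (a *: x, a' *: x) *m B = B *m b (a *: y, a' *: y),
      B \in unitmx & la *m B = la].
Proof.
move=> Ux Uy xy; have Uv : U (y - x) by apply: UD => //; rewrite -scaleN1r; exact: UZ.
(* Since ⟨y - x, x⟩ = -⟨x, y⟩, this parameter makes the transvection along y - x carry x to y. *)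
have [B [Bb _ Bu laB]] := lift (- (w x y)^-1) Uv; exists B; split=> // a a'.
have T c : transvection (y - x) (- (w x y)^-1) (c *: x) = c *: y.
  rewrite /transvection (formZr hw) (formDl hw) (formNl hw) (formxx hw) // subr0.
  rewrite (formC hw y x) mulrN mulrN mulNr opprK mulrCA mulVf // mulr1.
  by rewrite scalerBr addrC subrK.
by rewrite Bb !T.
Qed.

(** A lift that carries x to y and fixes [la] conjugates one Gaussian operator into the other, so
    both act on [la] by the same scalar. Chains of such links compare vectors that are orthogonal to
    each other. *)
Lemma gauss2_link x y s c : U x -> U y -> w x y != 0 ->
  la *m gauss2 x s = c *: la -> la *m gauss2 y s = c *: la.
Proof.
move=> Ux Uy xy e; have [B [Bb Bu laB]] := transvection_link Ux Uy xy.
have E1 : gauss2 x s *m B = B *m gauss2 y s.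
  rewrite /gauss2 -mulmxA (@gauss_op_transport _ _ _ _ _ _ (0, x) (0, y)); last first.
    by move=> a; have := Bb 0 a; rewrite !scale0r !scale_inr.
  rewrite !mulmxA (@gauss_op_transport _ _ _ _ _ _ (x, 0) (y, 0)) //.
  by move=> a; have := Bb a 0; rewrite !scale0r !scale_inl.
by rewrite -{1}laB -mulmxA -E1 mulmxA e -scalemxAl laB.
Qed.

Variables e1 f1 e2 f2 : E.
Hypotheses (Ue1 : U e1) (Uf1 : U f1) (Ue2 : U e2) (Uf2 : U f2).
Hypotheses (e1f1 : w e1 f1 = 1) (e2f2 : w e2 f2 = 1) (e1e2 : w e1 e2 = 0)
  (e1f2 : w e1 f2 = 0) (f1e2 : w f1 e2 = 0).

Lemma weights_vanish y1 z1 (mu := la *m weight_proj psi b (e1, 0) y1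
                                    *m weight_proj psi b (0, e1) z1) :
  mu != 0 -> y1 = 0 /\ z1 = 0.
Proof.
move=> mu0.
have [y2 mu2] := exists_weight psi_char card_neq0 b0 (e2, 0) mu0.
have [z2 mu3] := exists_weight psi_char card_neq0 b0 (0, e2) mu2.
set nu := _ *m _ in mu3.
have D1 x x' : double_form (x, 0) (x', 0) = w x x'.
  by rewrite /double_form /= (form0l hw) addr0.
have D2 x x' : double_form (0, x) (0, x') = w x x'.
  by rewrite /double_form /= (form0l hw) add0r.
have D3 x x' : double_form (x, 0) (0, x') = 0.
  by rewrite /double_form /= (form0l hw) (form0r hw) add0r.
have D4 x x' : double_form (0, x) (x', 0) = 0.
  by rewrite /double_form /= (form0l hw) (form0r hw) add0r.
have e2e1 : w e2 e1 = 0 by rewrite (formC hw) e1e2 oppr0.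
have xx x : w x x = 0 := formxx hw two_neq0 x.
have hp := has_weight_proj two_neq0 psi_char hW bM.
have hc := has_weight_comm psi_char hW bM.
have W1 : has_weight psi b nu (e1, 0) y1.
  apply: (hc); first by rewrite ?D1 ?D2 ?D3 ?D4 ?e2e1.
  apply: (hc); first by rewrite ?D1 ?D2 ?D3 ?D4 ?e2e1.
  apply: (hc); first by rewrite ?D1 ?D2 ?D3 ?D4 ?e2e1.
  exact: hp.
have W2 : has_weight psi b nu (0, e1) z1.
  apply: (hc); first by rewrite ?D1 ?D2 ?D3 ?D4 ?e2e1.
  apply: (hc); first by rewrite ?D1 ?D2 ?D3 ?D4 ?e2e1.
  exact: hp.
have W3 : has_weight psi b nu (e2, 0) y2.
  apply: (hc); first by rewrite ?D1 ?D2 ?D3 ?D4 ?e2e1.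
  exact: hp.
have W4 : has_weight psi b nu (0, e2) z2 by exact: hp.
(* [nu] is a common weight vector for the four mutually orthogonal lines of e1 and e2 in both copies
   of E. [Q c c'] is the value of y² + z² for the isotropic vector c e1 + c' e2. *)
pose Q c c' := (c * y1 + c' * y2) ^+ 2 + (c * z1 + c' * z2) ^+ 2.
have gaussQ c c' s : nu *m gauss2 (c *: e1 + c' *: e2) s = psi (s / 4%:R * Q c c') *: nu.
  have Wl : has_weight psi b nu (c *: e1 + c' *: e2, 0) (c * y1 + c' * y2).
    have := has_weight_lin psi_char hW bM c c' (etrans (D1 _ _) e1e2) W1 W3.
    by rewrite !scale_inl add_inl.
  have Wr : has_weight psi b nu (0, c *: e1 + c' *: e2) (c * z1 + c' * z2).
    have := has_weight_lin psi_char hW bM c c' (etrans (D2 _ _) e1e2) W2 W4.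
    by rewrite !scale_inr add_inr.
  rewrite /gauss2 mulmxA (has_weight_gauss _ _ _ Wl) // -scalemxAl.
  by rewrite (has_weight_gauss _ _ _ Wr) // scalerA -charD // -mulrDr.
(* Gaussians along vectors orthogonal to e1 and e2 commute with the weight projections, so a scalar
   known on [la] holds on [nu]. *)
have nuc x s c : w x e1 = 0 -> w x e2 = 0 -> la *m gauss2 x s = c *: la ->
    nu *m gauss2 x s = c *: nu.
  move=> xe1 xe2 h.
  have comm (v : E * E) y : double_form (x, 0) v = 0 -> double_form (0, x) v = 0 ->
      weight_proj psi b v y *m gauss2 x s = gauss2 x s *m weight_proj psi b v y.
    move=> h1 h2; rewrite /gauss2 mulmxA.
    rewrite (gauss_op_weight_comm two_neq0 psi_char hW bM _ _ h1) -mulmxA.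
    by rewrite (gauss_op_weight_comm two_neq0 psi_char hW bM _ _ h2) mulmxA.
  rewrite /nu /mu -!mulmxA.
  rewrite (comm (0, e2)) ?D2 ?D3 // (mulmxA (weight_proj _ _ (e2, 0) _)).
  rewrite (comm (e2, 0)) ?D1 ?D4 // -(mulmxA (gauss2 x s)).
  rewrite (mulmxA (weight_proj _ _ (0, e1) _)).
  rewrite (comm (0, e1)) ?D2 ?D3 // -(mulmxA (gauss2 x s)).
  rewrite (mulmxA (weight_proj _ _ (e1, 0) _)).
  rewrite (comm (e1, 0)) ?D1 ?D4 // -(mulmxA (gauss2 x s)).
  by rewrite mulmxA h scalemxAl.
have Q4 c' s : [/\ psi (s / 4%:R * Q 0 1) = psi (s / 4%:R * Q 1 0) &
    psi (s / 4%:R * Q 1 c') = psi (s / 4%:R * Q 1 0)].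
  have [c h] := gauss2_scalar s Ue1.
  have cE x c1 c2 : x = c1 *: e1 + c2 *: e2 -> la *m gauss2 x s = c *: la ->
      psi (s / 4%:R * Q c1 c2) = c.
    move=> xE hx; apply/eqP; rewrite -subr_eq0.
    have := nuc _ _ _ _ _ hx.
    rewrite {1 2}xE !(formDl hw) !(formZl hw) !xx e1e2 e2e1 !mulr0 addr0.
    move=> /(_ erefl erefl); rewrite xE gaussQ => /eqP.
    by rewrite -subr_eq0 -scalerBl scaler_eq0 (negPf mu3) orbF.
  have n1 : 1 != 0 :> F := oner_neq0 F.
  rewrite (cE e1 1 0) ?scale1r ?scale0r ?addr0 //.
  (* e1 and e2 are orthogonal and have no direct link; f1 + f2 is linked to both. *)
  have hf : la *m gauss2 (f1 + f2) s = c *: la.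
    by apply: gauss2_link h; rewrite ?(formDr hw) ?e1f1 ?e1f2 ?addr0 //; exact: UD.
  have f2e2 : w f2 e2 = -1 by rewrite (formC hw) e2f2.
  have f1e1 : w f1 e1 = -1 by rewrite (formC hw) e1f1.
  (* f1 pairs to -1 with e1 + c' e2 for every c', which links e1 to all these vectors. *)
  have hf1 : la *m gauss2 f1 s = c *: la by apply: gauss2_link h; rewrite ?e1f1.
  split; [apply: (cE e2)|apply: (cE (e1 + c' *: e2))].
  - by rewrite scale1r scale0r add0r.
  - apply: gauss2_link hf => //; first exact: UD.
    by rewrite (formDl hw) f1e2 f2e2 add0r oppr_eq0.
  - by rewrite scale1r.
  - apply: gauss2_link hf1 => //; first by apply: UD => //; exact: UZ.
    by rewrite (formDr hw) f1e1 (formZr hw) f1e2 mulr0 addr0 oppr_eq0.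
have n4 : 4%:R != 0 :> F by rewrite -[4%N]/(2 * 2)%N natrM mulf_neq0.
(* ψ need not be injective, so values of [Q] are recovered from ψ by letting the parameter s of the
   transvection vary over F. *)
have Qeq c c' : (forall s, psi (s / 4%:R * Q c c') = psi (s / 4%:R * Q 1 0)) ->
    Q c c' = Q 1 0.
  move=> h; apply/eqP; rewrite -subr_eq0; apply/eqP; apply: (char_trivial psi_char) => s.
  have := h (s * 4%:R); rewrite mulfK // mulrBr (charD psi_char (s * Q c c')) => ->.
  by rewrite char_unit.
have Q01 : Q 0 1 = Q 1 0 by apply: Qeq => s; case: (Q4 0 s).
have Q11 c' : Q 1 c' = Q 1 0 by apply: Qeq => s; case: (Q4 c' s).
have Q0 : y1 ^+ 2 + z1 ^+ 2 = 0.
  have E2 : Q 1 1 + Q 1 (-1) = 2 * Q 1 0 + 2 * Q 0 1 by rewrite /Q; ring.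
  have : 2 * Q 1 0 = 0.
    transitivity ((2 * Q 1 0 + 2 * Q 0 1) - (Q 1 1 + Q 1 (-1))).
      by rewrite Q01 !Q11; ring.
    by rewrite E2 subrr.
  move=> /eqP; rewrite mulf_eq0 (negPf two_neq0) /= => /eqP.
  by rewrite /Q !mul1r !mul0r !addr0.
have z10 : z1 = 0.
  apply/eqP; apply: contraT => z1n; case: N1_nonsquare; exists (y1 / z1).
  rewrite expr_div_n; apply/eqP; rewrite -(inj_eq (addIr 1)) addNr.
  by rewrite -(divff (expf_neq0 2 z1n)) -mulrDl Q0 mul0r.
split=> //; move: Q0; rewrite z10 expr0n addr0 => /eqP.
by rewrite expf_eq0 => /eqP.
Qed.

Lemma no_transvection_invariant : la = 0.
Proof.
apply/eqP; apply: contraT => la0.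
have p0 y : y != 0 -> la *m weight_proj psi b (e1, 0) y = 0.
  move=> yn; apply/eqP; apply: contraT => h.
  have [z hz] := exists_weight psi_char card_neq0 b0 (0, e1) h.
  by have [y0 _] := weights_vanish hz; rewrite y0 eqxx in yn.
(* All components of [la] with nonzero weight vanish by [p0], so [la] is its own component of weight
   0. The lift carrying e1 to f1 then transfers this invariance to f1. *)
have W1 : has_weight psi b la (e1, 0) 0.
  have -> : la = la *m weight_proj psi b (e1, 0) 0.
    rewrite -{1}(mulmx1 la) -(sum_weight_proj psi_char card_neq0 b0 (e1, 0)).
    by rewrite mulmx_sumr (bigD1 0) //= big1 ?addr0.
  exact: (has_weight_proj two_neq0 psi_char hW bM).
have e1a a : la *m b (a *: e1, 0) = la.
  by have := W1 a; rewrite scale_inl mulr0 char0 // scale1r.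
have [|B [Bb Bu laB]] := transvection_link Ue1 Uf1; first by rewrite e1f1 oner_neq0.
have f1a : la *m b (f1, 0) = la.
  have := Bb 1 0; rewrite !scale1r !scale0r => h.
  rewrite -{1}laB -mulmxA -h mulmxA.
  by have := e1a 1; rewrite scale1r => ->.
(* b (a e1, 0) and b (f1, 0) commute up to ψ(2 a), and a is chosen to make this factor different
   from 1. *)
have [a na] := char_scale_nontrivial psi_char two_neq0.
have := b_comm psi_char hW bM (a *: e1, 0) (f1, 0).
move=> /(congr1 (mulmx la)); rewrite -scalemxAr !mulmxA e1a f1a e1a => /eqP.
rewrite -subr_eq0 -{1}(scale1r la) -scalerBl scaler_eq0 (negPf la0) orbF subr_eq0 eq_sym.
rewrite /double_form /= (form0l hw) addr0 (formZl hw) e1f1 mulr1 mulrC.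
by rewrite (negPf na).
Qed.
End NoInvariant.

(** * Hyperbolic pairs and symplectic transvections *)

Section SymplecticGeometry.
Variables (F : finFieldType) (d : nat) (w : 'rV[F]_d -> 'rV[F]_d -> F).
Hypotheses (hw : symplectic_form w) (two_neq0 : 2 != 0 :> F).
Local Notation E := 'rV[F]_d.

Definition form_mx : 'M[F]_d := \matrix_(i, j) w (delta_mx 0 i) (delta_mx 0 j).

Lemma form_mxE (x y : E) : w x y = (x *m form_mx *m y^T) 0 0.
Proof.
have sl (I : finType) (f : I -> E) z : w (\sum_i f i) z = \sum_i w (f i) z.
  exact: (big_morph (fun u => w u z) (fun a b => formDl hw a b z) (form0l hw z)).
have sr (I : finType) (f : I -> E) z : w z (\sum_i f i) = \sum_i w z (f i).
  exact: (big_morph (w z) (fun a b => formDr hw a b z) (form0r hw z)).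
rewrite {1}(row_sum_delta x) {1}(row_sum_delta y) sl mxE.
under [RHS]eq_bigr => j _ do rewrite mxE mulr_suml.
rewrite exchange_big; apply: eq_bigr => i _; rewrite sr; apply: eq_bigr => j _.
by rewrite (formZl hw) (formZr hw) !mxE mulrA mulrAC.
Qed.

Lemma form_mx_unit : form_mx \in unitmx.
Proof.
rewrite -row_free_unit -kermx_eq0; apply/eqP/row_matrixP => i; rewrite row0.
set x := row i _.
have h : x *m form_mx = 0 by apply: sub_kermxP; exact: row_sub.
apply: (form_nondeg hw) => y; rewrite (formC hw).
by rewrite form_mxE h mul0mx mxE oppr0.
Qed.

(** The orthogonal [N] of s has dimension at least d - |s|, which exceeds d / 2, whereas a totally
    isotropic subspace has dimension at most d / 2. So two vectors of [N] pair nontrivially, and one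
    of them is rescaled. *)
Lemma hyperbolic_pair (s : seq E) : (2 * size s < d)%N ->
  exists e f, [/\ w e f = 1, forall x, x \in s -> w e x = 0 & forall x, x \in s -> w f x = 0].
Proof.
move=> sd; pose S : 'M[F]_(size s, d) := \matrix_(i < size s) s`_i.
pose N := kermx (form_mx *m S^T).
have NS u x : (u <= N)%MS -> x \in s -> w u x = 0.
  move=> /sub_kermxP h /(nthP 0) [i si <-]; rewrite form_mxE.
  have := congr1 (fun M : 'M[F]_(1, size s) => M 0 (Ordinal si)) h.
  rewrite mulmxA [RHS]mxE => <-; rewrite [LHS]mxE [RHS]mxE.
  by apply: eq_bigr => j _; rewrite !mxE.
have rN : (d - size s <= \rank N)%N.
  by rewrite mxrank_ker leq_sub2l // rank_leq_col.
have [/eqP iso|niso] := eqVneq (N *m form_mx *m N^T) 0.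
  have := mulmx0_rank_max (eqP iso); rewrite mxrank_tr mxrankMfree ?row_free_unit ?form_mx_unit //.
  move=> h; exfalso; move: h; apply/negP; rewrite -ltnNge.
  apply: leq_trans (leq_add rN rN); rewrite addnn -mul2n mulnBr.
  by rewrite ltn_subRL [X in (_ < X)%N]mul2n -addnn ltn_add2r.
have /existsP[i /existsP[j ij]] : [exists i, exists j, (N *m form_mx *m N^T) i j != 0].
  apply: contraNT niso => /existsPn h; apply/eqP/matrixP => i j.
  by have /existsPn/(_ j) := h i; rewrite negbK => /eqP ->; rewrite mxE.
have wij : w (row i N) (row j N) = (N *m form_mx *m N^T) i j.
  rewrite form_mxE tr_row -row_mul [LHS]mxE [RHS]mxE; apply: eq_bigr => k _.
  by congr (_ * _); rewrite mxE.
exists (row i N), ((w (row i N) (row j N))^-1 *: row j N); split.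
- by rewrite (formZr hw) mulVf // wij.
- by move=> x; apply: NS; exact: row_sub.
- by move=> x xs; rewrite (formZl hw) (NS _ _ (row_sub j N) xs) mulr0.
Qed.

Lemma transvectionK v s : cancel (transvection w v s) (transvection w v (- s)).
Proof.
move=> x; rewrite /transvection (formDr hw) (formZr hw) (formxx hw) // mulr0 addr0.
by rewrite mulNr scaleNr addrK.
Qed.

Lemma transvection_linear v s : linear (transvection w v s).
Proof.
move=> a x y; rewrite /transvection (formDr hw) (formZr hw) scalerDr scalerA.
by rewrite mulrDr scalerDl mulrCA addrACA.
Qed.

Lemma transvection_form v s x y :
  w (transvection w v s x) (transvection w v s y) = w x y.
Proof.
rewrite /transvection !(formDl hw) !(formDr hw) !(formZl hw) !(formZr hw) (formxx hw) //.
rewrite (formC hw x v); ring.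
Qed.

Lemma transvection_fix v s x : w v x = 0 -> transvection w v s x = x.
Proof. by move=> h; rewrite /transvection h mulr0 scale0r addr0. Qed.

Definition transvection_perm v s : {perm E} := perm (can_inj (transvectionK v s)).
End SymplecticGeometry.

Lemma transvection_Sp (F : finFieldType) d (omega : {skew_symmetric 'rV[F]_d})
    (hw : symplectic_form (form_fun omega)) (two_neq0 : 2 != 0 :> F) v s :
  transvection_perm hw two_neq0 v s \in Sp omega.
Proof.
apply/Sp_setP; split=> [a x y|x y]; rewrite !permE; first exact: transvection_linear.
exact: (transvection_form hw).
Qed.

(** * Vectors fixed by stabilizers of few points *)

Section ResolvedRepresentations.
Local Open Scope tcat_scope.
Variables (K : fieldType) (T : finType) (G : {group {perm T}}).
Local Notation RC := (rep_cat K G).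
Implicit Types (X Y M : RC).

(* The bound k on the number of points whose stabilizer fixes column j of C and row j
   of R can be chosen uniformly along the ultraproduct, whereas J cannot. *)
Definition resolved (k : nat) X := exists (J : nat) (C : 'M[K]_(rdim X, J))
    (R : 'M[K]_(J, rdim X)) (s : 'I_J -> seq T),
  C *m R = 1%:M /\ forall j, (size (s j) <= k)%N /\
    forall g : {perm T}, g \in G -> {in s j, forall x, g x = x} ->
      forall i, (X g *m C) i j = C i j /\ (R *m X g) j i = R j i.

Lemma resolved_leq k l X : (k <= l)%N -> resolved k X -> resolved l X.
Proof.
move=> kl [J [C [R [s [CR h]]]]]; exists J, C, R, s; split=> // j.
by have [sj hj] := h j; split=> //; exact: leq_trans sj kl.
Qed.

Lemma resolved_zero X : is_zero X -> resolved 0 X.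
Proof.
move=> /rep_is_zero; case: X => n r /= n0; exists 0%N, 0, 0, (fun _ => [::]).
by split=> [|[]//]; apply: mxP => x; exfalso; case: x => m /=; rewrite n0.
Qed.

Lemma resolved_unit : resolved 0 (𝟙 : RC).
Proof.
exists 1%N, 1%:M, 1%:M, (fun _ => [::]); split=> [|j]; first exact: mul1mx.
by split=> // g _ _ i; split; rewrite [rrep _ _]/= mul1mx.
Qed.

Lemma resolved_perm : resolved 1 (perm_rep K G).
Proof.
exists #|T|, 1%:M, 1%:M, (fun j => [:: enum_val j]); split=> [|j]; first exact: mul1mx.
split=> // g gG /(_ (enum_val j)); rewrite inE eqxx => /(_ isT) gj i.
rewrite mulmx1 mul1mx !mxE gj; split; congr (nat_of_bool _)%:R.
  by rewrite -{1}gj (inj_eq perm_inj) (inj_eq enum_val_inj) eq_sym.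
by rewrite (inj_eq enum_val_inj) eq_sym.
Qed.

Lemma resolved_tens k l X Y : resolved k X -> resolved l Y -> resolved (k + l) (X ⊗ Y).
Proof.
move=> [J [C [R [s [CR h]]]]] [J' [C' [R' [s' [CR' h']]]]].
exists (J * J')%N, (C *t C'), (R *t R'),
  (fun p => s (mxtens_unindex p).1 ++ s' (mxtens_unindex p).2).
split=> [|p]; first by rewrite tensmx_mul CR CR' tensmx1.
case: p / (mxtens_indexP p) => j j'; rewrite mxtens_indexK /=.
have [sj hj] := h j; have [sj' hj'] := h' j'.
split=> [|g gG fix_ p]; first by rewrite size_cat leq_add.
have f1 : {in s j, forall x, g x = x} by move=> x xs; apply: fix_; rewrite mem_cat xs.
have f2 : {in s' j', forall x, g x = x}.
  by move=> x xs; apply: fix_; rewrite mem_cat xs orbT.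
case: p / (mxtens_indexP p) => i i'.
have [e1 e2] := hj g gG f1 i; have [e1' e2'] := hj' g gG f2 i'.
by rewrite !tensmx_mul !tensmxE e1 e1' e2 e2'.
Qed.

Lemma resolved_biproduct k X Y M (p : hom M X) (i : hom X M) (q : hom M Y) (j : hom Y M) :
  hadd (p ;; i) (q ;; j) =~ idm M -> resolved k X -> resolved k Y -> resolved k M.
Proof.
move=> e [J [C [R [s [CR h]]]]] [J' [C' [R' [s' [CR' h']]]]].
exists (J + J')%N, (row_mx (hmx p *m C) (hmx q *m C')),
  (col_mx (R *m hmx i) (R' *m hmx j)),
  (fun a : 'I_(J + J') => match fintype.split a with inl b => s b | inr b => s' b end).
split=> [|a].
  rewrite mul_row_col -!mulmxA (mulmxA C) CR (mulmxA C') CR' !mul1mx; exact: e.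
rewrite -(fintype.splitK a); case: (fintype.split a) => b; rewrite fintype.unsplitK /=.
  have [sb hb] := h b; split=> // g gG fix_ z; have hg := hb g gG fix_.
  rewrite mul_mx_row mul_col_mx !row_mxEl !col_mxEu; split.
    rewrite mulmxA hmxP // -mulmxA mxE [RHS]mxE; apply: eq_bigr => y _.
    by rewrite (hg y).1.
  rewrite -mulmxA -hmxP // mulmxA mxE [RHS]mxE; apply: eq_bigr => y _.
  by rewrite (hg y).2.
have [sb hb] := h' b; split=> // g gG fix_ z; have hg := hb g gG fix_.
rewrite mul_mx_row mul_col_mx !row_mxEr !col_mxEd; split.
  rewrite mulmxA hmxP // -mulmxA mxE [RHS]mxE; apply: eq_bigr => y _.
  by rewrite (hg y).1.
rewrite -mulmxA -hmxP // mulmxA mxE [RHS]mxE; apply: eq_bigr => y _.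
by rewrite (hg y).2.
Qed.

Lemma resolved_retract k X M (a : hom X M) (c : hom M X) :
  a ;; c =~ idm X -> resolved k M -> resolved k X.
Proof.
move=> e [J [C [R [s [CR h]]]]]; exists J, (hmx a *m C), (R *m hmx c), s.
split=> [|j]; first by rewrite -mulmxA (mulmxA C) CR mul1mx; exact: e.
have [sj hj] := h j; split=> // g gG fix_ z; have hg := hj g gG fix_.
split.
  rewrite mulmxA hmxP // -mulmxA mxE [RHS]mxE; apply: eq_bigr => y _.
  by rewrite (hg y).1.
rewrite -mulmxA -hmxP // mulmxA mxE [RHS]mxE; apply: eq_bigr => y _.
by rewrite (hg y).2.
Qed.

Hypothesis G_neq0 : #|G|%:R != 0 :> K.

(* Maschke: the average over G of a pseudo-inverse is equivariant. *)
Lemma rep_regular X Y (f : hom X Y) : exists r : hom Y X, f ;; r ;; f =~ f.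
Proof.
have [P fPf] : exists P, hmx f *m P *m hmx f = hmx f.
  by exists (pinvmx (hmx f)); rewrite mulmxKpV ?submx_refl.
pose r := #|G|%:R^-1 *: \sum_(g in G) (Y g *m P *m X g^-1%g).
have rP : {in G, forall h, Y h *m r = r *m X h}.
  move=> h hG; rewrite /r -scalemxAr -scalemxAl mulmx_sumr mulmx_suml; congr (_ *: _).
  rewrite [RHS](reindex_inj (mulgI h)) /=; apply: eq_big => [g|g gG].
    by rewrite groupMl.
  rewrite !mulmxA -repr_mxM // -!mulmxA; congr (_ *m (_ *m _)).
  rewrite -repr_mxM ?groupV ?groupM // invMg -mulgA mulVg mulg1 //.
exists (RepHom rP); change (hmx f *m r *m hmx f = hmx f).
rewrite /r -scalemxAr -scalemxAl mulmx_sumr mulmx_suml.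
transitivity (#|G|%:R^-1 *: \sum_(g in G) hmx f).
  congr (_ *: _); apply: eq_bigr => g gG.
  rewrite !mulmxA -hmxP // -!mulmxA hmxP ?groupV // (mulmxA P) (mulmxA (hmx f)).
  rewrite (mulmxA (hmx f) P) fPf -hmxP ?groupV // mulmxA -repr_mxM ?groupV //.
  by rewrite mulgV repr_mx1 mul1mx.
by rewrite sumr_const -scaler_nat scalerA mulVf // scale1r.
Qed.

End ResolvedRepresentations.

Section UltraResolved.
Local Open Scope tcat_scope.
Variables (I : Type) (U : set_system I).
Context {FU : Filter U}.
Variables (K : fieldType) (T : I -> finType) (G : forall i, {group {perm T i}}).
Hypothesis G_neq0 : forall i, #|G i|%:R != 0 :> K.
Local Notation UC := (ultraproduct U (fun i => rep_cat K (G i))).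
Local Notation V := ((fun i => perm_rep K (G i)) : UC).

Lemma mono_split (C : tensorCat) (X Y : C) (f : hom X Y) (r : hom Y X) :
  is_mono f -> f ;; r ;; f =~ f -> f ;; r =~ idm X.
Proof. by move=> mf e; apply: mf; rewrite e comp_id_l. Qed.

Lemma epi_split (C : tensorCat) (X Y : C) (f : hom X Y) (r : hom Y X) :
  is_epi f -> f ;; r ;; f =~ f -> r ;; f =~ idm Y.
Proof. by move=> ef e; apply: ef; rewrite -comp_assoc e comp_id_r. Qed.

(** Being an equation, regularity passes from components to the ultraproduct, where it splits
    monomorphisms and epimorphisms. The components of a monomorphism of the ultraproduct need not be
    examined. *)
Lemma ultra_regular (X Y : UC) (f : hom X Y) : exists r : hom Y X, f ;; r ;; f =~ f.
Proof.
have h i : {r : hom (Y i) (X i) | f i ;; r ;; f i =~ f i}.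
  by apply: cid; exact: rep_regular.
exists (fun i => sval (h i)); apply: filterE => i; exact: (svalP (h i)).
Qed.

Lemma resolved_tpow n i : resolved n (tpow V n i).
Proof.
elim: n => [|n IH]; first exact: resolved_unit.
exact: (resolved_tens (resolved_perm K (G i)) IH).
Qed.

Lemma sum_of_powers_resolved (M : UC) : sum_of_powers V M ->
  exists k, U [set i | resolved k (M i)].
Proof.
elim=> {M} [M zM|n|X Y M _ [k Uk] _ [l Ul] [i [j [p [q [_ _ _ _ e]]]]]].
- by exists 0%N; apply: filterS zM => i; exact: resolved_zero.
- by exists n; apply: filterE => i; exact: resolved_tpow.
- exists (maxn k l); apply: filterS3 Uk Ul e => a rk rl e.
  apply: (resolved_biproduct e); apply: resolved_leq; [|exact: rk| |exact: rl].
    exact: leq_maxl.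
  exact: leq_maxr.
Qed.

(** Both halves of a subquotient split, so X is a retract of a sum of powers and keeps its bound
    k. *)
Lemma ultra_resolved (X : UC) : in_gen V X -> exists k, U [set i | resolved k (X i)].
Proof.
move=> [M /sum_of_powers_resolved [k Uk] [Z [m [e [mm ee]]]]]; exists k.
have [r mr] := ultra_regular m; have [r' er] := ultra_regular e.
have {}mr := mono_split mm mr; have {}er := epi_split ee er.
have : (r' ;; m) ;; (r ;; e) =~ idm X.
  by rewrite comp_assoc -(comp_assoc m) mr comp_id_l.
by apply: filterS2 Uk => i rk h; exact: (resolved_retract h rk).
Qed.

End UltraResolved.

(** * The square of the twisted group algebra does not split *)

Lemma row_tensE (K : fieldType) m n (x : 'rV[K]_m) (y : 'rV[K]_n) p q :
  (x *t y : 'rV_(m * n)) 0 (mxtens_index (p, q)) = x 0 p * y 0 q.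
Proof.
rewrite -tensmxE; congr (fun_of_matrix (x *t y : 'rV_(m * n)) _ _).
exact: val_inj.
Qed.

Section EndOperators.
Variables (K : fieldType) (n d : nat).
Variables (e : 'M[K]_(d * n, 1)) (c : 'M[K]_(1, n * d)).
Hypothesis ec : mx_dual e c.
Local Notation ix x y := (mxtens_index (x, y)).

Definition unvec (x : 'rV[K]_(n * d)) : 'M[K]_(n, d) := \matrix_(p, xi) x 0 (ix p xi).
Definition ev_mx : 'M[K]_(d, n) := \matrix_(xi, q) e (ix xi q) 0.
Definition coev_mx : 'M[K]_(n, d) := \matrix_(p, xi) c 0 (ix p xi).

(* p ⊗ ξ as the matrix of y ↦ ξ(y) p, acting on columns *)
Definition end_op (x : 'rV[K]_(n * d)) : 'M[K]_n := unvec x *m ev_mx.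
Definition end_elt (X : 'M[K]_n) : 'rV[K]_(n * d) :=
  \row_p (X *m coev_mx) (mxtens_unindex p).1 (mxtens_unindex p).2.

Lemma coev_evK : coev_mx *m ev_mx = 1%:M.
Proof.
have [h _] := ec; apply: mxP => p q; rewrite !mxE -h.
by apply: eq_bigr => xi _; rewrite !mxE.
Qed.

Lemma ev_coevK : ev_mx *m coev_mx = 1%:M.
Proof.
have [_ h] := ec; apply: mxP => p q; rewrite !mxE -h.
by apply: eq_bigr => xi _; rewrite !mxE.
Qed.

Lemma unvec_end_elt X : unvec (end_elt X) = X *m coev_mx.
Proof. by apply: mxP => p xi; rewrite !mxE mxtens_indexK. Qed.

Lemma unvec_inj : injective unvec.
Proof.
move=> x y /matrixP h; apply/rowP => p; case: p / (mxtens_indexP p) => i j.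
by have := h i j; rewrite !mxE.
Qed.

Lemma end_eltK : cancel end_elt end_op.
Proof. by move=> X; rewrite /end_op unvec_end_elt -mulmxA coev_evK mulmx1. Qed.

Lemma end_opK : cancel end_op end_elt.
Proof.
by move=> x; apply: unvec_inj; rewrite unvec_end_elt /end_op -mulmxA ev_coevK mulmx1.
Qed.

Lemma end_op_linear : linear end_op.
Proof.
move=> a x y; rewrite /end_op scalemxAl -mulmxDl; congr (_ *m _).
by apply: mxP => p xi; rewrite !mxE.
Qed.

Lemma end_opZ a x : end_op (a *: x) = a *: end_op x.
Proof.
by rewrite /end_op scalemxAl; congr (_ *m _); apply: mxP => p q; rewrite !mxE.
Qed.

Lemma end_op_sum (J : finType) (a : J -> K) (x : J -> 'rV[K]_(n * d)) :
  end_op (\sum_j a j *: x j) = \sum_j a j *: end_op (x j).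
Proof.
rewrite /end_op; under [RHS]eq_bigr => j _ do rewrite scalemxAl.
rewrite -mulmx_suml; congr (_ *m _); apply: mxP => p xi.
by rewrite !mxE !summxE; apply: eq_bigr => j _; rewrite !mxE.
Qed.

Lemma end_op_one : end_op c = 1%:M.
Proof. by rewrite -coev_evK; congr (_ *m _); apply: mxP => p xi; rewrite !mxE. Qed.

Lemma end_op_mul (x y : 'rV[K]_(n * d)) :
  end_op ((x *t y) *m end_mul e : 'rV_(n * d)) = end_op x *m end_op y.
Proof.
rewrite /end_op mulmxA; congr (_ *m _); apply: mxP => p zeta.
rewrite mxE [LHS]mxE [RHS]mxE big_mxtens big_mxtens (sum_only (z := p)); last first.
  move=> z ne; rewrite big1 // => xi _; rewrite big_mxtens big1 // => q _.
  by rewrite big1 // => eta _; rewrite end_mulE eq_sym (negPf ne) mul0r mulr0.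
under eq_bigr => xi _ do rewrite big_mxtens.
rewrite exchange_big; apply: eq_bigr => q _.
rewrite [unvec y _ _]mxE mxE mulr_suml; apply: eq_bigr => xi _.
rewrite (sum_only (z := zeta)); last first.
  by move=> eta /negPf ne; rewrite end_mulE ne !mulr0.
by rewrite row_tensE end_mulE !eqxx !mxE mul1r mulr1 mulrAC.
Qed.

Lemma end_elt_mul X Y : ((end_elt X *t end_elt Y) *m end_mul e : 'rV_(n * d)) = end_elt (X *m Y).
Proof. by apply: (can_inj end_opK); rewrite end_op_mul !end_eltK. Qed.

Lemma end_elt_one : end_elt 1%:M = c.
Proof. by apply: (can_inj end_opK); rewrite end_eltK end_op_one. Qed.

Lemma end_elt_linear : linear end_elt.
Proof.
by move=> a X Y; apply: (can_inj end_opK); rewrite end_op_linear !end_eltK.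
Qed.

(** Invariance of [e] forces the action D on the dual to be contragredient to A, which makes the
    action on P ⊗ P' a conjugation. Transposes appear because representations act on rows and
    [end_op] on columns. *)
Lemma end_op_conj (A A' : 'M[K]_n) (D : 'M[K]_d) (x : 'rV[K]_(n * d)) :
  A *m A' = 1%:M -> (D *t A) *m e = e ->
  end_op (x *m (A *t D)) = A^T *m end_op x *m A'^T.
Proof.
move=> AA' eD.
have DA : D *m ev_mx *m A^T = ev_mx.
  apply: mxP => xi q; have := congr1 (fun M : 'M[K]_(_, _) => M (ix xi q) 0) eD.
  rewrite mxE big_mxtens => h; rewrite [RHS]mxE -h [LHS]mxE exchange_big.
  apply: eq_bigr => z _; rewrite !mxE mulr_suml; apply: eq_bigr => eta _.
  by rewrite tensmxE !mxE mulrAC.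
have ux : unvec (x *m (A *t D)) = A^T *m unvec x *m D.
  apply: mxP => p xi; rewrite !mxE big_mxtens exchange_big; apply: eq_bigr => eta _.
  by rewrite !mxE mulr_suml; apply: eq_bigr => q _; rewrite tensmxE !mxE; ring.
rewrite /end_op ux -!mulmxA; congr (_ *m (_ *m _)).
by rewrite -{2}DA -!mulmxA -trmx_mul (mulmx1C AA') trmx1 mulmx1.
Qed.
End EndOperators.

Section SplitOperators.
Variables (F : finFieldType) (d : nat) (omega : {skew_symmetric 'rV[F]_d}).
Variables (K : fieldType) (psi : F -> K).
Hypotheses (psi_char : nontrivial_additive_character psi) (omega_symp : is_psymplectic omega).
Local Notation E := 'rV[F]_d.
Local Notation N := #|{: E}|.
Local Notation ix x y := (mxtens_index (x, y)).
Local Notation w := (form_fun omega).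
Local Notation V := (perm_rep K (Sp omega)).
Local Notation mu := (twisted_mul_mx omega psi).
Local Notation one := (twisted_one_mx F d K).
Let hw := psymplectic_form omega_symp.
Let hW := double_formP hw.

Lemma delta_tens p q (i : 'I_p) (j : 'I_q) :
  ((delta_mx 0 i : 'rV[K]_p) *t (delta_mx 0 j : 'rV[K]_q) : 'rV[K]_(p * q)) = delta_mx 0 (ix i j).
Proof.
apply/rowP => k; case: k / (mxtens_indexP k) => i' j'.
by rewrite row_tensE !mxE !eqxx /= (can_eq (@mxtens_indexK _ _)) xpair_eqE -natrM mulnb.
Qed.

Lemma tens_mul_rows p q (nu : 'M[K]_(p * p, p)) (nu' : 'M[K]_(q * q, q))
    (a b : 'rV[K]_p) (x y : 'rV[K]_q) :
  (((a *t x : 'rV_(p * q)) *t (b *t y : 'rV_(p * q)) : 'rV_((p * q) * (p * q)))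
    *m tens_mul nu nu' : 'rV_(p * q)) =
  ((a *t b : 'rV_(p * p)) *m nu) *t ((x *t y : 'rV_(q * q)) *m nu').
Proof.
rewrite /tens_mul mulmxA.
have -> : ((a *t x : 'rV_(p * q)) *t (b *t y : 'rV_(p * q)) : 'rV_((p * q) * (p * q)))
    *m swapmx K p q p q = (a *t b : 'rV_(p * p)) *t (x *t y : 'rV_(q * q)).
  apply/rowP => k; case: k / (mxtens_indexP k) => k l.
  case: k / (mxtens_indexP k) => i j; case: l / (mxtens_indexP l) => r s.
  by rewrite mul_swapmxE !row_tensE mulrACA.
exact: (tensmx_mul (a *t b : 'rV_(p * p)) (x *t y : 'rV_(q * q)) nu nu').
Qed.

Definition basis2 (u : E * E) : 'rV[K]_(N * N) :=
  delta_mx 0 (ix (enum_rank u.1) (enum_rank u.2)).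

Lemma basis2_mul u v : ((basis2 u *t basis2 v) *m tens_mul mu mu : 'rV_(N * N)) =
  psi (double_form w u v) *: basis2 (u + v).
Proof.
rewrite delta_tens -rowE; apply/rowP => k; case: k / (mxtens_indexP k) => k l.
rewrite [LHS]mxE [RHS]mxE [basis2 _ _ _]mxE tens_mulE !twisted_mulE !enum_rankK eqxx /=.
rewrite (can_eq (@mxtens_indexK _ _)) xpair_eqE -mulnb natrM (charD psi_char).
rewrite -(inj_eq enum_val_inj k) -(inj_eq enum_val_inj l) !enum_rankK; exact: mulrACA.
Qed.

Lemma basis2_one : basis2 0 = tens_one one one.
Proof.
apply/rowP => k; case: k / (mxtens_indexP k) => k l.
rewrite tens_oneE !mxE eqxx /= (can_eq (@mxtens_indexK _ _)) xpair_eqE -natrM mulnb.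
by rewrite -(inj_eq enum_val_inj k) -(inj_eq enum_val_inj l) !enum_rankK.
Qed.

Lemma basis2_perm g u : basis2 u *m (V g *t V g) = basis2 (g u.1, g u.2).
Proof.
rewrite -rowE; apply/rowP => k; case: k / (mxtens_indexP k) => k l.
rewrite [LHS]mxE tensmxE !perm_repE !enum_rankK !mxE eqxx /=.
rewrite (can_eq (@mxtens_indexK _ _)) xpair_eqE -natrM mulnb.
by rewrite -(inj_eq enum_val_inj k) -(inj_eq enum_val_inj l) !enum_rankK.
Qed.

Variables (n dn m dm : nat) (e : 'M[K]_(dn * n, 1)) (c : 'M[K]_(1, n * dn)).
Variables (e' : 'M[K]_(dm * m, 1)) (c' : 'M[K]_(1, m * dm)).
Hypotheses (ec : mx_dual e c) (ec' : mx_dual e' c').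
Variables (Phi : 'M[K]_((N * N) * (n * dn), m * dm)) (Phi' : 'M[K]_(m * dm, (N * N) * (n * dn))).
Hypothesis PhiV : Phi' *m Phi = 1%:M.
Hypothesis Phi_mul :
  tens_mul (tens_mul mu mu) (end_mul e) *m Phi = (Phi *t Phi) *m end_mul e'.
Hypothesis Phi_one : tens_one (tens_one one one) c *m Phi = c'.

Definition split_elt (u : E * E) (X : 'M[K]_n) : 'rV[K]_((N * N) * (n * dn)) :=
  basis2 u *t end_elt c X.
(** The image in the matrices of Q of [u1] ⊗ [u2] ⊗ X. With X = 1 it gives the Heisenberg operators
    b u of E ⊕ E, and with u = 0 the action D of End P. *)
Definition rho (u : E * E) (X : 'M[K]_n) : 'M[K]_m := end_op e' (split_elt u X *m Phi).

Lemma split_elt_mul u v X Y :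
  ((split_elt u X *t split_elt v Y) *m tens_mul (tens_mul mu mu) (end_mul e)
    : 'rV_((N * N) * (n * dn)))
  = psi (double_form w u v) *: split_elt (u + v) (X *m Y).
Proof.
apply: etrans (tens_mul_rows _ _ _ _ _ _) _; apply/rowP => k.
case: k / (mxtens_indexP k) => k l.
rewrite row_tensE basis2_mul (end_elt_mul ec) [X in X * _]mxE [RHS]mxE row_tensE.
by rewrite mulrA.
Qed.

Lemma rho_mul u v X Y :
  rho u X *m rho v Y = psi (double_form w u v) *: rho (u + v) (X *m Y).
Proof.
have H (x y : 'rV[K]_((N * N) * (n * dn))) :
    (((x *m Phi) *t (y *m Phi)) *m end_mul e' : 'rV_(m * dm)) =
    ((x *t y) *m tens_mul (tens_mul mu mu) (end_mul e) : 'rV_((N * N) * (n * dn))) *m Phi.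
  rewrite -mulmxA Phi_mul mulmxA; congr (_ *m _); exact: esym (tensmx_mul x y Phi Phi).
by rewrite /rho -(end_op_mul e') H split_elt_mul -scalemxAl end_opZ.
Qed.

Lemma rho_one : rho 0 1%:M = 1%:M.
Proof.
rewrite /rho -(end_op_one ec') -Phi_one; congr (end_op _ (_ *m _)); apply/rowP => k.
by case: k / (mxtens_indexP k) => k l; rewrite row_tensE tens_oneE basis2_one (end_elt_one ec).
Qed.

Lemma rho_linear u : linear (rho u).
Proof.
move=> a X Y; rewrite /rho -end_op_linear; congr (end_op _ _).
rewrite scalemxAl -mulmxDl; congr (_ *m _); apply/rowP => k.
case: k / (mxtens_indexP k) => k l.
rewrite [RHS]mxE [X in _ = X + _]mxE !row_tensE (end_elt_linear ec).
by rewrite [X in _ * X = _]mxE [X in _ * (X + _) = _]mxE mulrDr mulrCA.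
Qed.

Let b u := rho u 1%:M.
Let D := rho 0.

Lemma rho_op_mul X Y : D X *m D Y = D (X *m Y).
Proof.
by rewrite /D rho_mul (form0l hW) (char0 psi_char) scale1r addr0.
Qed.

Lemma rho_split u X : rho u X = b u *m D X.
Proof.
by rewrite /D rho_mul (form0r hW) (char0 psi_char) scale1r addr0 mul1mx.
Qed.

Lemma rho_comm u X : D X *m b u = b u *m D X.
Proof.
by rewrite -rho_split /D rho_mul (form0l hW) (char0 psi_char) scale1r add0r mulmx1.
Qed.

(* As Phi and [end_op] are onto, the operators [rho u X] span all matrices. *)
Lemma rho_scalar (M : 'M[K]_m) : (forall u, M *m b u = b u *m M) ->
  (forall X, M *m D X = D X *m M) -> exists a, M = a%:M.
Proof.
move=> Mb MD.
have Mr u X : M *m rho u X = rho u X *m M.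
  by rewrite rho_split mulmxA Mb -(mulmxA (b u)) MD (mulmxA (b u)).
have Mk k : M *m end_op e' (delta_mx 0 k *m Phi) = end_op e' (delta_mx 0 k *m Phi) *m M.
  case: k / (mxtens_indexP k) => k l; case: k / (mxtens_indexP k) => i j.
  have := Mr (enum_val i, enum_val j) (end_op e (delta_mx 0 l)).
  by rewrite /rho /split_elt (end_opK ec) /basis2 /= !enum_valK delta_tens.
have Mx (x : 'rV[K]_((N * N) * (n * dn))) :
    M *m end_op e' (x *m Phi) = end_op e' (x *m Phi) *m M.
  rewrite (row_sum_delta x) mulmx_suml.
  under eq_bigr => k _ do rewrite -scalemxAl.
  rewrite end_op_sum mulmx_sumr mulmx_suml; apply: eq_bigr => k _.
  by rewrite -scalemxAr -scalemxAl Mk.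
have MY (Y : 'M[K]_m) : M *m Y = Y *m M.
  have := Mx (end_elt c' Y *m Phi'); rewrite -mulmxA PhiV mulmx1.
  by rewrite (end_eltK ec').
case: (posnP m) => [m0|m_gt0].
  by exists 0; apply: mxP => i; exfalso; case: i => i; rewrite m0.
pose i0 := Ordinal m_gt0; exists (M i0 i0); apply: mxP => i j.
have /matrixP/(_ i0 j) := MY (delta_mx i0 i); rewrite !mxE.
rewrite (sum_only (z := i0)) => [|k /negPf ne]; last by rewrite mxE ne /= mulr0.
rewrite [X in _ = X -> _](sum_only (z := i)) => [|k /negPf ne]; last first.
  by rewrite mxE ne andbF mul0r.
by rewrite !mxE !eqxx /= mul1r => <-; rewrite eq_sym mulr_natr.
Qed.

Lemma rho_conj g (A A' : 'M[K]_n) (Dg : 'M[K]_dn) (B B' : 'M[K]_m) (Dg' : 'M[K]_dm) u X :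
  (Dg *t A) *m e = e -> A *m A' = 1%:M -> (Dg' *t B) *m e' = e' -> B *m B' = 1%:M ->
  ((V g *t V g) *t (A *t Dg)) *m Phi = Phi *m (B *t Dg') ->
  rho (g u.1, g u.2) (A^T *m X *m A'^T) = B^T *m rho u X *m B'^T.
Proof.
move=> eA AA' eB BB' eqv.
rewrite /rho -(end_op_conj _ BB' eB) -(mulmxA (split_elt u X)) -eqv mulmxA; congr (end_op _ (_ *m _)).
rewrite /split_elt -basis2_perm.
have -> : end_elt c (A^T *m X *m A'^T) = end_elt c X *m (A *t Dg).
  by apply: (can_inj (end_opK ec)); rewrite (end_op_conj _ AA' eA) !(end_eltK ec).
exact: esym (tensmx_mul (basis2 u) (end_elt c X) (V g *t V g) (A *t Dg)).
Qed.
Section Lift.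
Variables (g : {perm E}) (A A' : 'M[K]_n) (Dg : 'M[K]_dn) (B B' : 'M[K]_m) (Dg' : 'M[K]_dm).
Hypotheses (eA : (Dg *t A) *m e = e) (AA' : A *m A' = 1%:M).
Hypotheses (eB : (Dg' *t B) *m e' = e') (BB' : B *m B' = 1%:M).
Hypothesis eqv : ((V g *t V g) *t (A *t Dg)) *m Phi = Phi *m (B *t Dg').

(** The action of g on Q transforms both the b u and the D X. The factor D A^T undoes its effect on
    End P, leaving an operator that commutes with the D X and still moves b u as g does. *)
Definition lift_op := D A^T *m B'^T.

Let A'A : A'^T *m A^T = 1%:M. Proof. by rewrite -trmx_mul AA' trmx1. Qed.
Let AA'T : A^T *m A'^T = 1%:M. Proof. by rewrite -trmx_mul (mulmx1C AA') trmx1. Qed.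
Let BT : B'^T *m B^T = 1%:M. Proof. by rewrite -trmx_mul BB' trmx1. Qed.

Let conj u X : B'^T *m rho (g u.1, g u.2) (A^T *m X *m A'^T) = rho u X *m B'^T.
Proof. by rewrite (rho_conj u X eA AA' eB BB' eqv) !mulmxA BT mul1mx. Qed.

Let conjD (g0 : g 0 = 0) X : B'^T *m D (A^T *m X *m A'^T) = D X *m B'^T.
Proof. by rewrite -conj /= g0. Qed.

Lemma lift_op_b u : b u *m lift_op = lift_op *m b (g u.1, g u.2).
Proof.
have := conj u 1%:M; rewrite mulmx1 AA'T => h.
by rewrite /lift_op mulmxA -rho_comm -!(mulmxA (D _)) -h.
Qed.

Lemma lift_op_D (g0 : g 0 = 0) X : lift_op *m D X = D X *m lift_op.
Proof.
have E1 : A^T *m (A'^T *m X *m A^T) = X *m A^T by rewrite !mulmxA AA'T mul1mx.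
have := conjD g0 (A'^T *m X *m A^T); rewrite E1 -(mulmxA X) AA'T mulmx1 => h.
by rewrite /lift_op -(mulmxA (D _)) h (mulmxA (D A^T)) (mulmxA (D X)) !rho_op_mul E1.
Qed.

Lemma lift_op_unit : lift_op \in unitmx.
Proof.
have /mulmx1_unit [] // : lift_op *m (B^T *m D A'^T) = 1%:M.
rewrite /lift_op -(mulmxA (D _)) (mulmxA B'^T) BT mul1mx rho_op_mul AA'T.
exact: rho_one.
Qed.

(** The correction D A^T would move an invariant vector x of Q, so x is first multiplied by D Y with
    Y invariant from the left. Moving B' past D (Y A^T) turns this operator back into D Y. *)
Lemma lift_op_fix (g0 : g 0 = 0) (x : 'rV[K]_m) (Y : 'M[K]_n) :
  x *m B'^T = x -> A^T *m Y = Y -> (x *m D Y) *m lift_op = x *m D Y.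
Proof.
move=> xB AY; rewrite /lift_op -(mulmxA x) (mulmxA (D Y)) rho_op_mul.
have := conjD g0 (Y *m A^T); rewrite (mulmxA A^T) AY -(mulmxA Y) AA'T mulmx1 => <-.
by rewrite mulmxA xB.
Qed.
End Lift.
End SplitOperators.

Section NoSplit.
Local Open Scope tcat_scope.
Variables (F : finFieldType) (d : nat) (omega : {skew_symmetric 'rV[F]_d}).
Variables (K : fieldType) (psi : F -> K).
Hypotheses (two_neq0 : 2 != 0 :> F) (psi_char : nontrivial_additive_character psi).
Hypotheses (omega_symp : is_psymplectic omega) (card_neq0 : #|F|%:R != 0 :> K).
Hypothesis N1_nonsquare : ~ exists a : F, a ^+ 2 = -1.
Local Notation E := 'rV[F]_d.
Local Notation w := (form_fun omega).
Local Notation RC := (rep_cat K (Sp omega)).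
Local Notation A := (twisted_alg omega psi).
Local Notation mu := (twisted_mul_mx omega psi).
Let hw := psymplectic_form omega_symp.

Variables (P P' Q Q' : RC) (e : hom (P' ⊗ P) 𝟙) (c : hom 𝟙 (P ⊗ P')).
Variables (e' : hom (Q' ⊗ Q) 𝟙) (c' : hom 𝟙 (Q ⊗ Q')).
Hypotheses (ec : is_dual e c) (ec' : is_dual e' c').

Lemma alg_iso_mx :
  alg_iso (tens_alg (tens_alg A A) (end_alg_of e c)) (end_alg_of e' c') ->
  exists (Phi : 'M[K]_((#|{: E}| * #|{: E}|) * (rdim P * rdim P'), rdim Q * rdim Q'))
         (Phi' : 'M[K]_(rdim Q * rdim Q', (#|{: E}| * #|{: E}|) * (rdim P * rdim P'))),
  [/\ Phi' *m Phi = 1%:M,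
      tens_mul (tens_mul mu mu) (end_mul (hmx e)) *m Phi = (Phi *t Phi) *m end_mul (hmx e'),
      tens_one (tens_one (twisted_one_mx F d K) (twisted_one_mx F d K)) (hmx c) *m Phi = hmx c'
    & {in Sp omega, forall g, ((perm_rep K (Sp omega) g *t perm_rep K (Sp omega) g)
         *t (P g *t P' g)) *m Phi = Phi *m (Q g *t Q' g)}].
Proof.
move=> [f [[f' [_ f'f]] fM f1]]; exists (hmx f), (hmx f'); split.
- exact: f'f.
- have e1 : hmx (amul (tens_alg A A)) = tens_mul mu mu := hmx_tens_amul A A.
  have e2 : hmx (amul (tens_alg (tens_alg A A) (end_alg_of e c))) =
      tens_mul (tens_mul mu mu) (end_mul (hmx e)).
    apply: etrans (hmx_tens_amul (tens_alg A A) (end_alg_of e c)) _.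
    exact: (f_equal2 (@tens_mul K (#|{: E}| * #|{: E}|) (rdim P * rdim P')) e1 (hmx_end_amul e c)).
  apply: etrans (congr1 (fun M : 'M[K]_(_, _) => M *m hmx f) (esym e2)) _.
  exact: fM.
- exact: f1.
- exact: (hmxP f).
Qed.
Lemma ev_invariant (X Y : RC) (v : hom (Y ⊗ X) 𝟙) g :
  g \in Sp omega -> (Y g *t X g) *m hmx v = hmx v.
Proof. by move=> gG; apply: etrans (hmxP v gG) _; rewrite mulmx1. Qed.

Lemma rep_inv (X : RC) g : g \in Sp omega -> X g *m X g^-1%g = 1%:M.
Proof. by move=> gG; rewrite -repr_mxM ?groupV // mulgV repr_mx1. Qed.

(* A covector of P and a vector of Q fixed by the stabilizer of few points would give a
   vector which is invariant under the transvections of the orthogonal of these points. *)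
Lemma no_split k l : resolved k P -> resolved l Q -> (2 * (k + l + 2) < d)%N ->
  alg_iso (tens_alg (tens_alg A A) (end_alg_of e c)) (end_alg_of e' c') -> is_zero Q.
Proof.
move=> [J [C [R [s [CR h]]]]] [J' [C' [R' [s' [CR' h']]]]] kld.
move=> /alg_iso_mx [Phi [Phi' [PhiV PhiM Phi1 PhiG]]].
have mec := (rep_is_dual _ _).1 ec; have mec' := (rep_is_dual _ _).1 ec'.
pose rh := rho (hmx c) (hmx e') Phi; pose D := rh 0.
have la0 i j : (col i C')^T *m D ((row j R)^T *m (col j C)^T) = 0.
  pose t := s' i ++ s j.
  have [sj hj] := h j; have [si hi] := h' i.
  have st : (size t <= k + l)%N by rewrite size_cat addnC leq_add.
  have [|e1 [f1 [e1f1 te1 tf1]]] := hyperbolic_pair hw (s := t).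
    apply: leq_ltn_trans kld; rewrite leq_mul2l /=; apply: leq_trans st _.
    exact: leq_addr.
  (* The second pair is also orthogonal to the first, hence to k + l + 2 vectors, which gives the
     bound on d. *)
  have [|e2 [f2 [e2f2 te2 tf2]]] := hyperbolic_pair hw (s := e1 :: f1 :: t).
    by apply: leq_ltn_trans kld; rewrite leq_mul2l /= addn2 !ltnS.
  have fixP v a (T := transvection_perm hw two_neq0 v a) :
      (forall y, y \in t -> w v y = 0) -> {in t, forall y, T y = y}.
    by move=> vt y yt; rewrite permE; apply: transvection_fix; exact: vt.
  apply: (@no_transvection_invariant F K psi two_neq0 psi_char card_neq0 N1_nonsquare
    E w hw (rdim Q) (fun u => rh u 1%:M) (fun M => exists X, M = D X) _
    (fun x => forall y, y \in t -> w x y = 0) _ _ _ _ _ _ _ e1 f1 e2 f2) => //.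
  - exact: (rho_one mec mec' Phi1).
  - by move=> u v; rewrite (rho_mul psi_char mec PhiM) mulmx1.
  - move=> _ [X ->] u; exact: (rho_comm psi_char omega_symp mec PhiM).
  - move=> M Mb MD; apply: (rho_scalar psi_char omega_symp mec mec' PhiV PhiM) => // X.
    by apply: MD; exists X.
  - by move=> x y xt yt z zt; rewrite (formDl hw) xt // yt // addr0.
  - by move=> a x xt z zt; rewrite (formZl hw) xt // mulr0.
  - move=> v a vt; pose T := transvection_perm hw two_neq0 v a.
    have TG : T \in Sp omega by exact: transvection_Sp.
    have T0 : T 0 = 0 by rewrite permE /transvection (form0r hw) mulr0 scale0r addr0.
    have Tt := fixP v a vt.
    exists (lift_op (hmx c) (hmx e') Phi (P T) (Q T^-1%g)).
    have eP := ev_invariant e TG; have eQ := ev_invariant e' TG.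
    have iP := rep_inv P TG; have iQ := rep_inv Q TG.
    split.
    + move=> u; have -> : (transvection w v a u.1, transvection w v a u.2) = (T u.1, T u.2).
        by rewrite !permE.
      exact: (lift_op_b psi_char omega_symp mec PhiM eP iP eQ iQ (PhiG T TG)).
    + move=> _ [X ->].
      exact: (lift_op_D psi_char omega_symp mec PhiM eP iP eQ iQ (PhiG T TG)).
    + exact: (lift_op_unit psi_char omega_symp mec mec' PhiM Phi1 iP iQ).
    + apply: (lift_op_fix psi_char omega_symp mec PhiM eP iP eQ iQ (PhiG T TG)) => //.
      * rewrite -trmx_mul; congr trmx; apply: mxP => x y.
        (* The lift contains the action of the inverse of T on Q, and the inverse fixes the same
           points. *)
        have TVt : {in s' i, forall y, T^-1%g y = y}.
          move=> z zs; apply: (perm_inj (s := T)); rewrite permKV Tt //.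
          by rewrite mem_cat zs.
        have [hx _] := hi _ (groupVr TG) TVt x.
        by move: hx; rewrite !mxE => <-; apply: eq_bigr => z _; rewrite !mxE.
      * rewrite mulmxA -trmx_mul; congr (trmx _ *m _); apply: mxP => x y.
        have Tsj : {in s j, forall y, T y = y}.
          by move=> z zs; apply: Tt; rewrite mem_cat zs orbT.
        have [_ hy] := hj _ TG Tsj y.
        by move: hy; rewrite !mxE => <-; apply: eq_bigr => z _; rewrite !mxE.
  - by move=> y yt; apply: te2; rewrite !inE yt !orbT.
  - by move=> y yt; apply: tf2; rewrite !inE yt !orbT.
  - by rewrite (formC hw) te2 ?oppr0 // inE eqxx.
  - by rewrite (formC hw) tf2 ?oppr0 // inE eqxx.
  - by rewrite (formC hw) te2 ?oppr0 // !inE eqxx orbT.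
(* The rank-one operators in [la0] add up to the transpose of C R = 1, so each column of C' is a sum
   of vectors that vanish by [la0]. Then C' R' = 1 leaves only Q = 0. *)
have sumRC : \sum_j (row j R)^T *m (col j C)^T = 1%:M.
  apply: etrans (_ : (C *m R)^T = _); last by rewrite CR trmx1.
  apply: mxP => x y; rewrite summxE !mxE; apply: eq_bigr => j _.
  by rewrite !mxE big_ord1 !mxE mulrC.
have C'0 i : (col i C')^T = 0.
  have D1 : D 1%:M = 1%:M := rho_one mec mec' Phi1.
  have DD X Y : D (X + Y) = D X + D Y.
    by have := rho_linear (hmx e') mec Phi 0 1 X Y; rewrite !scale1r.
  have D0 : D 0 = 0 by apply: (addrI (D 0)); rewrite -DD !addr0.
  rewrite -[LHS]mulmx1 -D1 -sumRC (big_morph D DD D0) mulmx_sumr big1 // => j _.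
  exact: la0.
have C0 : C' = 0.
  apply: mxP => x i; have /matrixP/(_ 0 x) := C'0 i.
  by rewrite !mxE.
by apply: etrans (esym CR') _; rewrite C0 mul0mx.
Qed.

End NoSplit.

(** * The interpolation category *)

Section Interpolation.
Local Open Scope tcat_scope.
Variables (I : Type) (U : set_system I) (U_ultra : UltraFilter U).
Variables (F : finFieldType) (d : I -> nat) (omega : forall i, {skew_symmetric 'rV[F]_(d i)}).
Variables (K : fieldType) (psi : F -> K).
Hypothesis K_char0 : forall n : nat, n.+1%:R != 0 :> K.
Hypothesis two_neq0 : 2 != 0 :> F.
Hypothesis N1_nonsquare : ~ exists a : F, a ^+ 2 = -1.
Hypothesis d_lim : forall n : nat, ~ (\forall i \near U, d i = n).
Hypothesis omega_symp : forall i, is_psymplectic (omega i).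
Hypothesis psi_char : nontrivial_additive_character psi.
Local Notation C := (sp_interpolation U omega K).
Local Notation A := (sp_twisted_alg U omega psi : algebra C).

Lemma card_neq0 (T : finType) (x : T) : #|T|%:R != 0 :> K.
Proof. by have : (0 < #|T|)%N by [apply/card_gt0P; exists x]; case: #|T|. Qed.

Lemma sp_coherent : coherent C.
Proof. by apply: full_coherent; apply: ultra_coherent => i; exact: rep_coherent. Qed.

(** If d were bounded on a large set, the ultrafilter would single out one of its finitely many
    values as the limit. *)
Lemma sp_dim_large n : \forall i \near U, (n < d i)%N.
Proof.
apply: contrapT => /(ultraN U_ultra) h.
have {}h : U [set i | (d i <= n)%N].
  by apply: filterS h => i /= /negP; rewrite -leqNgt.
elim: n h => [|n IH] h.
  by apply: (d_lim (n := 0)); apply: filterS h => i /=; rewrite leqn0 => /eqP.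
have [Un|/(ultraN U_ultra) Un] := pselect (U [set i | (d i <= n)%N]); first exact: IH.
apply: (d_lim (n := n.+1)); apply: filterS2 h Un => i /= le /negP.
by rewrite -ltnNge => lt; apply/eqP; rewrite eqn_leq le lt.
Qed.

Lemma sp_twisted_azumaya : azumaya A.
Proof.
pose e i := perm_ev (omega i) K; pose c i := perm_coev (omega i) K.
refine (@full_azumaya (@sp_ultraproduct I U _ F d omega K) _ _ _
  (ultra_alg (U := U) (fun i => twisted_alg (omega i) psi)) (in_gen_self _)
  (fun i => perm_rep K (Sp (omega i))) (in_gen_self _) e c _ _ _).
- apply: ultra_alg_laws; apply: filterE => i.
  exact: (twisted_alg_laws psi_char (omega_symp i)).
- by apply: ultra_is_dual; apply: filterE => i; exact: perm_is_dual.
- apply: ultra_sandwich => i.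
  exact: (twisted_sandwich_iso two_neq0 psi_char (omega_symp i)
    (card_neq0 (0 : 'rV[F]_(d i)))).
Qed.
Lemma sp_twisted_nonzero : ~ is_zero (aobj A).
Proof.
move=> Uz; have [i z] := filter_ex (Uz : U _).
have n0 := (rep_is_zero (perm_rep K (Sp (omega i)))).1 z.
by have := card_neq0 (0 : 'rV[F]_(d i)); rewrite -[#|_|]/(rdim (perm_rep K (Sp (omega i)))) n0 eqxx.
Qed.

Lemma sp_twisted_square_op : alg_iso (tens_alg A A) (tens_alg (op_alg A) (op_alg A)).
Proof.
have [a [b ab]] := sum_two_squares_N1 F.
refine (@full_square_op (@sp_ultraproduct I U _ F d omega K) _ _ _
  (ultra_alg (U := U) (fun i => twisted_alg (omega i) psi)) (in_gen_self _) _).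
apply: ultra_square_op => i.
exact: (twisted_square_op psi_char (omega_symp i) ab).
Qed.
Lemma sp_twisted_no_split : ~ brauer_equiv (tens_alg A A) (unit_alg C).
Proof.
move=> /(brauer_square_splits sp_coherent).
move=> [X [Y [X' [Y' [e [c [e' [c' [nz h]]]]]]]]].
have {}h : \forall i \near U, @square_splits (rep_cat K (Sp (omega i)))
    (twisted_alg (omega i) psi) (sval X i) (sval Y i) (sval X' i) (sval Y' i)
    (e i) (c i) (e' i) (c' i).
  refine (square_splits_comp (@full_square_splits (@sp_ultraproduct I U _ F d omega K) _ _ _
    (ultra_alg (U := U) (fun i => twisted_alg (omega i) psi)) (in_gen_self _)
    X Y X' Y' e c e' c' h)).
have G_neq0 i : #|Sp (omega i)|%:R != 0 :> K.
  by have := cardG_gt0 (Sp (omega i)); case: #|_|.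
have [k Uk] := ultra_resolved G_neq0 (svalP X).
have [l Ul] := ultra_resolved G_neq0 (svalP X').
have Uz : U [set i | is_zero (sval X' i)]; last exact: nz Uz.
have Ukl : U ([set i | resolved k (sval X i)] `&` [set i | resolved l (sval X' i)]).
  exact: filterI.
apply: filterS3 Ukl (sp_dim_large (2 * (k + l + 2))) h => i [rk rl] dl [d1 d2 hi].
exact: (no_split two_neq0 psi_char (omega_symp i) (card_neq0 (0 : F)) N1_nonsquare d1 d2 rk rl dl hi).
Qed.
End Interpolation.

Theorem corollary6p12 (R : realType)
    (F : finFieldType) (F_odd : odd #|F|) (F_N1 : ~ exists a : F, a ^+ 2 = -1)
    (I : Type) (I_inf : infinite_set [set: I])
    (U : set_system I) (U_ultra : UltraFilter U)
    (U_nonprincipal : forall i : I, U <> principal_filter i)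
    (d : I -> nat) (d_lim : forall n : nat, ~ (\forall i \near U, d i = n))
    (omega : forall i : I, {skew_symmetric 'rV[F]_(d i)})
    (omega_symp : forall i : I, is_psymplectic (omega i))
    (psi : F -> R[i]) (psi_char : nontrivial_additive_character psi) :
  let C := sp_interpolation U omega R[i] in
  let A : algebra C := sp_twisted_alg U omega psi in
  azumaya A /\ (brauer_cycle (brauer_class A) #= `I_4)%card.

Proof.
move=> C A.
have two_neq0 := odd_field_two_neq0 F_odd.
have K_char0 n : n.+1%:R != 0 :> R[i] by rewrite pnatr_eq0.
have coh := sp_coherent U_ultra omega R[i].
have az : azumaya A := sp_twisted_azumaya U_ultra K_char0 two_neq0 omega_symp psi_char.
split=> //; apply: (brauer_cycle_card4 coh).
- by split=> //; exact: (sp_twisted_nonzero K_char0).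
- exact: (brauer_iso coh (sp_twisted_square_op U_ultra omega_symp psi_char)).
- exact: (sp_twisted_no_split K_char0 two_neq0 F_N1 d_lim omega_symp psi_char).
Qed.
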